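(* For $\epsilon\in\{0,1\}$ and an integer $k\geq1$, the associations $A\mapsto\mathfrak{d}_kA:=\Sigma^{2k+5}DA$ and $A\mapsto\Sigma^{-3}\Omega A$, for $A\in\mathscr{O}_{k,\epsilon}$, induce an action of the dihedral group $D_8$ of order $8$ on $\mathscr{O}_{k,\epsilon}$. The action of the centre $\mathbb{Z}/2\subset D_8$ corresponds to $A\mapsto A\otimes J$. Moreover, the fixed points $\mathscr{O}_{k,\epsilon}^{\mathfrak{d}_k}$ under the duality operator have cardinal $2$ if $k\equiv0\bmod2$ and $0$ if $k\equiv1\bmod2$, and $(\Sigma^{-3}\Omega)^tA_{k,\epsilon}$ is a $\mathfrak{d}_k$-fixed point if and only if $(\Sigma^{-3}\Omega)^tA_{k,\epsilon}\otimes J\simeq(\Sigma^{-3}\Omega)^{t+2}A_{k,\epsilon}$ is.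
   Context: $\mathbb{F}=\mathbb{F}_2$; $\mathscr{A}(1)$ is the sub-Hopf algebra of the mod 2 Steenrod algebra generated by $Sq^1,Sq^2$. Modules are $\mathbb{Z}$-graded, $\otimes$ is over $\mathbb{F}$ with the diagonal action, $(\Sigma M)^n=M^{n-1}$; $D$ is the vector space duality functor on $\mathscr{A}(1)$-modules, $(DM)^n=\mathrm{Hom}(M^{-n},\mathbb{F})$. $\simeq$ is stable isomorphism of $\mathscr{A}(1)$-modules (maps factoring through projectives are killed). A module is reduced if $Sq^2Sq^2Sq^2$ acts trivially; every bounded-below module is free $\oplus\,M^{\mathrm{red}}$ with $M^{\mathrm{red}}$ reduced. $\Omega\mathbb{F}$ is the augmentation ideal of $\mathscr{A}(1)$; $\Omega^nM=((\Omega\mathbb{F})^{\otimes n}\otimes M)^{\mathrm{red}}$ for $n\geq0$. $J=\Sigma^{-2}\big(\mathscr{A}(1)/\mathscr{A}(1)Sq^1Sq^2\big)$ (the Joker). $A_{k,\epsilon}$ is the kernel of the unique non-trivial morphism $\Sigma^{-(k+1)}\Omega^{k+1}J^{\otimes\epsilon}\to\mathbb{F}$. $\mathscr{O}_{k,\epsilon}$ is the set of stable isomorphism classes represented by $\{(\Sigma^{-3}\Omega)^tA_{k,\epsilon}\mid0\leq t\leq3\}$. $D_8$ is the non-trivial semi-direct product $\mathbb{Z}/4\rtimes\mathbb{Z}/2$, with $\mathbb{Z}/4$ acting through $\Sigma^{-3}\Omega$ and $\mathbb{Z}/2$ through $\mathfrak{d}_k$. *)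

(* Defs.v *)
(* Written with Mathematical Components. *)
From HB Require Import structures.
From mathcomp Require Import all_boot all_order all_algebra all_fingroup.
From mathcomp Require Import all_solvable mxtens.
From mathcomp Require Import boolp classical_sets functions cardinality.

Set Implicit Arguments.
Unset Strict Implicit.
Unset Printing Implicit Defensive.
Import GRing.Theory.
Local Open Scope ring_scope.

(* The mod 2 Steenrod algebra is the universal F_2-algebra on elements Sq^i
   with Sq^0 = 1 subject to the Adem relations. *)
Definition adem (E : pzRingType) (Sq : nat -> E) : Prop :=
  Sq 0%N = 1 /\
  forall a b : nat, (0 < a < b.*2)%N ->
    Sq a * Sq b =
      \sum_(c < a./2.+1) (Sq (a + b - c)%N * Sq c) *+ 'C(b - c - 1, a - c.*2).

(* Non-commutative polynomials over F_2 in Sq^1 and Sq^2, as lists of words;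
   the letter b : bool stands for Sq^(b+1). *)
Definition ncpoly := seq (seq bool).

Definition ev (E : pzRingType) (s : bool -> E) (p : ncpoly) : E :=
  \sum_(w <- p) \prod_(b <- w) s b.

(* p vanishes in the Steenrod algebra. Hence A(1), the subalgebra generated by
   Sq^1 and Sq^2, is the quotient of the free algebra on two letters by
   steenrod_rel. *)
Definition steenrod_rel (p : ncpoly) : Prop :=
  forall (E : algType 'F_2) (Sq : nat -> E),
    adem Sq -> ev (fun b : bool => Sq b.+1) p = 0.

(* A finite dimensional Z-graded left A(1)-module, in a homogeneous basis
   indexed by 'I_dim. Operators act on column vectors: sq b i j is the
   coefficient of the i-th basis element in Sq^(b+1) of the j-th one, and
   sq_rel says that the action of the free algebra factors through A(1). *)
Record gmod := GMod {
  dim : nat;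
  deg : 'I_dim -> int;
  sq : bool -> 'M['F_2]_dim;
  sq_deg : forall (b : bool) (i j : 'I_dim),
    sq b i j != 0 -> deg i = deg j + (b.+1)%:Z;
  sq_rel : forall p : ncpoly, steenrod_rel p -> ev sq p = 0
}.

HB.instance Definition _ := gen_eqMixin gmod.
HB.instance Definition _ := gen_choiceMixin gmod.

Definition is_hom (M N : gmod) (f : 'M['F_2]_(dim N, dim M)) : Prop :=
  (forall i j, f i j != 0 -> deg i = deg j) /\
  (forall b, f *m sq M b = sq N b *m f).

Definition iso (M N : gmod) : Prop :=
  exists f g, [/\ @is_hom M N f, @is_hom N M g, g *m f = 1%:M & f *m g = 1%:M].

Definition projective (P : gmod) : Prop :=
  forall (M N : gmod) (q : 'M_(dim N, dim M)) (f : 'M_(dim N, dim P)),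
    is_hom q -> (forall v : 'cV_(dim N), exists u, q *m u = v) -> is_hom f ->
    exists g : 'M_(dim M, dim P), is_hom g /\ q *m g = f.

Definition stably_zero (M N : gmod) (f : 'M['F_2]_(dim N, dim M)) : Prop :=
  exists (P : gmod) (g : 'M_(dim P, dim M)) (h : 'M_(dim N, dim P)),
    [/\ projective P, is_hom g, is_hom h & f = h *m g].

Definition stable_iso (M N : gmod) : Prop :=
  exists f g, [/\ @is_hom M N f, @is_hom N M g,
    @stably_zero M M (g *m f - 1%:M) & @stably_zero N N (f *m g - 1%:M)].

Definition is_kernel (M N : gmod) (f : 'M['F_2]_(dim N, dim M)) (K : gmod) :
    Prop :=
  exists i : 'M_(dim M, dim K), [/\ is_hom i, f *m i = 0 &
    forall v : 'cV_(dim M), f *m v = 0 -> exists! u, i *m u = v].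

(* Combinatorial description of A(1) on the basis
   1, Sq1, Sq2, Sq1Sq2, Sq2Sq1, Sq1Sq2Sq1, Sq2Sq1Sq2, Sq1Sq2Sq1Sq2:
   edge_mx s sends the basis element j to the sum of the i with (j, i) in s. *)
Definition edge_mx (n : nat) (s : seq (nat * nat)) : 'M['F_2]_n :=
  \matrix_(i, j) ((nat_of_ord j, nat_of_ord i) \in s)%:R.

Definition A1_deg (i : nat) : int := nth 0 [:: 0; 1; 2; 3; 3; 4; 5; 6] i.

Definition A1_edges (b : bool) : seq (nat * nat) :=
  if b then [:: (0, 2); (1, 4); (2, 5); (3, 6); (5, 7)]%N
  else [:: (0, 1); (2, 3); (4, 5); (6, 7)]%N.

Definition A1_sq (b : bool) : 'M['F_2]_8 := edge_mx 8 (A1_edges b).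

(* Matrices with natural number entries, reduced mod 2; nat_chk decides
   equality by computation. *)
Definition natmx (m n : nat) (f : nat -> nat -> nat) : 'M['F_2]_(m, n) :=
  \matrix_(i, j) (f i j)%:R.

Definition nmul (n : nat) (f g : nat -> nat -> nat) (i j : nat) : nat :=
  sumn [seq (f i k * g k j)%N | k <- iota 0 n].

Lemma natmx_mul m n p f g : natmx m n f *m natmx n p g = natmx m p (nmul n f g).
Proof.
apply/matrixP=> i j; rewrite !mxE /nmul sumnE big_map natr_sum.
have -> : iota 0 n = index_iota 0 n by rewrite /index_iota subn0.
rewrite big_mkord.
by apply: eq_bigr => k _; rewrite !mxE natrM.
Qed.

Lemma natmx_add m n f g :
  natmx m n f + natmx m n g = natmx m n (fun i j => f i j + g i j)%N.
Proof. by apply/matrixP=> i j; rewrite !mxE natrD. Qed.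

Lemma natmx0 m n : 0 = natmx m n (fun _ _ => 0%N).
Proof. by apply/matrixP=> i j; rewrite !mxE. Qed.

Lemma natmx1 n : 1%:M = natmx n n (fun i j => i == j).
Proof. by apply/matrixP=> i j; rewrite !mxE. Qed.

Lemma natr_F2 (m : nat) : (m%:R : 'F_2) = (odd m)%:R.
Proof.
rewrite -{1}[m]odd_double_half natrD -mul2n natrM.
by rewrite (_ : 2%:R = 0 :> 'F_2) ?mul0r ?addr0 //; apply/val_inj.
Qed.

Definition nat_chk (m n : nat) (f g : nat -> nat -> nat) : bool :=
  all (fun i => all (fun j => odd (f i j) == odd (g i j)) (iota 0 n)) (iota 0 m).

Lemma natmx_eq m n f g : nat_chk m n f g -> natmx m n f = natmx m n g.
Proof.
move=> /allP H; apply/matrixP=> i j; rewrite !mxE.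
have := H (i : nat); rewrite mem_iota ltn_ord => /(_ isT) /allP H2.
have := H2 (j : nat); rewrite mem_iota ltn_ord => /(_ isT) /eqP e.
by rewrite natr_F2 e -natr_F2.
Qed.

Definition nedge (s : seq (nat * nat)) (i j : nat) : nat := (j, i) \in s.

Lemma edge_mxE n s : edge_mx n s = natmx n n (nedge s).
Proof. by apply/matrixP=> i j; rewrite !mxE. Qed.

(* An extension of the action of A(1) on itself to the Steenrod algebra. *)
Definition A1_ext_edges (i : nat) : seq (nat * nat) :=
  match i with
  | 0 => [seq (k, k) | k <- iota 0 8]
  | 1 => A1_edges false
  | 2 => A1_edges true
  | 3 => [:: (0, 3); (1, 5); (3, 7)]
  | 4 => [:: (1, 6)]
  | 5 => [:: (1, 7)]
  | 6 => [:: (0, 7)]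
  | _ => [::]
  end%N.

Definition A1_ext (i : nat) : 'M['F_2]_8 := edge_mx 8 (A1_ext_edges i).

Lemma natmx_sum n (f : nat -> nat -> nat -> nat) (m : nat) :
  \sum_(c < m) natmx n n (f c) =
  natmx n n (fun i j => sumn [seq f c i j | c <- iota 0 m]).
Proof.
apply/matrixP=> i j; rewrite summxE mxE sumnE big_map natr_sum.
have -> : iota 0 m = index_iota 0 m by rewrite /index_iota subn0.
by rewrite big_mkord; apply: eq_bigr => c _; rewrite mxE.
Qed.

Lemma natmx_muln n f m : natmx n n f *+ m = natmx n n (fun i j => f i j * m)%N.
Proof. by apply/matrixP=> i j; rewrite mulmxnE !mxE natrM mulr_natr. Qed.

Lemma A1_ext_adem : adem A1_ext.
Proof.
split=> [|a b /andP [a0 ab]].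
  by apply/matrixP=> i j; rewrite !mxE; case: i j; do 8?case=> //; move=> p;
    case; do 8?case.
have Z m : (6 < m)%N -> A1_ext m = 0.
  move=> h; apply/matrixP=> i j; rewrite !mxE.
  by do 7?[case: m h => [//|m] h].
have hc (c : 'I_a./2.+1) : (c <= a./2)%N by rewrite -ltnS.
have ha : (a./2 <= a)%N by rewrite leq_half_double -addnn -addnS leq_addr.
have ha2 : (a./2 < b)%N by rewrite ltn_half_double.
have [h|h] := ltnP 6 (maxn a b).
  transitivity (0 : 'M['F_2]_8).
    by move: h; rewrite leq_max => /orP [] /Z ->; rewrite ?mul0r ?mulr0.
  rewrite big1 // => c _; rewrite Z ?mul0r ?mul0rn //.
  have := hc c; move: h; rewrite leq_max => /orP [] h hcc; last first.
    by apply: leq_trans h _; rewrite addnC -addnBA ?leq_addr // (leq_trans hcc).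
  apply: leq_trans h _; rewrite -addnBA ?leq_addr //.
  by apply: leq_trans hcc (ltnW ha2).
rewrite /A1_ext.
under eq_bigr => c _ do rewrite !edge_mxE [_ * _]natmx_mul natmx_muln.
rewrite !edge_mxE [_ * _]natmx_mul.
rewrite (natmx_sum 8 (fun c i j => nmul 8 (nedge (A1_ext_edges (a + b - c)))
  (nedge (A1_ext_edges c)) i j * 'C(b - c - 1, a - c.*2))%N).
apply: natmx_eq; move: h; rewrite geq_max => /andP [].
move: ab {a0 Z hc ha ha2}; do 7?[case: a => [|a]] => //;
  do 7?[case: b => [|b]] => //; by vm_compute.
Qed.

(* The action of Sq^(b+1) on the basis of A(1), with None for 0. *)
Definition act (b : bool) (i : nat) : option nat :=
  match b, i with
  | false, 0 => Some 1 | false, 2 => Some 3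
  | false, 4 => Some 5 | false, 6 => Some 7
  | true, 0 => Some 2 | true, 1 => Some 4 | true, 2 => Some 5
  | true, 3 => Some 6 | true, 5 => Some 7
  | _, _ => None
  end%N.

Definition wact (w : seq bool) : option nat := foldr (fun b => obind (act b)) (Some 0%N) w.

Definition A1_word (E : pzRingType) (s : bool -> E) (i : nat) : E :=
  let x := s false in let y := s true in
  nth 0 [:: 1; x; y; x * y; y * x; x * y * x; y * x * y; x * y * x * y] i.

Lemma wact_lt w i : wact w = Some i -> (i < 8)%N.
Proof.
elim: w i => [|b w IH] i /=; first by case=> <-.
rewrite /wact /= -/(wact w); case: (wact w) => [k|] //= .
by case: b; do 8?[case: k => [|k]] => //= [] [<-].
Qed.

Lemma A1_word_act (E : pzRingType) (s : bool -> E) (w : seq bool) :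
  s false * s false = 0 -> s true * s true = s false * s true * s false ->
  \prod_(b <- w) s b = oapp (A1_word s) 0 (wact w).
Proof.
move=> h1 h2; set x := s false in h1 h2 *; set y := s true in h1 h2 *.
have yxyx : y * x * y * x = x * y * x * y.
  by rewrite -[y * x * y * x]mulrA -[y * x * _]mulrA (mulrA x) -h2 mulrA h2.
elim: w => [|b w IH]; first by rewrite big_nil.
rewrite big_cons IH /wact /= -/(wact w).
case E1: (wact w) => [k|] /=; last by rewrite mulr0.
have {E1} := wact_lt E1; rewrite /A1_word -/x -/y.
have xx z : x * (x * z) = 0 by rewrite mulrA h1 mul0r.
have yy z : y * (y * z) = x * (y * (x * z)) by rewrite !mulrA h2.
move: yxyx; rewrite -!mulrA => yxyx.
case: b; do 8?[case: k => [|k]] => //= _; rewrite -/x -/y -?mulrA.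
all: rewrite ?mulr1 ?xx ?yy ?yxyx ?h1 ?h2 ?mulr0 ?xx ?mulr0 -?mulrA ?h1 ?mulr0 //.
have yxyxz z : y * (x * (y * (x * z))) = x * (y * (x * (y * z))).
  by have := congr1 (fun t => t * z) yxyx; rewrite -!mulrA.
by rewrite yxyxz h2 -!mulrA xx !mulr0.
Qed.

Lemma char2_ev (E : pzRingType) (s : bool -> E) (p : ncpoly) :
  s false * s false = 0 -> s true * s true = s false * s true * s false ->
  ev s p = \sum_(i < 8) A1_word s i *+ count (fun w => wact w == Some (i : nat)) p.
Proof.
move=> h1 h2; rewrite /ev; elim: p => [|w p IH].
  by rewrite big_nil big1 // => i _; rewrite mulr0n.
rewrite big_cons IH (A1_word_act w h1 h2).
under [RHS]eq_bigr => i _ do rewrite /= mulrnDr.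
rewrite big_split /=; congr (_ + _).
case E1: (wact w) => [k|] /=; last by rewrite big1 // => i _; rewrite mulr0n.
have k8 := wact_lt E1.
rewrite (bigD1 (Ordinal k8)) //= eqxx mulr1n big1 ?addr0 // => i ne.
rewrite (_ : (Some k == Some (i : nat)) = false) ?mulr0n //.
apply/negbTE; apply: contraNneq ne => - [e]; by apply/eqP/val_inj.
Qed.

Lemma A1_presentation :
  A1_sq false * A1_sq false = 0 /\
  A1_sq true * A1_sq true = A1_sq false * A1_sq true * A1_sq false.
Proof.
rewrite /A1_sq !edge_mxE; split.
  by rewrite (natmx0 8 8) [_ * _]natmx_mul; apply: natmx_eq; vm_compute.
rewrite [in LHS]/GRing.mul /= natmx_mul.
rewrite -[_ * _ * _]/((_ *m _) *m _) !natmx_mul.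
by apply: natmx_eq; vm_compute.
Qed.

Definition A1_one : 'cV['F_2]_8 := delta_mx 0 0.

Lemma A1_word_one (i : 'I_8) : A1_word A1_sq i *m A1_one = delta_mx i 0.
Proof.
pose d (k : nat) : 'cV['F_2]_8 := delta_mx (inord k) 0.
have e b k : (k < 8)%N -> A1_sq b *m d k = oapp d 0 (act b k).
  move=> k8; rewrite -colE; apply/matrixP=> r c; rewrite !mxE (ord1 c) inordK //.
  case: b; do 8?[case: k k8 => [|k] k8] => //=; rewrite mxE /= ?eqxx ?andbT //;
    rewrite -?(inj_eq val_inj) /= ?inordK //; case: r => r hr;
    by do 8?[case: r hr => [|r] hr].
have M (A B : 'M['F_2]_8) : A * B = A *m B by [].
have -> : A1_one = d 0%N by congr delta_mx; apply/val_inj; rewrite /= inordK.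
have -> : delta_mx i 0 = d i by rewrite /d inord_val.
case: i => [i hi]; do 8?[case: i hi => [|i] hi] => //=; rewrite /A1_word /= ?M -?mulmxA.
all: by rewrite ?mul1mx ?(e, isT) //= ?e //= ?e //= ?e.
Qed.

Lemma A1_ev_one (p : ncpoly) (i : 'I_8) :
  (ev A1_sq p *m A1_one) i 0 = (count (fun w => wact w == Some (i : nat)) p)%:R.
Proof.
have [h1 h2] := A1_presentation.
rewrite (char2_ev p h1 h2) mulmx_suml summxE (bigD1 i) //= big1 => [|j ji].
  by rewrite addr0 -scaler_nat -scalemxAl A1_word_one !mxE !eqxx mulr1.
by rewrite -scaler_nat -scalemxAl A1_word_one !mxE eq_sym (negbTE ji) mulr0.
Qed.

(* A(1) is presented by Sq1 Sq1 = 0 and Sq2 Sq2 = Sq1 Sq2 Sq1. *)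
Lemma presentation_rel (E : pzRingType) (s : bool -> E) (p : ncpoly) :
  1 + 1 = 0 :> E ->
  s false * s false = 0 -> s true * s true = s false * s true * s false ->
  ev A1_sq p *m A1_one = 0 -> ev s p = 0.
Proof.
move=> two h1 h2 h; rewrite (char2_ev p h1 h2) big1 // => i _.
have := A1_ev_one p i; rewrite h mxE natr_F2 => hc.
set c := count _ p in hc *; case: (boolP (odd c)) hc => [_|o _] => [hc|].
  by have := oner_neq0 'F_2; rewrite -[1]/(true%:R) hc eqxx.
rewrite -[c]odd_double_half (negbTE o) add0n -mul2n mulrnA.
by rewrite -[_ *+ 2]mulr_natr -[2%:R]/(1 + 1) two mulr0 mul0rn.
Qed.

Lemma adem_presentation (E : algType 'F_2) (Sq : nat -> E) : adem Sq ->
  Sq 1%N * Sq 1%N = 0 /\ Sq 2%N * Sq 2%N = Sq 1%N * Sq 2%N * Sq 1%N.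
Proof.
move=> [h0 h]; split.
  by rewrite (h 1%N 1%N) // big_ord_recl big_ord0 /= addr0 mulr0n.
have := h 1%N 2%N isT; rewrite big_ord_recl big_ord0 /= addr0 h0 mulr1 => ->.
rewrite (h 2%N 2%N) // !big_ord_recl big_ord0 /= addr0 .
by rewrite [X in X + _](_ : _ = 0) ?add0r // bin_small.
Qed.

Lemma F2_two (E : algType 'F_2) : 1 + 1 = 0 :> E.
Proof.
rewrite -[1 + 1]/(2%:R) -scaler_nat (_ : 2%:R = 0 :> 'F_2) ?scale0r //.
exact/val_inj.
Qed.

(* The 8-dimensional matrix model is the regular representation: a polynomial
   kills the generator exactly when it vanishes in the Steenrod algebra. *)
Lemma A1_steenrod (p : ncpoly) : ev A1_sq p *m A1_one = 0 <-> steenrod_rel p.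
Proof.
split=> [h E Sq /adem_presentation [h1 h2]|h].
  exact: (presentation_rel (F2_two E) h1 h2 h).
suff -> : ev A1_sq p = 0 by rewrite mul0mx.
rewrite -[RHS](h _ A1_ext A1_ext_adem); apply: eq_bigr => w _.
by apply: eq_bigr => -[].
Qed.

(* Together with A1_steenrod: p |-> p.1 identifies A(1) with this module. *)
Lemma A1_generated (v : 'cV['F_2]_8) : exists p, v = ev A1_sq p *m A1_one.
Proof.
pose word i : seq bool := nth [::] [:: [::]; [:: false]; [:: true]; [:: false; true];
  [:: true; false]; [:: false; true; false]; [:: true; false; true];
  [:: false; true; false; true]] i.
have hw (i : 'I_8) : wact (word i) = Some (i : nat).
  by case: i => i; do 8?[case: i => [|i]].
pose p := [seq word (nat_of_ord i) | i : 'I_8 <- enum 'I_8 & v i 0 != 0].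
exists p; rewrite /ev /p big_map big_filter big_enum_cond mulmx_suml /=.
have [h1 h2] := A1_presentation.
under eq_bigr => i _ do rewrite (A1_word_act _ h1 h2) hw A1_word_one.
apply/colP=> r; rewrite summxE.
have F2E (x : 'F_2) : x = (x != 0)%:R by case: x => -[|[]] //= ?; apply/val_inj.
rewrite [LHS]F2E -big_filter; case vr: (v r 0 != 0).
  rewrite big_filter (bigD1 r) //= big1 ?mxE ?eqxx ?addr0 // => i /andP [_ ir].
  by rewrite mxE eq_sym (negbTE ir).
rewrite big_filter big1 // => i vi; rewrite mxE andbT.
by case: (r =P i) vi => [<-|//]; rewrite vr.
Qed.

Definition mk_gmod (n : nat) (d : 'I_n -> int) (s : bool -> 'M['F_2]_n)
  (hd : forall (b : bool) (i j : 'I_n), s b i j != 0 -> d i = d j + (b.+1)%:Z)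
  (h1 : s false *m s false = 0)
  (h2 : s true *m s true = s false *m s true *m s false) : gmod.
Proof.
refine (GMod hd _) => p /A1_steenrod h; apply: presentation_rel h => //.
by apply/matrixP=> i j; rewrite !mxE -mulr2n; apply/val_inj; case: (i == j).
Defined.
Lemma sq_presentation (M : gmod) :
  sq M false *m sq M false = 0 /\
  sq M true *m sq M true = sq M false *m sq M true *m sq M false.
Proof.
have r p : steenrod_rel p -> ev (sq M) p = 0 by apply: sq_rel.
have /r : steenrod_rel [:: [:: false; false]].
  move=> E Sq /adem_presentation [h _].
  by rewrite /ev big_seq1 !big_cons big_nil mulr1.
have /r : steenrod_rel [:: [:: true; true]; [:: false; true; false]].
  move=> E Sq /adem_presentation [_ h]; rewrite /ev !big_cons !big_nil !mulr1 addr0.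
  by rewrite h mulrA -mulr2n -mulr_natr -[2%:R]/(1 + 1) F2_two mulr0.
rewrite /ev !big_cons !big_nil !mulr1 !addr0 => h2 h1; split; first exact: h1.
move: h2; rewrite mulrA => h2; apply/eqP; rewrite -subr_eq0; apply/eqP.
rewrite -[RHS]h2; congr (_ + _); apply/matrixP=> i j; rewrite !mxE.
by apply: oppr_pchar2; apply: pchar_Fp.
Qed.

Definition susp (n : int) (M : gmod) : gmod.
Proof.
refine (@GMod (dim M) (fun i => deg i + n) (sq M) _ (@sq_rel M)).
by move=> b i j /sq_deg ->; rewrite addrAC.
Defined.

(* D M in the dual basis. The antipode fixes Sq^1 and Sq^2 (it sends Sq^2 to
   Sq^2 + Sq^1 Sq^1 = Sq^2), so they act by the transposed operators. *)
Definition dual (M : gmod) : gmod.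
Proof.
refine (@mk_gmod (dim M) (fun i => - deg i) (fun b => (sq M b)^T) _ _ _).
- by move=> b i j; rewrite mxE => /sq_deg ->; rewrite opprD subrK.
- by rewrite -trmx_mul (sq_presentation M).1 trmx0.
- by rewrite -!trmx_mul (sq_presentation M).2 mulmxA.
Defined.

Lemma cartan_rel (E : pzRingType) (a b c d : E) : 1 + 1 = 0 :> E ->
  c * a = a * c -> c * b = b * c -> d * a = a * d -> d * b = b * d ->
  a * a = 0 -> b * b = a * b * a -> c * c = 0 -> d * d = c * d * c ->
  (a + c) * (a + c) = 0 /\
  (b + d + a * c) * (b + d + a * c) = (a + c) * (b + d + a * c) * (a + c).
Proof.
move=> two ca cb da db aa bb cc dd.
have xx x : x + x = 0 :> E by rewrite -[x]mulr1 -mulrDr two mulr0.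
split; first by rewrite mulrDl !mulrDr aa cc ca add0r addr0 xx.
have e1 : (a + c) * (b + d + a * c) = a * b + a * d + (b * c + c * d).
  rewrite mulrDl !mulrDr [a * (a * c)]mulrA aa mul0r addr0 cb.
  by rewrite mulrA ca -mulrA cc mulr0 addr0.
have e2 : (a * b + a * d + (b * c + c * d)) * (a + c) =
    a * b * a + (b * a * c + a * c * d) + (a * b * c + a * d * c + c * d * c).
  rewrite mulrDr !mulrDl -[a * d * a]mulrA da [a * (a * d)]mulrA aa mul0r addr0.
  rewrite -[b * c * a]mulrA ca [b * (a * c)]mulrA -[c * d * a]mulrA da.
  by rewrite [c * (a * d)]mulrA ca -[b * c * c]mulrA cc mulr0 add0r.
rewrite e1 e2 !mulrDl !mulrDr bb dd db.
have -> : a * c * (a * c) = 0.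
  by rewrite mulrA -[a * c * a]mulrA ca mulrA aa !mul0r.
have -> : b * (a * c) = b * a * c by rewrite mulrA.
have -> : d * (a * c) = a * d * c by rewrite mulrA da.
have -> : a * c * b = a * b * c by rewrite -mulrA cb mulrA.
by rewrite addr0 [LHS](AC (3*3*2) (1*(3*8)*(7*6*5)*(2*4))) /= xx addr0.
Qed.

Definition tens_sq (M N : gmod) (b : bool) : 'M['F_2]_(dim M * dim N) :=
  if b then sq M true *t 1%:M + 1%:M *t sq N true + sq M false *t sq N false
  else sq M false *t 1%:M + 1%:M *t sq N false.

Lemma tens_sq_rel (M N : gmod) :
  tens_sq M N false *m tens_sq M N false = 0 /\
  tens_sq M N true *m tens_sq M N true =
    tens_sq M N false *m tens_sq M N true *m tens_sq M N false.
Proof.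
have [a1 a2] := sq_presentation M; have [b1 b2] := sq_presentation N.
have c (X : 'M['F_2]_(dim M)) (Y : 'M['F_2]_(dim N)) :
  (1%:M *t Y) * (X *t 1%:M) = X *t Y :> 'M_(dim M * dim N)
  by rewrite -[LHS]/(_ *m _) tensmx_mul mul1mx mulmx1.
have c' (X : 'M['F_2]_(dim M)) (Y : 'M['F_2]_(dim N)) :
  (X *t 1%:M) * (1%:M *t Y) = X *t Y :> 'M_(dim M * dim N)
  by rewrite -[LHS]/(_ *m _) tensmx_mul mul1mx mulmx1.
have l (X Y : 'M['F_2]_(dim M)) : (X *t 1%:M) * (Y *t 1%:M) =
  (X *m Y) *t 1%:M :> 'M_(dim M * dim N)
  by rewrite -[LHS]/(_ *m _) tensmx_mul mul1mx.
have r (X Y : 'M['F_2]_(dim N)) : (1%:M *t X) * (1%:M *t Y) =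
  1%:M *t (X *m Y) :> 'M_(dim M * dim N)
  by rewrite -[LHS]/(_ *m _) tensmx_mul mul1mx.
have two : 1 + 1 = 0 :> 'M['F_2]_(dim M * dim N)
  by apply/matrixP=> i j; rewrite !mxE -mulr2n (mulrn_pchar (pchar_Fp _)).
rewrite /tens_sq -[sq M false *t sq N false]c'.
by refine (@cartan_rel 'M['F_2]_(dim M * dim N) (sq M false *t 1%:M)
    (sq M true *t 1%:M) (1%:M *t sq N false) (1%:M *t sq N true)
    two _ _ _ _ _ _ _ _);
  rewrite ?c ?c' ?(l, r, a1, a2, b1, b2) ?tens0mx ?tensmx0.
Qed.

(* The diagonal action, through the Cartan formula
   Delta Sq^n = \sum_(i + j = n) Sq^i (x) Sq^j for n = 1, 2. *)
Definition tens (M N : gmod) : gmod.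
Proof.
refine (@mk_gmod (dim M * dim N)
  (fun k => deg (mxtens_unindex k).1 + deg (mxtens_unindex k).2)
  (tens_sq M N) _ _ _).
- have H b (k l : 'I_(dim M * dim N)) :
    (sq M b *t 1%:M) k l + (1%:M *t sq N b) k l != 0 ->
    deg (mxtens_unindex k).1 + deg (mxtens_unindex k).2 =
    deg (mxtens_unindex l).1 + deg (mxtens_unindex l).2 + (b.+1)%:Z.
    case: (mxtens_indexP k) => i1 i2; case: (mxtens_indexP l) => j1 j2.
    rewrite !mxtens_indexK !tensmxE !mxE.
    have [h|] := boolP (sq M b i1 j1 * (i2 == j2)%:R == 0); last first.
      rewrite mulf_eq0 negb_or => /andP [/sq_deg -> ].
      by case: (i2 =P j2) => [->|]; rewrite ?eqxx // => _ _; rewrite addrAC.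
    rewrite (eqP h) add0r mulf_eq0 negb_or => /andP [+ /sq_deg ->].
    by case: (i1 =P j1) => [->|]; rewrite ?eqxx // => _; rewrite addrA.
  case=> k l; rewrite /tens_sq mxE; last exact: (H false).
  have [h|h _] := boolP ((sq M true *t 1%:M + 1%:M *t sq N true) k l == 0);
    last by rewrite mxE in h; exact: (H true).
  rewrite (eqP h) add0r {h}.
  case: (mxtens_indexP k) => i1 i2; case: (mxtens_indexP l) => j1 j2.
  rewrite !mxtens_indexK tensmxE mulf_eq0 negb_or => /andP [/sq_deg -> /sq_deg ->].
  by rewrite addrACA.
- exact: (tens_sq_rel M N).1.
- exact: (tens_sq_rel M N).2.
Defined.

Definition dsum (M N : gmod) : gmod.
Proof.
refine (@mk_gmod (dim M + dim N)
  (fun k => match fintype.split k with inl i => deg i | inr j => deg j end)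
  (fun b => block_mx (sq M b) 0 0 (sq N b)) _ _ _).
- move=> b k l; case: (split_ordP k) => i ->; case: (split_ordP l) => j ->;
    rewrite ?(block_mxEul, block_mxEur, block_mxEdl, block_mxEdr) ?mxE ?eqxx //;
    rewrite ?(unsplitK (inl _)) ?(unsplitK (inr _)); exact: sq_deg.
- by rewrite mulmx_block !(mulmx0, mul0mx) (sq_presentation M).1
    (sq_presentation N).1 !addr0 block_mx0.
- rewrite !mulmx_block !(mulmx0, mul0mx) !addr0 !add0r !(mulmx0, mul0mx).
  by rewrite (sq_presentation M).2 (sq_presentation N).2.
Defined.

Definition edge_ok (n : nat) (d : nat -> int) (e : bool -> seq (nat * nat)) : bool :=
  let a := nedge (e false) in let b := nedge (e true) in
  [&& all (fun c => all (fun ij => d ij.2 == d ij.1 + (nat_of_bool c).+1%:Z) (e c))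
        [:: false; true],
      nat_chk n n (nmul n a a) (fun _ _ => 0%N)
    & nat_chk n n (nmul n b b) (nmul n (nmul n a b) a)].

Definition edge_gmod (n : nat) (d : nat -> int) (e : bool -> seq (nat * nat))
  (ok : edge_ok n d e) : gmod.
Proof.
refine (@mk_gmod n (fun i => d i) (fun b => edge_mx n (e b)) _ _ _);
  case/and3P: ok => ok1 ok2 ok3.
- move=> b i j; rewrite mxE; have [h _|] := boolP ((_, _) \in _); last by rewrite eqxx.
  have /allP /(_ _ h) /= /eqP -> // : all (fun ij => d ij.2 == d ij.1 + b.+1%:Z) (e b).
  by move: ok1 => /= /and3P [h1 h2 _]; case: b {h}.
- by rewrite !edge_mxE natmx_mul natmx0; exact: natmx_eq.
- by rewrite !edge_mxE !natmx_mul; exact: natmx_eq.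
Defined.

(* The trivial module F, in degree 0. *)
Definition unit_mod : gmod :=
  @edge_gmod 1 (fun _ => 0) (fun _ => [::]) isT.

Definition zero_mod : gmod :=
  @edge_gmod 0 (fun _ => 0) (fun _ => [::]) isT.

Definition A1_mod : gmod := @edge_gmod 8 A1_deg A1_edges isT.

(* The augmentation ideal of A(1), on the basis
   Sq1, Sq2, Sq1Sq2, Sq2Sq1, Sq1Sq2Sq1, Sq2Sq1Sq2, Sq1Sq2Sq1Sq2. *)
Definition OmegaF : gmod :=
  @edge_gmod 7 (fun i => nth 0 [:: 1; 2; 3; 3; 4; 5; 6] i)
    (fun b => if b then [:: (0, 3); (1, 4); (2, 5); (4, 6)]%N
              else [:: (1, 2); (3, 4); (5, 6)]%N) isT.

(* A(1)/A(1)Sq1Sq2, on the classes of 1, Sq1, Sq2, Sq2Sq1, Sq1Sq2Sq1. *)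
Definition A1_mod_Sq1Sq2 : gmod :=
  @edge_gmod 5 (fun i => nth 0 [:: 0; 1; 2; 3; 4] i)
    (fun b => if b then [:: (0, 2); (1, 3); (2, 4)]%N
              else [:: (0, 1); (3, 4)]%N) isT.

Lemma split_kernel (m n k : nat) (f : 'M['F_2]_(n, m)) (r : 'M['F_2]_(m, n))
    (l : 'M['F_2]_(m, k)) (l' : 'M['F_2]_(k, m)) :
  l' *m l = 1%:M -> l *m l' + r *m f = 1%:M ->
  forall v : 'cV_m, f *m v = 0 -> exists! u, l *m u = v.
Proof.
move=> l'l ll' v fv; exists (l' *m v); split => [|u <-].
  by rewrite -[RHS]mul1mx -ll' mulmxDl -!mulmxA fv mulmx0 addr0.
by rewrite mulmxA l'l mul1mx.
Qed.

Lemma OmegaF_kernel :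
  exists2 f : 'M_(dim unit_mod, dim A1_mod),
    @is_hom A1_mod unit_mod f /\ f *m A1_one = 1%:M & is_kernel f OmegaF.
Proof.
pose f : 'M_(dim unit_mod, dim A1_mod) := natmx 1 8 (fun _ j => j == 0%N).
pose r : 'M_(dim A1_mod, dim unit_mod) := natmx 8 1 (fun i _ => i == 0%N).
pose l : 'M_(dim A1_mod, dim OmegaF) := natmx 8 7 (fun i j => i == j.+1).
pose l' : 'M_(dim OmegaF, dim A1_mod) := natmx 7 8 (fun i j => j == i.+1).
have l'l : l' *m l = 1%:M by rewrite natmx_mul natmx1; exact: natmx_eq.
have ll' : l *m l' + r *m f = 1%:M.
  by rewrite !natmx_mul natmx_add natmx1; exact: natmx_eq.
exists f; [split; [split|]|exists l; split; [split| |]].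
- move=> i j; rewrite mxE /=; case: (nat_of_ord j =P 0%N) => [->|]; last by rewrite eqxx.
  by [].
- by move=> b; rewrite /= !edge_mxE !natmx_mul; apply: natmx_eq; case: b.
- rewrite [A1_one](_ : _ = r) ?natmx_mul ?natmx1; first exact: natmx_eq.
  by apply/matrixP=> i j; rewrite !mxE (ord1 j) andbT.
- move=> i j; rewrite mxE; case: (nat_of_ord i =P j.+1) => [/= -> _|]; last by rewrite eqxx.
  by case: j => j; do 7?[case: j => [|j]].
- by move=> b; rewrite /= !edge_mxE !natmx_mul; apply: natmx_eq; case: b.
- by rewrite natmx_mul natmx0; exact: natmx_eq.
- exact: split_kernel l'l ll'.
Qed.

Lemma A1_mod_Sq1Sq2_quotient :
  exists q : 'M_(dim A1_mod_Sq1Sq2, dim A1_mod),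
    [/\ @is_hom A1_mod A1_mod_Sq1Sq2 q,
        forall w : 'cV_(dim A1_mod_Sq1Sq2), exists v, q *m v = w
      & forall v : 'cV_(dim A1_mod), q *m v = 0 <->
          exists p, v = ev A1_sq p *m (A1_sq false *m (A1_sq true *m A1_one))].
Proof.
pose q : 'M_(dim A1_mod_Sq1Sq2, dim A1_mod) :=
  natmx 5 8 (nedge [:: (0, 0); (1, 1); (2, 2); (4, 3); (5, 4)]%N).
pose r : 'M_(dim A1_mod, dim A1_mod_Sq1Sq2) :=
  natmx 8 5 (nedge [:: (0, 0); (1, 1); (2, 2); (3, 4); (4, 5)]%N).
pose t := natmx 8 8 (nedge [:: (0, 3); (2, 6); (3, 7)]%N).
pose t' := natmx 8 8 (nedge [:: (3, 0); (6, 2); (7, 3)]%N).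
have qr : q *m r = 1%:M by rewrite natmx_mul natmx1; exact: natmx_eq.
have tq : r *m q + t *m t' = 1%:M.
  by rewrite !natmx_mul natmx_add natmx1; exact: natmx_eq.
have qt : q *m t = 0 by rewrite natmx_mul natmx0; exact: natmx_eq.
have one : A1_one = natmx 8 1 (fun i _ => i == 0%N).
  by apply/matrixP=> i j; rewrite !mxE (ord1 j) andbT.
have t1 : A1_sq false *m (A1_sq true *m A1_one) = t *m A1_one.
  by rewrite one /A1_sq !edge_mxE !natmx_mul; exact: natmx_eq.
have tb b : t *m A1_sq b = A1_sq b *m t.
  by rewrite /A1_sq edge_mxE !natmx_mul; apply: natmx_eq; case: b.
have te p : t *m ev A1_sq p = ev A1_sq p *m t.
  rewrite /ev mulmx_suml mulmx_sumr; apply: eq_bigr => w _.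
  elim: w => [|b w IH]; first by rewrite big_nil mulmx1 mul1mx.
  by rewrite big_cons -[_ * _]/(_ *m _) mulmxA tb -!mulmxA IH.
exists q; split.
- split=> [i j|b]; last first.
    by rewrite /= !edge_mxE !natmx_mul; apply: natmx_eq; case: b.
  rewrite mxE; case: i => i; case: j => j.
  by do 8?[case: j => [|j]] => //=; do 5?[case: i => [|i]].
- by move=> w; exists (r *m w); rewrite mulmxA qr mul1mx.
- move=> v; split=> [qv|[p ->]].
    have [p e] := A1_generated (t' *m v); exists p.
    rewrite t1 mulmxA -te -mulmxA -e -[LHS]mul1mx -tq mulmxDl -(mulmxA r).
    by rewrite qv mulmx0 add0r mulmxA.
  by rewrite t1 (mulmxA (ev _ _)) -te -(mulmxA t) (mulmxA q) qt mul0mx.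
Qed.

(* The Joker. *)
Definition joker : gmod := susp (-2) A1_mod_Sq1Sq2.

(* Finitely generated free modules, generated in the degrees listed. *)
Definition free_mod (s : seq int) : gmod :=
  foldr (fun n M => dsum (susp n A1_mod) M) zero_mod s.

Definition reduced (M : gmod) : Prop :=
  sq M true *m sq M true *m sq M true = 0.

(* A reduced complement of a free summand; it is well defined up to
   isomorphism, whence the choice. *)
Definition red (M : gmod) : gmod :=
  xget M [set N | reduced N /\ exists s, iso M (dsum (free_mod s) N)]%classic.

Definition tpow (M : gmod) (n : nat) : gmod := iterop n tens M unit_mod.

Definition Omega (n : nat) (M : gmod) : gmod := red (tens (tpow OmegaF n) M).

(* The functor Sigma^(-3) Omega. *)
Definition SOmega (M : gmod) : gmod := susp (-3) (Omega 1 M).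

Definition dual_op (k : nat) (M : gmod) : gmod := susp (2 * k + 5)%N%:Z (dual M).

Definition uniq_nontrivial (M N : gmod) (f : 'M['F_2]_(dim N, dim M)) : Prop :=
  [/\ is_hom f, f != 0
    & forall g : 'M_(dim N, dim M), is_hom g -> g != 0 -> g = f].

Definition Amod (k eps : nat) : gmod :=
  let M := susp (- k.+1%:Z) (Omega k.+1 (tpow joker eps)) in
  xget unit_mod [set K | exists f : 'M_(dim unit_mod, dim M),
    uniq_nontrivial f /\ is_kernel f K]%classic.

Definition stable_class (M : gmod) : set gmod := [set N | stable_iso M N]%classic.

Definition orbit_set (k eps : nat) : set (set gmod) :=
  [set stable_class (iter t SOmega (Amod k eps)) | t in [set t | (t <= 3)%N]]%classic.

(* The operation f on modules induces the map phi on the set O of stable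
   classes, independently of the representatives. *)
Definition induces (O : set (set gmod)) (f : gmod -> gmod) (phi : O -> O) : Prop :=
  forall (c : O) (M : gmod),
    set_val c = stable_class M -> set_val (phi c) = stable_class (f M).

Definition D8 : {group 'D_8} := [set: 'D_8]%G.

(* Main.v *)
Require Import Defs.
From Corelib Require Import Setoid Morphisms.
From mathcomp Require Import all_boot all_order all_algebra all_fingroup.
From mathcomp Require Import all_solvable mxtens.
From mathcomp Require Import boolp classical_sets functions cardinality.
From mathcomp Require Import zify ring.
Import Defs.
Set Implicit Arguments.
Unset Strict Implicit.
Unset Printing Implicit Defensive.
Import GRing.Theory.
Local Open Scope ring_scope.

(* A map of A(1)-modules is stably trivial exactly when it is obtained from a
   linear map by the action of the integral Sq2 Sq2 Sq2 of A(1); this turns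
   stable questions into matrix identities.

   Let S = Sigma^(-3) Omega. If M has no Sq1-homology, tensoring
   0 -> F -> D(A(1)//A(0)) -> Sigma^(-6) Omega J -> 0 with M makes the middle
   term projective, so M ~ S^2 (M (x) J); with J (x) J ~ F this gives
   M (x) J ~ S^2 M and S^4 M ~ M. The module L = Sigma^(-k-1) Omega^(k+1) J^eps is
   stably a module X in degrees >= 0 that has a single class in degree 0, a
   class that carries its Sq1-homology. So A = A_{k,eps} is stably the part of
   X in positive degrees, and it has no Sq1-homology. As X is invertible,
   dualizing 0 -> A -> X -> F -> 0 and tensoring with X gives
   A ~ Omega (X (x) D A), hence d_k A ~ S^(-(k+2+2eps)) A: the duality acts on
   the orbit {S^t A} as a reflection of Z/4 that has 2 or 0 fixed points
   according to the parity of k.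

   The orbit has 4 elements because A and A (x) J are not stably isomorphic:
   A ~ Omega C for some C in degrees >= -1 that contains a trivial submodule F
   in degree 0, whence C (x) J has an essential map to Sigma^(-2) F, while C
   has none. *)

(** * The integral of A(1) acting on linear maps *)

(** The criterion is Higman's: [A(1)] is a Frobenius algebra, linear maps form an [A(1)]-module
    whose invariants are the module maps, and the integral plays the part of the norm.

    Two obstacles shape the rest. [red] and [Amod] are chosen, not constructed, so nothing can be
    computed on them; explicit small modules replace them up to stable isomorphism. But the kernel
    of a map to F is not a stable notion. The functionals on L and on its model X correspond because
    Sq2 Sq2 Sq2 vanishes on L and because the bottom class of X is not a Sq1-boundary; the
    comparison of the two kernels is then invertible only up to a unipotent error.

    The Joker is not an admissible model: its Sq1-homology sits in its middle class. Omega J is one,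
    of dimension 3, and for k >= 1 there is always a factor Omega to absorb J. *)

Lemma addmm (m n : nat) (x : 'M['F_2]_(m, n)) : x + x = 0.
Proof. by apply/matrixP=> i j; rewrite !mxE -mulr2n (mulrn_pchar (pchar_Fp _)). Qed.

Lemma oppm (m n : nat) (x : 'M['F_2]_(m, n)) : - x = x.
Proof. by apply/esym/eqP; rewrite -addr_eq0 addmm. Qed.

Lemma addm_eq0 (m n : nat) (x y : 'M['F_2]_(m, n)) : x + y = 0 -> x = y.
Proof. by move/eqP; rewrite addr_eq0 oppm => /eqP. Qed.

Lemma addmK2 (m n : nat) (x y : 'M['F_2]_(m, n)) : x + (x + y) = y.
Proof. by rewrite addrA addmm add0r. Qed.

Lemma F2_cases (x : 'F_2) : x = 0 \/ x = 1.
Proof. by case: x => -[|[]] //= ?; [left|right]; apply/val_inj. Qed.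

Definition homog (M N : gmod) (d : int) (t : 'M['F_2]_(dim N, dim M)) : Prop :=
  forall i j, t i j != 0 -> deg i = deg j + d.

(** Homogeneous parts allow degrees to be ignored in existence arguments: a section or a splitting
    found as a bare matrix is made homogeneous afterwards. *)
Definition hpart (M N : gmod) (d : int) (t : 'M['F_2]_(dim N, dim M)) :
    'M['F_2]_(dim N, dim M) :=
  \matrix_(i, j) (if deg i == deg j + d then t i j else 0).

Lemma homog_hpart M N d t : @homog M N d (hpart d t).
Proof. by move=> i j; rewrite mxE; case: ifP => [/eqP //|]; rewrite eqxx. Qed.

Lemma hpart_id M N d t : @homog M N d t -> hpart d t = t.
Proof.
move=> ht; apply/matrixP=> i j; rewrite mxE; case: ifP => // /eqP ne.
by have [|/ht //] := eqVneq (t i j) 0.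
Qed.

Lemma hpartP M N d t : @homog M N d t <-> hpart d t = t.
Proof. by split=> [/hpart_id //|<-]; apply: homog_hpart. Qed.

Lemma hpartD M N d (s t : 'M_(dim N, dim M)) :
  @hpart M N d (s + t) = @hpart M N d s + @hpart M N d t.
Proof. by apply/matrixP=> i j; rewrite !mxE; case: ifP; rewrite ?addr0. Qed.

Lemma hpart_mull M N P c d e (s : 'M_(dim P, dim N)) (t : 'M_(dim N, dim M)) :
  c = d + e -> @homog N P d s -> @hpart M P c (s *m t) = s *m @hpart M N e t.
Proof.
move=> -> hs; apply/matrixP=> i j; rewrite !mxE.
have -> : (if deg i == deg j + (d + e) then \sum_k s i k * t k j else 0) =
    \sum_k (if deg i == deg j + (d + e) then s i k * t k j else 0).
  by case: ifP => // _; rewrite big1.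
apply: eq_bigr => k _; rewrite mxE.
have [->|/hs ->] := eqVneq (s i k) 0; first by rewrite !mul0r if_same.
by rewrite [d + e]addrC addrA (inj_eq (addIr _)); case: ifP; rewrite ?mulr0.
Qed.

Lemma hpart_mulr M N P c d e (s : 'M_(dim P, dim N)) (t : 'M_(dim N, dim M)) :
  c = d + e -> @homog M N e t -> @hpart M P c (s *m t) = @hpart N P d s *m t.
Proof.
move=> -> ht; apply/matrixP=> i j; rewrite !mxE.
have -> : (if deg i == deg j + (d + e) then \sum_k s i k * t k j else 0) =
    \sum_k (if deg i == deg j + (d + e) then s i k * t k j else 0).
  by case: ifP => // _; rewrite big1.
apply: eq_bigr => k _; rewrite mxE.
have [->|/ht ->] := eqVneq (t k j) 0; first by rewrite !mulr0 if_same.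
by rewrite [d + e]addrC addrA; case: ifP; rewrite ?mul0r.
Qed.

Lemma homog_mul M N P c d e (s : 'M_(dim P, dim N)) (t : 'M_(dim N, dim M)) :
  c = d + e -> @homog N P d s -> @homog M N e t -> @homog M P c (s *m t).
Proof. by move=> cE hs ht; apply/hpartP; rewrite (hpart_mull _ cE hs) (hpart_id ht). Qed.

Lemma homogD M N d (s t : 'M_(dim N, dim M)) :
  @homog M N d s -> @homog M N d t -> @homog M N d (s + t).
Proof. by move=> hs ht; apply/hpartP; rewrite hpartD !hpart_id. Qed.

Lemma homog_sq M (b : bool) : @homog M M b.+1%:Z (sq M b).
Proof. by move=> i j /sq_deg. Qed.

Lemma homog1 M : @homog M M 0 1%:M.
Proof. by move=> i j; rewrite mxE addr0; have [->|] := eqVneq i j; rewrite ?eqxx. Qed.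

Lemma is_hom_homog M N f : @is_hom M N f -> @homog M N 0 f.
Proof. by case=> h _ i j /h ->; rewrite addr0. Qed.

Lemma is_hom_sq M N f b : @is_hom M N f -> f *m sq M b = sq N b *m f.
Proof. by case. Qed.

Lemma is_homI M N f : @homog M N 0 f ->
  (forall b, f *m sq M b = sq N b *m f) -> @is_hom M N f.
Proof. by move=> h c; split=> // i j /h ->; rewrite addr0. Qed.

Lemma is_hom1 M : @is_hom M M 1%:M.
Proof. by apply: is_homI => [|b]; [exact: homog1|rewrite mulmx1 mul1mx]. Qed.

Lemma is_hom0 M N : @is_hom M N 0.
Proof. by split=> [i j|b]; rewrite ?mxE ?eqxx // mulmx0 mul0mx. Qed.

Lemma is_hom_mul M N P f g : @is_hom N P f -> @is_hom M N g -> @is_hom M P (f *m g).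
Proof.
move=> hf hg; apply: is_homI => [|b].
  by apply: (homog_mul (esym (addr0 0))); apply: is_hom_homog.
by rewrite -mulmxA (is_hom_sq b hg) !mulmxA (is_hom_sq b hf).
Qed.

Lemma is_homD M N f g : @is_hom M N f -> @is_hom M N g -> @is_hom M N (f + g).
Proof.
move=> hf hg; apply: is_homI => [|b]; first by apply: homogD; apply: is_hom_homog.
by rewrite mulmxDl mulmxDr !is_hom_sq.
Qed.

(* The action of A(1) on linear maps, phi |-> \sum a' phi chi(a''), and of its
   integral Sq2 Sq2 Sq2. *)
Definition ad (M N : gmod) (b : bool) (t : 'M['F_2]_(dim N, dim M)) :
    'M['F_2]_(dim N, dim M) :=
  if b then sq N true *m t + sq N false *m t *m sq M false + t *m sq M true
  else sq N false *m t + t *m sq M false.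

Definition Lam (M N : gmod) (t : 'M['F_2]_(dim N, dim M)) : 'M['F_2]_(dim N, dim M) :=
  ad true (ad true (ad true t)).

Lemma adD M N b s t : @ad M N b (s + t) = @ad M N b s + @ad M N b t.
Proof.
case: b; rewrite /ad !(mulmxDl, mulmxDr); last by rewrite addrACA.
by rewrite [RHS]addrACA; congr (_ + _); rewrite addrACA.
Qed.

Lemma ad0 M N b : @ad M N b 0 = 0.
Proof. by case: b; rewrite /ad !(mulmx0, mul0mx) !addr0. Qed.

Lemma ad_mull M N P b g t :
  @is_hom N P g -> @ad M P b (g *m t) = g *m @ad M N b t.
Proof.
move=> hg; have e b' : sq P b' *m (g *m t) = g *m (sq N b' *m t).
  by rewrite mulmxA -(is_hom_sq b' hg) mulmxA.
by case: b; rewrite /ad !e !mulmxDr !mulmxA.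
Qed.

Lemma ad_mulr M N P b g t :
  @is_hom M N g -> @ad M P b (t *m g) = @ad N P b t *m g.
Proof.
move=> hg; have e b' (x : 'M_(dim P, dim N)) : x *m g *m sq M b' = x *m sq N b' *m g.
  by rewrite -!mulmxA (is_hom_sq b' hg).
by case: b; rewrite /ad !mulmxDl ?mulmxA !e ?mulmxA.
Qed.

Lemma Lam_mull M N P g t : @is_hom N P g -> @Lam M P (g *m t) = g *m @Lam M N t.
Proof. by move=> hg; rewrite /Lam !(ad_mull _ _ hg). Qed.

Lemma Lam_mulr M N P g t : @is_hom M N g -> @Lam M P (t *m g) = @Lam N P t *m g.
Proof. by move=> hg; rewrite /Lam !(ad_mulr _ _ hg). Qed.

Lemma LamD M N s t : @Lam M N (s + t) = @Lam M N s + @Lam M N t.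
Proof. by rewrite /Lam 3!adD. Qed.

Lemma Lam0 M N : @Lam M N 0 = 0.
Proof. by rewrite -[LHS](addmK2 (@Lam M N 0)) -LamD addr0 addmm. Qed.

Lemma hpart_ad M N c d (b : bool) t (cE : c = d + b.+1%:Z) :
  hpart c (@ad M N b t) = @ad M N b (hpart d t).
Proof.
have cE' : c = b.+1%:Z + d by rewrite addrC.
have hM := @homog_sq M; have hN := @homog_sq N.
case: b cE cE' => cE cE'; rewrite /ad !hpartD.
  rewrite (hpart_mull _ cE' (hN true)) (hpart_mulr _ cE (hM true)).
  rewrite (@hpart_mulr _ _ _ c (d + 1) 1 _ _ _ (hM false)); last by rewrite cE -addrA.
  by rewrite (@hpart_mull _ _ _ (d + 1) 1 d _ _ _ (hN false)) // addrC.
by rewrite (hpart_mull _ cE' (hN false)) (hpart_mulr _ cE (hM false)).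
Qed.

Lemma hpart_Lam M N c d t : c = d + 6 -> hpart c (@Lam M N t) = @Lam M N (hpart d t).
Proof.
have ad2 e s : hpart (e + 2) (@ad M N true s) = ad true (hpart e s).
  exact: (@hpart_ad M N _ _ true).
by move=> cE; rewrite (_ : c = d + 2 + 2 + 2) ?/Lam ?ad2 // cE -!addrA.
Qed.

Lemma ad_sq1 M N t : @ad M N false (@ad M N false t) = 0.
Proof.
rewrite /ad !mulmxDl !mulmxDr !mulmxA (sq_presentation N).1 mul0mx add0r.
by rewrite -[t *m _ *m _]mulmxA (sq_presentation M).1 mulmx0 addr0 addmm.
Qed.

Lemma ad_sq2 M N t :
  @ad M N true (@ad M N true t) = @ad M N false (@ad M N true (@ad M N false t)).
Proof.
have [a1 b1] := sq_presentation N; have [c1 d1] := sq_presentation M.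
rewrite /ad; move: a1 b1 c1 d1.
move: (sq N false) (sq N true) (sq M false) (sq M true) => a b c d a1 b1 c1 d1.
rewrite !(mulmxDl, mulmxDr) !mulmxA a1 b1 !mul0mx.
rewrite -![_ *m c *m c]mulmxA c1 !mulmx0.
rewrite -![_ *m d *m d]mulmxA d1 !mulmxA !(addr0, add0r).
set u1 := a *m b *m a *m t; set u2 := b *m t *m d.
set u3 := b *m a *m t *m c; set u4 := a *m b *m t *m c.
set u5 := a *m t *m d *m c; set u6 := a *m t *m c *m d; set u7 := t *m c *m d *m c.
rewrite ?[in LHS]addrA ?[in RHS]addrA.
by rewrite [LHS](ACl ((3*6)*(1*4*7*2*5*8))) /= addmm add0r.
Qed.

Lemma Lam_xyxy M N t :
  @Lam M N t = @ad M N true (ad false (ad true (ad false t))).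
Proof. by rewrite /Lam [ad true (ad true t)]ad_sq2. Qed.

Lemma ad_Lam M N b t : @ad M N b (Lam t) = 0.
Proof.
case: b; last by rewrite /Lam ad_sq2 ad_sq1.
by rewrite /Lam ad_sq2 ad_sq2 ad_sq1 !ad0.
Qed.

(** The invariants of [ad] are the module maps: once [t] commutes with Sq1, the middle Cartan term
    for Sq2 becomes Sq1 Sq1 t = 0. *)
Lemma ad0_hom M N t : @homog M N 0 t -> (forall b, @ad M N b t = 0) -> @is_hom M N t.
Proof.
move=> ht h; have h1 : t *m sq M false = sq N false *m t.
  exact/esym/addm_eq0/(h false).
apply: is_homI => // -[] //; apply/esym/addm_eq0.
have := h true; rewrite /ad -[_ *m _ *m sq M false]mulmxA h1 mulmxA.
by rewrite (sq_presentation N).1 mul0mx addr0.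
Qed.

Lemma hom_ad0 M N b t : @is_hom M N t -> @ad M N b t = 0.
Proof.
move=> ht; case: b; rewrite /ad -?(is_hom_sq _ ht) ?addmm //.
by rewrite -mulmxA (sq_presentation M).1 mulmx0 addr0 addmm.
Qed.

Lemma Lam_hom M N t : @homog M N (- 6) t -> @is_hom M N (Lam t).
Proof.
move=> ht; apply: ad0_hom => [|b]; last exact: ad_Lam.
by apply/hpartP; rewrite (@hpart_Lam _ _ _ (- 6)) ?(hpart_id ht).
Qed.

(** No degree is imposed on the witness, so null maps form an ideal by mere linear algebra;
    [null_homog] recovers a witness of degree -6. *)
Definition null (M N : gmod) (f : 'M['F_2]_(dim N, dim M)) : Prop :=
  exists t, f = @Lam M N t.

Lemma null0 M N : @null M N 0.
Proof. by exists 0; rewrite Lam0. Qed.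

Lemma nullD M N f g : @null M N f -> @null M N g -> @null M N (f + g).
Proof. by move=> [s ->] [t ->]; exists (s + t); rewrite LamD. Qed.

Lemma null_mull M N P g f : @is_hom N P g -> @null M N f -> @null M P (g *m f).
Proof. by move=> hg [t ->]; exists (g *m t); rewrite Lam_mull. Qed.

Lemma null_mulr M N P g f : @is_hom M N g -> @null N P f -> @null M P (f *m g).
Proof. by move=> hg [t ->]; exists (t *m g); rewrite Lam_mulr. Qed.

Lemma null_homog M N f : @is_hom M N f -> @null M N f ->
  exists2 t, @homog M N (- 6) t & f = Lam t.
Proof.
move=> /is_hom_homog/hpart_id {2}<- [t ->]; exists (hpart (- 6) t).
  exact: homog_hpart.
exact: hpart_Lam.
Qed.

(* A section of a surjection can be taken homogeneous. *)
Lemma null_projective P : @null P P 1%:M -> projective P.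
Proof.
move=> nP M N q f hq sq hf.
have [t ht e] := null_homog (is_hom1 P) nP.
have /choice [s qs] : forall j : 'I_(dim N), exists u : 'cV_(dim M), q *m u = delta_mx j 0.
  by move=> j; exact: sq.
pose S : 'M_(dim M, dim N) := \matrix_(i, j) s j i 0.
have qS : q *m S = 1%:M.
  apply/matrixP=> i j; have /matrixP /(_ i 0) := qs j; rewrite !mxE eqxx andbT => <-.
  by apply: eq_bigr => k _; rewrite mxE.
pose S0 := @hpart N M 0 S.
have qS0 : q *m S0 = 1%:M.
  rewrite -(@hpart_mull N M N 0 0 0 q S _ (is_hom_homog hq)) ?addr0 //.
  by rewrite qS hpart_id //; apply: homog1.
(* The linear lift [S0 *m f *m t] is averaged: q Lam(S0 f t) = Lam(f t) = f Lam(t) = f. *)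
exists (@Lam P M (S0 *m f *m t)); split; last first.
  by rewrite -(Lam_mull _ hq) !mulmxA qS0 mul1mx (Lam_mull _ hf) -e mulmx1.
have hS0 : @homog N M 0 S0 := @homog_hpart N M 0 S.
apply: Lam_hom; apply: (@homog_mul P P M _ 0 (- 6)) => //.
by apply: (homog_mul (esym (addr0 0)) hS0 (is_hom_homog hf)).
Qed.

(** * Tensor products, duals and suspensions *)

Section TensorMatrices.
Variables (m n p q : nat).
Implicit Types (A B : 'M['F_2]_(m, n)) (C D : 'M['F_2]_(p, q)).

Lemma tensmxDl A B C : (A + B) *t C = A *t C + B *t C.
Proof. by apply/matrixP=> i j; rewrite !mxE mulrDl. Qed.

Lemma tensmxDr A C D : A *t (C + D) = A *t C + A *t D.
Proof. by apply/matrixP=> i j; rewrite !mxE mulrDr. Qed.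

End TensorMatrices.

Lemma tensmx11 m n : 1%:M *t 1%:M = 1%:M :> 'M['F_2]_(m * n).
Proof.
apply/matrixP=> k l; case: (mxtens_indexP k) => i1 i2; case: (mxtens_indexP l) => j1 j2.
rewrite tensmxE !mxE -natrM mulnb; congr (_%:R); congr nat_of_bool.
by rewrite (can_eq (@mxtens_indexK _ _)) xpair_eqE.
Qed.

Lemma deg_tens M N (i : 'I_(dim M)) (j : 'I_(dim N)) :
  @deg (tens M N) (mxtens_index (i, j)) = deg i + deg j.
Proof. by rewrite -[LHS]/(deg _.1 + deg _.2) mxtens_indexK. Qed.

Lemma homog_tens M N M' N' d e (t : 'M_(dim N, dim M)) (u : 'M_(dim N', dim M')) :
  homog d t -> homog e u -> @homog (tens M M') (tens N N') (d + e) (t *t u).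
Proof.
move=> ht hu k l; case: (mxtens_indexP k) => i1 i2; case: (mxtens_indexP l) => j1 j2.
rewrite tensmxE mulf_eq0 negb_or !deg_tens => /andP [/ht -> /hu ->].
by rewrite addrACA.
Qed.

(** Against an invariant factor only the action on the other factor survives in the Cartan formula.
    This makes null maps a tensor ideal. *)
Lemma ad_tens_homr M N M' N' b (t : 'M_(dim N, dim M)) (g : 'M_(dim N', dim M')) :
  @is_hom M' N' g ->
  @ad (tens M M') (tens N N') b (t *t g) = @ad M N b t *t g.
Proof.
move=> hg; have e b' := is_hom_sq b' hg.
case: b; rewrite /ad /= !(mulmxDl, mulmxDr) !tensmx_mul !(mul1mx, mulmx1) !e.
  rewrite -[sq N' false *m g *m _]mulmxA e mulmxA (sq_presentation N').1 mul0mx tensmx0 addr0.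
  have cancel m n (u v w x y z : 'M['F_2]_(m, n)) :
      u + v + w + (x + y + w) + (z + v + y) = u + x + z.
    rewrite !addrA [LHS](ACl ((2*8)*(3*6)*(5*9)*(1*4*7))) /=.
    by rewrite !addmm !add0r.
  by rewrite 2!tensmxDl; exact: cancel.
by rewrite tensmxDl addrACA addmm addr0.
Qed.

Lemma ad_tens_homl M N M' N' b (g : 'M_(dim N, dim M)) (t : 'M_(dim N', dim M')) :
  @is_hom M N g ->
  @ad (tens M M') (tens N N') b (g *t t) = g *t @ad M' N' b t.
Proof.
move=> hg; have e b' := is_hom_sq b' hg.
case: b; rewrite /ad /= !(mulmxDl, mulmxDr) !tensmx_mul !(mul1mx, mulmx1) !e.
  rewrite -[sq N false *m g *m _]mulmxA e mulmxA (sq_presentation N).1 mul0mx tens0mx add0r.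
  have cancel m n (u v w x y z : 'M['F_2]_(m, n)) :
      u + v + w + (w + (x + y)) + (u + z + x) = v + y + z.
    rewrite !addrA [LHS](ACl ((1*7)*(3*4)*(5*9)*(2*6*8))) /=.
    by rewrite !addmm !add0r.
  by rewrite 2!tensmxDr; exact: cancel.
by rewrite tensmxDr addrACA addmm add0r.
Qed.

Lemma ad1_tens M N M' N' (s : 'M_(dim N, dim M)) (t : 'M_(dim N', dim M')) :
  @ad (tens M M') (tens N N') false (s *t t) =
  @ad M N false s *t t + s *t @ad M' N' false t.
Proof.
rewrite /ad /= !(mulmxDl, mulmxDr) !tensmx_mul !(mul1mx, mulmx1).
by rewrite tensmxDl tensmxDr addrACA.
Qed.

Lemma is_hom_tens M N M' N' (f : 'M_(dim N, dim M)) (g : 'M_(dim N', dim M')) :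
  @is_hom M N f -> @is_hom M' N' g -> @is_hom (tens M M') (tens N N') (f *t g).
Proof.
move=> hf hg; apply: ad0_hom => [|b].
  by rewrite -[0](addr0 0); apply: homog_tens; apply: is_hom_homog.
by rewrite ad_tens_homr // hom_ad0 // tens0mx.
Qed.

Lemma Lam_tens_homr M N M' N' (t : 'M_(dim N, dim M)) (g : 'M_(dim N', dim M')) :
  @is_hom M' N' g -> @Lam (tens M M') (tens N N') (t *t g) = @Lam M N t *t g.
Proof. by move=> hg; rewrite /Lam !ad_tens_homr. Qed.

Lemma null_tensr M N M' N' (f : 'M_(dim N, dim M)) (g : 'M_(dim N', dim M')) :
  @null M N f -> @is_hom M' N' g -> @null (tens M M') (tens N N') (f *t g).
Proof. by move=> [t ->] hg; exists (t *t g); rewrite Lam_tens_homr. Qed.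

Lemma null_tensl M N M' N' (f : 'M_(dim N, dim M)) (g : 'M_(dim N', dim M')) :
  @is_hom M N f -> @null M' N' g -> @null (tens M M') (tens N N') (f *t g).
Proof. by move=> hf [t ->]; exists (f *t t); rewrite /Lam !ad_tens_homl. Qed.

Lemma null1_tensr M N : @null M M 1%:M -> @null (tens M N) (tens M N) 1%:M.
Proof. by move=> h; rewrite -tensmx11; apply: null_tensr h (is_hom1 N). Qed.

Lemma homog_dual M N d (t : 'M_(dim N, dim M)) :
  @homog M N d t -> @homog (dual N) (dual M) d t^T.
Proof. by move=> h i j; rewrite mxE => /h /= ->; rewrite opprD subrK. Qed.

Lemma ad_dual M N b (t : 'M_(dim N, dim M)) :
  @ad (dual N) (dual M) b t^T = (@ad M N b t)^T.
Proof.
case: b; rewrite /ad /= !raddfD /= !trmx_mul; last by rewrite addrC.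
by rewrite mulmxA [RHS](ACl (3*2*1)).
Qed.

Lemma is_hom_dual M N f : @is_hom M N f -> @is_hom (dual N) (dual M) f^T.
Proof.
move=> hf; apply: ad0_hom => [|b]; first exact/homog_dual/is_hom_homog.
by rewrite ad_dual (hom_ad0 b hf) trmx0.
Qed.

Lemma null_dual M N f : @null M N f -> @null (dual N) (dual M) f^T.
Proof. by move=> [t ->]; exists t^T; rewrite /Lam !ad_dual. Qed.

Lemma is_hom_susp M N n f : @is_hom M N f -> @is_hom (susp n M) (susp n N) f.
Proof. by move=> [h c]; split=> // i j /h /= ->. Qed.

Lemma null_susp M N n m f : @null M N f -> @null (susp n M) (susp m N) f.
Proof. by move=> [t ->]; exists t. Qed.

Definition fun_mx (m n : nat) (s : 'I_m -> 'I_n) : 'M['F_2]_(n, m) :=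
  \matrix_(i, j) (i == s j)%:R.

Lemma fun_mx_iso M N (s : 'I_(dim M) -> 'I_(dim N)) :
  bijective s -> (forall i, deg (s i) = deg i) ->
  (forall b i j, sq N b (s i) (s j) = sq M b i j) ->
  exists g, [/\ @is_hom M N (fun_mx s), @is_hom N M g, g *m fun_mx s = 1%:M
    & fun_mx s *m g = 1%:M].
Proof.
move=> [s' sK s'K] hd hs.
pose f := fun_mx s.
pose g : 'M['F_2]_(dim M, dim N) := \matrix_(i, j) (i == s' j)%:R.
have gE A (B : 'M['F_2]_(dim N, A)) i j : (g *m B) i j = B (s i) j.
  rewrite mxE (bigD1 (s i)) //= big1 ?addr0 => [|k ne]; first by rewrite mxE sK eqxx mul1r.
  by rewrite mxE (_ : i == _ = false) ?mul0r //; apply: contraNF ne => /eqP ->; rewrite s'K.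
have fE A (B : 'M['F_2]_(dim M, A)) i j : (f *m B) i j = B (s' i) j.
  rewrite mxE (bigD1 (s' i)) //= big1 ?addr0 => [|k ne]; first by rewrite mxE s'K eqxx mul1r.
  by rewrite mxE (_ : i == _ = false) ?mul0r //; apply: contraNF ne => /eqP ->; rewrite sK.
have gf : g *m f = 1%:M.
  by apply/matrixP=> i j; rewrite gE !mxE (can_eq sK).
have fg : f *m g = 1%:M.
  by apply/matrixP=> i j; rewrite fE !mxE (can_eq s'K).
have fs b : f *m sq M b = sq N b *m f.
  apply/matrixP=> i j; rewrite fE mxE (bigD1 (s j)) //= big1 ?addr0 => [|k ne].
    by rewrite mxE eqxx mulr1 -hs s'K.
  by rewrite mxE (negbTE ne) mulr0.
exists g; split=> //.
  split=> // i j; rewrite mxE; have [->|] := eqVneq i (s j); last by rewrite eqxx.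
  by rewrite hd.
split=> [i j|b].
  rewrite mxE; have [->|] := eqVneq i (s' j); last by rewrite eqxx.
  by rewrite -hd s'K.
by rewrite -[LHS]mulmx1 -fg -mulmxA (mulmxA (sq N b)) -fs !mulmxA gf mul1mx.
Qed.

Lemma iso_bij M N (s : 'I_(dim M) -> 'I_(dim N)) :
  bijective s -> (forall i, deg (s i) = deg i) ->
  (forall b i j, sq N b (s i) (s j) = sq M b i j) -> iso M N.
Proof. by move=> h1 h2 h3; have [g h] := fun_mx_iso h1 h2 h3; exists (fun_mx s), g. Qed.

Lemma iso_refl M : iso M M.
Proof. by exists 1%:M, 1%:M; rewrite !mulmx1; split=> //; apply: is_hom1. Qed.

Lemma sq_tensE M N (b : bool) (i i' : 'I_(dim M)) (j j' : 'I_(dim N)) :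
  @sq (tens M N) b (mxtens_index (i, j)) (mxtens_index (i', j')) =
  sq M b i i' * (j == j')%:R + (i == i')%:R * sq N b j j' +
  b%:R * (sq M false i i' * sq N false j j').
Proof.
case: b; rewrite -[LHS]/(tens_sq M N _ _ _) /tens_sq mxE.
  by rewrite [X in X + _]mxE !tensmxE ![1%:M _ _]mxE mul1r.
by rewrite !tensmxE ![1%:M _ _]mxE mul0r addr0.
Qed.

Lemma iso_unitl M : iso (tens unit_mod M) M.
Proof.
pose s (k : 'I_(dim (tens unit_mod M))) : 'I_(dim M) := (mxtens_unindex k).2.
pose s' (i : 'I_(dim M)) : 'I_(dim (tens unit_mod M)) := mxtens_index (ord0, i).
apply: (@iso_bij _ _ s).
- exists s' => [k|i]; rewrite /s /s' ?mxtens_indexK //.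
  by case: (mxtens_indexP k) => i j; rewrite mxtens_indexK (ord1 i).
- by move=> k; case: (mxtens_indexP k) => i j; rewrite /s deg_tens mxtens_indexK /= add0r.
- move=> b k l; case: (mxtens_indexP k) => i j; case: (mxtens_indexP l) => i' j'.
  rewrite /s !mxtens_indexK sq_tensE /= !mxE (ord1 i) (ord1 i').
  by case: b; rewrite /= !(mul0r, mulr0, mul1r, addr0, add0r).
Qed.

Lemma iso_comm M N : iso (tens M N) (tens N M).
Proof.
pose s M N (k : 'I_(dim (tens M N))) : 'I_(dim (tens N M)) :=
  mxtens_index ((mxtens_unindex k).2, (mxtens_unindex k).1).
have sK M' N' : cancel (s M' N') (s N' M').
  by move=> k; case: (mxtens_indexP k) => i j; rewrite /s !mxtens_indexK.
apply: (@iso_bij _ _ (s M N)); first by exists (s N M).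
- by move=> k; case: (mxtens_indexP k) => i j; rewrite /s mxtens_indexK !deg_tens addrC.
- move=> b k l; case: (mxtens_indexP k) => i j; case: (mxtens_indexP l) => i' j'.
  rewrite /s !mxtens_indexK !sq_tensE [sq M false i i' * _]mulrC; congr (_ + _).
  by rewrite addrC; congr (_ + _); rewrite mulrC.
Qed.

Lemma iso_assoc M N P : iso (tens M (tens N P)) (tens (tens M N) P).
Proof.
pose s (k : 'I_(dim (tens M (tens N P)))) : 'I_(dim (tens (tens M N) P)) :=
  let v := mxtens_unindex (mxtens_unindex k).2 in
  mxtens_index (mxtens_index ((mxtens_unindex k).1, v.1), v.2).
pose s' (k : 'I_(dim (tens (tens M N) P))) : 'I_(dim (tens M (tens N P))) :=
  let v := mxtens_unindex (mxtens_unindex k).1 in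
  mxtens_index (v.1, mxtens_index (v.2, (mxtens_unindex k).2)).
apply: (@iso_bij _ _ s).
- exists s' => k; rewrite /s /s'; case: (mxtens_indexP k) => i j.
    by case: (mxtens_indexP j) => j1 j2; rewrite !mxtens_indexK.
  by case: (mxtens_indexP i) => i1 i2; rewrite !mxtens_indexK.
- move=> k; case: (mxtens_indexP k) => i j; case: (mxtens_indexP j) => j1 j2.
  by rewrite /s !mxtens_indexK !deg_tens addrA.
- move=> b k l; case: (mxtens_indexP k) => i j; case: (mxtens_indexP j) => j1 j2.
  case: (mxtens_indexP l) => i' j'; case: (mxtens_indexP j') => j1' j2'.
  rewrite /s !mxtens_indexK !sq_tensE.
  rewrite !(can_eq (@mxtens_indexK _ _)) !xpair_eqE -!mulnb !natrM.
  rewrite [false%:R]/(0 : 'F_2) !mul0r !addr0 !mulrDl !mulrDr.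
  cbn [fst snd]; ring.
Qed.

Lemma iso_susp_tens n M N : iso (tens (susp n M) N) (susp n (tens M N)).
Proof.
apply: (@iso_bij (tens (susp n M) N) (susp n (tens M N)) id); first by exists id.
  by move=> k /=; rewrite addrAC.
by move=> b i j.
Qed.

Lemma iso_susp_susp m n M : iso (susp m (susp n M)) (susp (n + m) M).
Proof.
apply: (@iso_bij (susp m (susp n M)) (susp (n + m) M) id); first by exists id.
  by move=> k /=; rewrite addrA.
by [].
Qed.

Lemma iso_susp0 M : iso (susp 0 M) M.
Proof.
apply: (@iso_bij (susp 0 M) M id); first by exists id.
  by move=> k /=; rewrite addr0.
by [].
Qed.

Lemma iso_dual_susp n M : iso (dual (susp n M)) (susp (- n) (dual M)).
Proof.
apply: (@iso_bij (dual (susp n M)) (susp (- n) (dual M)) id); first by exists id.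
  by move=> k /=; rewrite opprD.
by [].
Qed.

Lemma iso_dual_tens M N : iso (dual (tens M N)) (tens (dual M) (dual N)).
Proof.
apply: (@iso_bij (dual (tens M N)) (tens (dual M) (dual N)) id); first by exists id.
  by move=> k /=; rewrite opprD.
move=> b k l; case: (mxtens_indexP k) => i j; case: (mxtens_indexP l) => i' j'.
rewrite [LHS](@sq_tensE (dual M) (dual N)) -[RHS]/((sq (tens M N) b)^T _ _) [RHS]mxE.
by rewrite sq_tensE /= !mxE [j == _]eq_sym [i == _]eq_sym.
Qed.

Lemma iso_dual_unit : iso (dual unit_mod) unit_mod.
Proof.
apply: (@iso_bij (dual unit_mod) unit_mod id); first by exists id.
  by move=> k /=; rewrite oppr0.
by move=> b i j /=; rewrite !mxE.
Qed.

(** * The stable category *)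

(* Memoization: under call-by-value evaluation the table is computed once. *)
Definition ntab (m n : nat) (f : nat -> nat -> nat) : nat -> nat -> nat :=
  let T := [seq [seq nat_of_bool (odd (f i j)) | j <- iota 0 n] | i <- iota 0 m] in
  fun i j => nth 0%N (nth [::] T i) j.

Lemma natmx_ntab m n f : natmx m n (ntab m n f) = natmx m n f.
Proof.
apply/matrixP=> i j; rewrite !mxE /ntab [RHS]natr_F2.
rewrite (nth_map 0%N) ?size_iota // nth_iota // add0n.
by rewrite (nth_map 0%N) ?size_iota // nth_iota // add0n.
Qed.

Definition nad (m n : nat) (sm sn : bool -> nat -> nat -> nat) (b : bool)
    (f : nat -> nat -> nat) : nat -> nat -> nat :=
  let t := ntab n m f in
  let u := ntab n m (nmul n (sn false) t) in
  if b then
    fun i j => (nmul n (sn true) t i j + nmul m u (sm false) i j + nmul m t (sm true) i j)%N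
  else fun i j => (u i j + nmul m t (sm false) i j)%N.

Definition nLam m n sm sn f := nad m n sm sn true (nad m n sm sn true (nad m n sm sn true f)).

Lemma ad_natmx (M N : gmod) (sm sn : bool -> nat -> nat -> nat) b f :
  (forall b, sq M b = natmx (dim M) (dim M) (sm b)) ->
  (forall b, sq N b = natmx (dim N) (dim N) (sn b)) ->
  @ad M N b (natmx (dim N) (dim M) f) =
    natmx (dim N) (dim M) (nad (dim M) (dim N) sm sn b f).
Proof.
move=> hM hN; rewrite -[in LHS](natmx_ntab _ _ f) /ad /nad !hM !hN.
have -> : natmx (dim N) (dim N) (sn false) *m natmx (dim N) (dim M) (ntab (dim N) (dim M) f) =
    natmx (dim N) (dim M) (ntab (dim N) (dim M)
      (nmul (dim N) (sn false) (ntab (dim N) (dim M) f))).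
  by rewrite [RHS]natmx_ntab natmx_mul.
by case: b; rewrite !natmx_mul ?natmx_add.
Qed.

Lemma Lam_natmx (M N : gmod) (sm sn : bool -> nat -> nat -> nat) f :
  (forall b, sq M b = natmx (dim M) (dim M) (sm b)) ->
  (forall b, sq N b = natmx (dim N) (dim N) (sn b)) ->
  @Lam M N (natmx (dim N) (dim M) f) = natmx (dim N) (dim M) (nLam (dim M) (dim N) sm sn f).
Proof. by move=> hM hN; rewrite /Lam !(ad_natmx _ _ hM hN). Qed.

(** The Frobenius form of A(1): the map of degree -6 that sends the top class to 1 and kills the
    other basis elements integrates to the identity. *)
Lemma Lam_A1 : @Lam A1_mod A1_mod (delta_mx 0 ord_max) = 1%:M.
Proof.
have -> : delta_mx 0 ord_max = natmx 8 8 (fun i j => (i == 0%N) && (j == 7%N)).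
  by apply/matrixP=> i j; rewrite !mxE.
rewrite (@Lam_natmx A1_mod A1_mod (fun b => nedge (A1_edges b)) (fun b => nedge (A1_edges b))).
- by rewrite natmx1; apply: natmx_eq; vm_compute.
- by move=> b; rewrite -edge_mxE.
- by move=> b; rewrite -edge_mxE.
Qed.

Lemma null1_A1 : @null A1_mod A1_mod 1%:M.
Proof. by exists (delta_mx 0 ord_max); rewrite Lam_A1. Qed.

Definition augm : 'M['F_2]_(dim unit_mod, dim A1_mod) := natmx 1 8 (fun _ j => j == 0%N).

Lemma augm_hom : @is_hom A1_mod unit_mod augm.
Proof.
split=> [i j|b].
  by rewrite mxE /=; case: (nat_of_ord j =P 0%N) => [->|]; rewrite ?eqxx.
by rewrite /= !edge_mxE !natmx_mul; apply: natmx_eq; case: b.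
Qed.

Definition augm_sec : 'M['F_2]_(dim A1_mod, dim unit_mod) := natmx 8 1 (fun i _ => i == 0%N).

Lemma augm_secK : augm *m augm_sec = 1%:M.
Proof. by rewrite natmx_mul natmx1; exact: natmx_eq. Qed.

Lemma augm_sec_homog : @homog unit_mod A1_mod 0 augm_sec.
Proof.
by move=> i j; rewrite mxE /= addr0; case: (nat_of_ord i =P 0%N) => [->|]; rewrite ?eqxx.
Qed.

(** The cover is A(1) (x) M with the diagonal action, mapped to M by the augmentation. Its identity
    is null by the tensor ideal property, so its freeness never has to be shown. *)
Lemma free_cover M : exists (q : 'M_(dim M, dim (tens A1_mod M))) r,
  [/\ @is_hom (tens A1_mod M) M q, @homog M (tens A1_mod M) 0 r & q *m r = 1%:M].
Proof.
have [f [g [hf hg gf fg]]] := iso_unitl M.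
exists (f *m (augm *t 1%:M)), ((augm_sec *t 1%:M) *m g); split.
- apply: is_hom_mul hf _; exact: is_hom_tens augm_hom (is_hom1 M).
- apply: (homog_mul (esym (addr0 0)) _ (is_hom_homog hg)).
  by rewrite -[0](addr0 0); apply: homog_tens augm_sec_homog (@homog1 M).
- by rewrite -mulmxA (mulmxA (_ *t _)) tensmx_mul augm_secK mul1mx tensmx11 mul1mx.
Qed.

(** A projective P is a retract of its cover A(1) (x) P, whose identity is null. *)
Lemma projectiveP P : projective P <-> @null P P 1%:M.
Proof.
split=> [pP|]; last exact: null_projective.
have [q [r [hq hr qr]]] := free_cover P.
have qs (v : 'cV_(dim P)) : exists u, q *m u = v by exists (r *m v); rewrite mulmxA qr mul1mx.
have [g [hg <-]] := pP _ _ q 1%:M hq qs (is_hom1 P).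
apply: null_mull hq _; rewrite -[g]mul1mx; apply: null_mulr hg _.
exact: null1_tensr null1_A1.
Qed.

(** A null map factors through the cover of its target: with a linear section [r] of [q], Lam(t) =
    Lam(q r t) = q Lam(r t). *)
Lemma stably_zeroP M N f : @is_hom M N f -> @stably_zero M N f <-> null f.
Proof.
move=> hf; split=> [[P [g [h [/projectiveP nP hg hh ->]]]]|nf].
  by rewrite -[g]mul1mx; apply: null_mull hh _; apply: null_mulr hg _.
have [t ht ->] := null_homog hf nf; have [q [r [hq hr qr]]] := free_cover N.
exists (tens A1_mod N), (@Lam M (tens A1_mod N) (r *m t)), q; split=> //.
- by apply/projectiveP; exact: null1_tensr null1_A1.
- by apply: Lam_hom; apply: (homog_mul _ hr ht); rewrite add0r.
- by rewrite -(Lam_mull _ hq) mulmxA qr mul1mx.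
Qed.

Lemma stable_isoP M N : stable_iso M N <->
  exists f g, [/\ @is_hom M N f, @is_hom N M g,
    @null M M (g *m f - 1%:M) & @null N N (f *m g - 1%:M)].
Proof.
have h1 (P : gmod) (u : 'M_(dim P)) : @is_hom P P u -> @is_hom P P (u - 1%:M).
  by move=> hu; rewrite oppm; apply: is_homD hu (is_hom1 P).
split=> -[f [g [hf hg n1 n2]]]; exists f, g; split=> //.
all: by apply/stably_zeroP => //; apply: h1; apply: is_hom_mul.
Qed.

Lemma iso_stable M N : iso M N -> stable_iso M N.
Proof.
move=> [f [g [hf hg gf fg]]]; apply/stable_isoP; exists f, g.
by rewrite gf fg !subrr; split=> //; exact: null0.
Qed.

Lemma stable_refl M : stable_iso M M.
Proof. exact/iso_stable/iso_refl. Qed.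

Lemma stable_sym M N : stable_iso M N -> stable_iso N M.
Proof. by move=> [f [g [hf hg gf fg]]]; exists g, f. Qed.

Lemma stable_trans N M P : stable_iso M N -> stable_iso N P -> stable_iso M P.
Proof.
move=> /stable_isoP [f [g [hf hg gf fg]]] /stable_isoP [f' [g' [hf' hg' gf' fg']]].
apply/stable_isoP; exists (f' *m f), (g *m g'); split; try exact: is_hom_mul.
  rewrite -(subrK (g *m f) (_ - _)) -addrA addrA.
  have -> : g *m g' *m (f' *m f) - 1%:M - g *m f + g *m f =
    (g *m ((g' *m f' - 1%:M) *m f)) + (g *m f - 1%:M).
    by rewrite mulmxBl mul1mx mulmxBr !mulmxA subrK addrA subrK.
  by apply: nullD => //; apply: null_mull hg _; apply: null_mulr hf _.
have -> : f' *m f *m (g *m g') - 1%:M =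
    (f' *m ((f *m g - 1%:M) *m g')) + (f' *m g' - 1%:M).
  by rewrite mulmxBl mul1mx mulmxBr !mulmxA addrA subrK.
by apply: nullD => //; apply: null_mull hf' _; apply: null_mulr hg' _.
Qed.

Lemma stable_tens M M' N N' : stable_iso M M' -> stable_iso N N' ->
  stable_iso (tens M N) (tens M' N').
Proof.
move=> /stable_isoP [f [g [hf hg gf fg]]] /stable_isoP [f' [g' [hf' hg' gf' fg']]].
have key (P Q : gmod) (u : 'M_(dim P)) (v : 'M_(dim Q)) : @is_hom P P u ->
    null (u - 1%:M) -> @null Q Q (v - 1%:M) -> @null (tens P Q) (tens P Q) (u *t v - 1%:M).
  move=> hu nu nv; rewrite -tensmx11.
  have -> : u *t v - 1%:M *t 1%:M = u *t (v - 1%:M) + (u - 1%:M) *t 1%:M.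
    by rewrite !oppm tensmxDl tensmxDr -addrA addmK2.
  by apply: nullD; [exact: null_tensl|exact: null_tensr nu (is_hom1 Q)].
apply/stable_isoP; exists (f *t f'), (g *t g'); split; try exact: is_hom_tens.
  by rewrite tensmx_mul; apply: key => //; apply: is_hom_mul.
by rewrite tensmx_mul; apply: key => //; apply: is_hom_mul.
Qed.

Lemma stable_dual M N : stable_iso M N -> stable_iso (dual M) (dual N).
Proof.
move=> /stable_isoP [f [g [hf hg gf fg]]]; apply/stable_isoP; exists g^T, f^T.
split; try exact: is_hom_dual.
  by rewrite -trmx_mul -[1%:M]trmx1 -raddfB; apply: (@null_dual M M).
by rewrite -trmx_mul -[1%:M]trmx1 -raddfB; apply: (@null_dual N N).
Qed.

Lemma stable_susp n M N : stable_iso M N -> stable_iso (susp n M) (susp n N).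
Proof.
move=> /stable_isoP [f [g [hf hg gf fg]]]; apply/stable_isoP; exists f, g.
by split; [exact: is_hom_susp|exact: is_hom_susp|exact: null_susp gf|exact: null_susp fg].
Qed.

Lemma null1_susp n M : @null M M 1%:M -> @null (susp n M) (susp n M) 1%:M.
Proof. exact: null_susp. Qed.

Lemma null1_dual M : @null M M 1%:M -> @null (dual M) (dual M) 1%:M.
Proof. by move/null_dual; rewrite trmx1. Qed.

(** * Splitting off projective summands *)

(** The image of [e] needs a homogeneous basis, built one vector at a time: an entry e_ab = 1 gives
    a column [v] and a row [l] of [e] with l v = (e e)_ab = 1, so [v *m l] is a homogeneous
    idempotent of rank one to be subtracted from [e]. *)
Lemma homog_idem_split M (e : 'M['F_2]_(dim M)) : @homog M M 0 e -> e *m e = e ->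
  exists n (d : 'I_n -> int) (i : 'M['F_2]_(dim M, n)) (r : 'M['F_2]_(n, dim M)),
    [/\ i *m r = e, r *m i = 1%:M, forall a b, i a b != 0 -> deg a = d b
      & forall a b, r a b != 0 -> d a = deg b].
Proof.
have [k] := ubnP (\rank e); elim: k e => // k IH e ek he ee.
have [/eqP e0|] := boolP (e == 0).
  exists 0%N, (fun _ => 0), 0, 0; split=> [||a []//|[]//].
    by rewrite mulmx0.
  by apply/matrixP=> -[].
move=> e0; have [a [b eab]] : exists a b, e a b != 0.
  apply: contrapT => /forallNP h; case/eqP: e0; apply/matrixP=> a b; rewrite mxE.
  by apply/eqP/negPn/negP => eab; apply: (h a); exists b.
have eab1 : e a b = 1 by case: (F2_cases (e a b)) eab => // ->; rewrite eqxx.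
have dab : deg a = deg b by rewrite (he _ _ eab) addr0.
pose v := col b e; pose l := row a e.
have ev : e *m v = v by rewrite /v colE mulmxA ee.
have le : l *m e = l by rewrite /l rowE -mulmxA ee.
have lv : l *m v = 1%:M.
  rewrite /l /v rowE colE mulmxA -[delta_mx 0 a *m e *m e]mulmxA ee -mulmxA -colE -rowE.
  by apply/matrixP=> p q; rewrite !mxE eab1 (ord1 p) (ord1 q).
pose e' := e - v *m l.
have ve' : l *m e' = 0 by rewrite mulmxBr le mulmxA lv mul1mx subrr.
have e'v : e' *m v = 0 by rewrite mulmxBl ev -mulmxA lv mulmx1 subrr.
have e'e : e' *m e = e' by rewrite mulmxBl ee -mulmxA le.
have e'e' : e' *m e' = e' by rewrite {2}/e' mulmxBr e'e mulmxA e'v mul0mx subr0.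
have hv p q : v p q != 0 -> deg p = deg b by rewrite mxE => /he ->; rewrite addr0.
have hl p q : l p q != 0 -> deg a = deg q by rewrite mxE => /he ->; rewrite addr0.
have he' : @homog M M 0 e'.
  rewrite /e' oppm; apply: homogD => // p q; rewrite mxE big_ord1 mulf_eq0 negb_or.
  by case/andP=> /hv -> /hl <-; rewrite addr0.
have rk : (\rank e' < k)%N.
  rewrite ltnS in ek; apply: leq_trans ek; have : (e' < e)%MS.
    rewrite /ltmx -{1}e'e submxMl /=; apply/negP => /submxP [D eD].
    have := lv; rewrite -le eD -!mulmxA e'v !mulmx0 => /matrixP /(_ 0 0).
    by rewrite !mxE eqxx => /eqP; rewrite eq_sym oner_eq0.
  by rewrite ltmxErank => /andP [].
have [n [d [i [r [ir ri hi hr]]]]] := IH e' rk he' e'e'.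
have li : l *m i = 0 by rewrite -[i]mulmx1 -ri mulmxA mulmxA -[l *m i *m r]mulmxA ir ve' mul0mx.
have rv : r *m v = 0 by rewrite -[r]mul1mx -ri -[_ *m r]mulmxA ir -mulmxA e'v mulmx0.
exists (1 + n)%N, (fun k => match fintype.split k with inl _ => deg b | inr j => d j end).
exists (row_mx v i), (col_mx l r); split.
- by rewrite mul_row_col ir /e' addrC subrK.
- by rewrite mul_col_row lv ri li rv -scalar_mx_block.
- move=> p q; case: (split_ordP q) => q' ->.
    by rewrite row_mxEl => /hv.
  by rewrite row_mxEr => /hi.
- move=> p q; case: (split_ordP p) => p' ->.
    by rewrite col_mxEu -dab => /hl.
  by rewrite col_mxEd => /hr.
Qed.

(** The last hypothesis says that the image of [e] is a submodule; its complement need not be one,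
    so [r] is only a linear retraction. *)
Lemma submodule_split M (e : 'M['F_2]_(dim M)) : @homog M M 0 e -> e *m e = e ->
  (forall b, e *m sq M b *m e = sq M b *m e) ->
  exists K (i : 'M_(dim M, dim K)) (r : 'M_(dim K, dim M)),
    [/\ @is_hom K M i, @homog M K 0 r, i *m r = e & r *m i = 1%:M].
Proof.
move=> he ee se; have [n [d [i [r [ir ri hi hr]]]]] := homog_idem_split he ee.
have ei : e *m i = i by rewrite -ir -mulmxA ri mulmx1.
have isr b : i *m (r *m (sq M b *m i)) = sq M b *m i.
  by rewrite !mulmxA ir -{1}ei mulmxA se -mulmxA ei.
have hd (b : bool) (p q : 'I_n) : (r *m sq M b *m i) p q != 0 -> d p = d q + b.+1%:Z.
  rewrite mxE => /eqP nz.
  have [k] : exists k, (r *m sq M b) p k * i k q != 0.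
    by apply/not_existsP => h; apply: nz; rewrite big1 // => k _; apply/eqP/negPn/negP/h.
  rewrite mulf_eq0 negb_or => /andP [+ /hi <-]; rewrite mxE => /eqP nz2.
  have [l] : exists l, r p l * sq M b l k != 0.
    by apply/not_existsP => h; apply: nz2; rewrite big1 // => l _; apply/eqP/negPn/negP/h.
  by rewrite mulf_eq0 negb_or => /andP [/hr -> /sq_deg].
have irr n' b (x : 'M_(dim M, n')) : e *m x = x -> i *m (r *m (sq M b *m x)) = sq M b *m x.
  by move=> <-; rewrite mulmxA ir !mulmxA se.
have h1 : (r *m sq M false *m i) *m (r *m sq M false *m i) = 0.
  by rewrite -!mulmxA isr (mulmxA (sq M false)) (sq_presentation M).1 mul0mx mulmx0.
have h2 : (r *m sq M true *m i) *m (r *m sq M true *m i) =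
   (r *m sq M false *m i) *m (r *m sq M true *m i) *m (r *m sq M false *m i).
  rewrite -!mulmxA !isr irr; last by rewrite -isr mulmxA -ir -[i *m r *m i]mulmxA ri mulmx1.
  by rewrite !mulmxA -[r *m _ *m _]mulmxA (sq_presentation M).2 !mulmxA.
exists (mk_gmod hd h1 h2), i, r; split=> //.
- split=> [p q /hi //|b]; by rewrite -isr !mulmxA.
- by move=> p q /hr h; rewrite addr0; exact: h.
Qed.

Lemma is_hom_col M A B f g : @is_hom M A f -> @is_hom M B g ->
  @is_hom M (dsum A B) (col_mx f g).
Proof.
move=> hf hg; split=> [p q|b].
  case: (split_ordP p) => p' -> /=;
    rewrite ?col_mxEu ?col_mxEd ?(unsplitK (inl _)) ?(unsplitK (inr _)).
    by case: hf => h _ /h.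
  by case: hg => h _ /h.
rewrite /= mul_block_col !mul0mx addr0 add0r -!is_hom_sq //.
by rewrite mul_col_mx.
Qed.

Lemma is_hom_row M A B f g : @is_hom A M f -> @is_hom B M g ->
  @is_hom (dsum A B) M (row_mx f g).
Proof.
move=> hf hg; split=> [p q|b].
  case: (split_ordP q) => q' -> /=;
    rewrite ?row_mxEl ?row_mxEr ?(unsplitK (inl _)) ?(unsplitK (inr _)).
    by case: hf => h _ /h.
  by case: hg => h _ /h.
by rewrite /= mul_row_block !mulmx0 addr0 add0r !is_hom_sq // mul_mx_row.
Qed.

(** Direct sums through their structure maps, which keeps block matrices out of the splitting
    arguments; orthogonality of the two summands follows ([biprod_orth]). *)
Definition biprod (M A B : gmod) : Prop :=
  exists (a : 'M_(dim M, dim A)) (a' : 'M_(dim A, dim M))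
         (b : 'M_(dim M, dim B)) (b' : 'M_(dim B, dim M)),
    [/\ @is_hom A M a /\ @is_hom M A a', @is_hom B M b /\ @is_hom M B b',
        a' *m a = 1%:M, b' *m b = 1%:M & a *m a' + b *m b' = 1%:M].

Lemma biprod_orth M A B (a : 'M['F_2]_(dim M, dim A)) (a' : 'M_(dim A, dim M))
    (b : 'M_(dim M, dim B)) (b' : 'M_(dim B, dim M)) :
  a' *m a = 1%:M -> a *m a' + b *m b' = 1%:M -> b' *m b = 1%:M -> a' *m b = 0.
Proof.
move=> aa ab bb.
have : a' *m (b *m b') = 0.
  by rewrite -[b *m b'](addmK2 (a *m a')) ab mulmxDr mulmx1 mulmxA aa mul1mx addmm.
by move=> /(congr1 (mulmx^~ b)); rewrite mul0mx -!mulmxA bb mulmx1.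
Qed.

Lemma biprodP M A B : biprod M A B <-> iso M (dsum A B).
Proof.
split=> [[a [a' [b [b' [[ha ha'] [hb hb'] aa bb ab]]]]]|].
  have a'b := biprod_orth aa ab bb.
  have b'a : b' *m a = 0 by rewrite addrC in ab; exact: biprod_orth bb ab aa.
  exists (col_mx a' b'), (row_mx a b); split.
  - exact: is_hom_col.
  - exact: is_hom_row.
  - by rewrite mul_row_col.
  - by rewrite mul_col_row aa bb a'b b'a -scalar_mx_block.
move=> [f [g [hf hg gf fg]]].
have h0 := is_hom0; have h1 := is_hom1.
exists (g *m col_mx 1%:M 0), (row_mx 1%:M 0 *m f), (g *m col_mx 0 1%:M), (row_mx 0 1%:M *m f).
split; [split|split| | |].
1: by apply: is_hom_mul hg _; apply: is_hom_col.
1: by apply: is_hom_mul _ hf; apply: is_hom_row.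
1: by apply: is_hom_mul hg _; apply: is_hom_col.
1: by apply: is_hom_mul _ hf; apply: is_hom_row.
- by rewrite -mulmxA (mulmxA f) fg mul1mx mul_row_col mul1mx mul0mx addr0.
- by rewrite -mulmxA (mulmxA f) fg mul1mx mul_row_col mul1mx mul0mx add0r.
rewrite -!(mulmxA g) -mulmxDr -gf; congr (_ *m _).
rewrite !mulmxA -mulmxDl !mul_col_row !mul0mx !mulmx0 !mul1mx add_block_mx !addr0 !add0r.
by rewrite -scalar_mx_block mul1mx.
Qed.

Lemma biprod_assoc M A K B C : biprod M A K -> biprod K B C -> biprod M (dsum A B) C.
Proof.
move=> [a [a' [k [k' [[ha ha'] [hk hk'] aa kk ak]]]]].
move=> [b [b' [c [c' [[hb hb'] [hc hc'] bb cc bc]]]]].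
have a'k := biprod_orth aa ak kk.
have k'a : k' *m a = 0 by rewrite addrC in ak; exact: biprod_orth kk ak aa.
exists (row_mx a (k *m b)), (col_mx a' (b' *m k')), (k *m c), (c' *m k').
split; [split|split| | |].
- by apply: is_hom_row => //; apply: is_hom_mul.
- by apply: is_hom_col => //; apply: is_hom_mul.
- exact: is_hom_mul.
- exact: is_hom_mul.
- rewrite mul_col_row aa mulmxA a'k mul0mx -(mulmxA b') k'a mulmx0.
  by rewrite -mulmxA (mulmxA k') kk mul1mx bb -scalar_mx_block.
- by rewrite -mulmxA (mulmxA k') kk mul1mx cc.
rewrite mul_row_col -addrA -ak; congr (_ + _).
by rewrite -!mulmxA -mulmxDr !mulmxA -mulmxDl bc mul1mx.
Qed.

Lemma null1_dsum M N : @null M M 1%:M -> @null N N 1%:M ->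
  @null (dsum M N) (dsum M N) 1%:M.
Proof.
move=> nM nN.
have [a [a' [b [b' [[ha ha'] [hb hb'] aa bb <-]]]]] := (biprodP (dsum M N) M N).2 (iso_refl _).
by apply: nullD; [rewrite -[a]mulmx1|rewrite -[b]mulmx1]; rewrite -mulmxA;
  apply: null_mull => //; apply: null_mulr.
Qed.

Lemma null1_free s : @null (free_mod s) (free_mod s) 1%:M.
Proof.
elim: s => [|n s IH]; last exact: null1_dsum (null1_susp n null1_A1) IH.
by exists 0; apply/matrixP=> -[].
Qed.

Lemma stable_dsum_free s M N : iso M (dsum (free_mod s) N) -> stable_iso M N.
Proof.
move=> /biprodP [a [a' [b [b' [[ha ha'] [hb hb'] aa bb ab]]]]].
apply/stable_isoP; exists b', b; split=> //; last by rewrite bb subrr; exact: null0.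
rewrite -ab opprD addrCA subrr addr0 oppm -[a]mulmx1 -mulmxA.
by apply: null_mull ha _; apply: null_mulr ha' _; exact: null1_free.
Qed.

Section FreeSummand.
Variables (M : gmod) (x : 'cV['F_2]_(dim M)).

(* The map A(1) -> M with 1 |-> x. *)
Definition from_A1 : 'M['F_2]_(dim M, dim A1_mod) :=
  \matrix_(i, j) (A1_word (sq M) j *m x) i 0.

Lemma from_A1_col (j : 'I_(dim A1_mod)) :
  from_A1 *m (delta_mx j 0 : 'cV_(dim A1_mod)) = A1_word (sq M) j *m x.
Proof. by rewrite -colE; apply/colP=> i; rewrite !mxE. Qed.

Lemma sq_A1_word b (j : nat) : (j < 8)%N ->
  sq M b *m A1_word (sq M) j = oapp (A1_word (sq M)) 0 (act b j).
Proof.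
have [h1 h2] := sq_presentation M.
rewrite /A1_word; case: b; move: (sq M false) (sq M true) h1 h2 => p q h1 h2.
all: have M2 (A B : 'M['F_2]_(dim M)) : A * B = A *m B by [].
all: have pp z : p *m (p *m z) = 0 :> 'M_(dim M) by rewrite mulmxA h1 mul0mx.
all: have qq z : q *m (q *m z) = p *m (q *m (p *m z)) :> 'M_(dim M)
  by rewrite mulmxA h2 !mulmxA.
all: have qpqp z : q *m (p *m (q *m (p *m z))) = p *m (q *m (p *m (q *m z))) :> 'M_(dim M)
  by rewrite -!qq.
all: have q4 := qpqp 1%:M; rewrite !mulmx1 in q4.
all: have q2 : q *m q = p *m (q *m p) by rewrite mulmxA.
all: do 8?[case: j => [|j]] => //= _;
  rewrite ?M2 -?mulmxA ?mulmx1 ?pp ?qpqp ?q4 ?qq ?q2 ?pp ?h1 ?mulmx0 ?pp //.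
all: by rewrite ?h1 ?mulmx0.
Qed.

Lemma from_A1_homog n : (forall i, x i 0 != 0 -> deg i = n) ->
  @homog (susp n A1_mod) M 0 from_A1.
Proof.
move=> hx; have hw (j : nat) (i k : 'I_(dim M)) : (j < 8)%N ->
    A1_word (sq M) j i k != 0 -> deg i = deg k + A1_deg j.
  have M2 (A B : 'M['F_2]_(dim M)) : A * B = A *m B by [].
  have s1 : @homog M M 1 (sq M false) by exact: (@homog_sq M false).
  have s2 : @homog M M 2 (sq M true) by exact: (@homog_sq M true).
  have s3 : @homog M M 3 (sq M false *m sq M true) by exact: homog_mul s1 s2.
  have s3' : @homog M M 3 (sq M true *m sq M false) by exact: homog_mul s2 s1.
  have s4 : @homog M M 4 (sq M false *m sq M true *m sq M false) by exact: homog_mul s3 s1.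
  have s5 : @homog M M 5 (sq M true *m sq M false *m sq M true) by exact: homog_mul s3' s2.
  have s6 : @homog M M 6 (sq M false *m sq M true *m sq M false *m sq M true)
    by exact: (homog_mul _ s4 s2).
  move=> j8; rewrite /A1_word; move: i k.
  rewrite -/(@homog M M (A1_deg j) (A1_word (sq M) j)) /A1_word.
  do 8?[case: j j8 => [|j] j8] => //=; rewrite ?M2 /A1_deg /=.
  exact: homog1.
move=> i j; rewrite mxE => /eqP nz.
have [k] : exists k, A1_word (sq M) j i k * x k 0 != 0.
  by apply: contrapT => /forallNP h; apply: nz; rewrite mxE big1 // => k _;
    apply/eqP/negPn/negP/h.
rewrite mulf_eq0 negb_or => /andP [/(hw j _ _ (ltn_ord j)) -> /hx ->].
by rewrite addr0 addrC.
Qed.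

Lemma from_A1_hom n : (forall i, x i 0 != 0 -> deg i = n) ->
  @is_hom (susp n A1_mod) M from_A1.
Proof.
move=> /from_A1_homog hx; apply: is_homI => // b.
apply/matrixP=> i j; rewrite -[LHS]mulr1 -[RHS]mulr1.
have colE' (A : 'M['F_2]_(dim M, 8)) : A i j = (A *m (delta_mx j 0 : 'cV_8)) i 0.
  by rewrite -colE mxE.
rewrite [in LHS]colE' [in RHS]colE' -!mulmxA from_A1_col (mulmxA (sq M b)).
rewrite sq_A1_word ?ltn_ord //; clear colE'.
have -> : sq (susp n A1_mod) b *m delta_mx j 0 =
    oapp (fun k => delta_mx (inord k) 0) 0 (act b j) :> 'cV_8.
  rewrite -colE /=; apply/colP=> k; rewrite !mxE.
  case: b; case: j => j; do 8?[case: j => [|j]] => //= hj; rewrite mxE //= ?andbT;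
  rewrite -?(inj_eq val_inj) /= ?inordK //; case: k => k hk;
    by do 8?[case: k hk => [|k] hk].
have : forall k, act b j = Some k -> (k < 8)%N.
  by case: b; case: j => j; do 8?[case: j => [|j]] => //= hj k [<-].
case: (act b j) => [k|] /= k8; last by rewrite mulmx0 mul0mx.
by rewrite from_A1_col inordK // k8.
Qed.

End FreeSummand.

(** If Sq2 Sq2 Sq2 takes the basis element j to a vector with nonzero coordinate p, let [a] be the
    map A(1) -> M with 1 |-> j and [t] the map of degree -6 taking p to 1. By degrees, [t *m a] sees
    only the top class of A(1), so Lam(t) a = Lam(t a) = 1 by [Lam_A1] and [a] splits. *)
Lemma A1_summand M : ~ reduced M -> exists n K, biprod M (susp n A1_mod) K.
Proof.
set T := sq M true *m sq M true *m sq M true => nT.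
have [p [j nz]] : exists p j, T p j != 0.
  apply: contrapT => /forallNP h; apply: nT; apply/matrixP=> p j; rewrite [RHS]mxE.
  by apply/eqP/negPn/negP => nz; apply: (h p); exists j.
have [h1 h2] := sq_presentation M.
have word7 : A1_word (sq M) 7 = T.
  by rewrite /A1_word /= /T h2.
have dp : deg p = deg j + 6.
  have s2 : @homog M M 2 (sq M true) by exact: (@homog_sq M true).
  have s4 : @homog M M 4 (sq M true *m sq M true) by exact: (homog_mul _ s2 s2).
  have hT : @homog M M 6 T by exact: (homog_mul _ s4 s2).
  exact: hT nz.
pose x : 'cV['F_2]_(dim M) := delta_mx j 0.
have hx i : x i 0 != 0 -> deg i = deg j.
  by rewrite mxE andbT; have [->|] := eqVneq i j; rewrite ?eqxx.
pose a := from_A1 x; have ha : @is_hom (susp (deg j) A1_mod) M a := from_A1_hom hx.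
pose t : 'M_(dim (susp (deg j) A1_mod), dim M) := @delta_mx 'F_2 8 (dim M) 0 p.
have ht : @homog M (susp (deg j) A1_mod) (- 6) t.
  move=> i k; rewrite mxE; have [->|] := eqVneq i (0 : 'I_8); last by rewrite eqxx.
  have [->|] := eqVneq k p; last by rewrite eqxx.
  by rewrite dp addrK /= add0r.
pose b := @Lam M (susp (deg j) A1_mod) t; have hb := Lam_hom ht.
have aE k : a p k = A1_word (sq M) k p j by rewrite mxE -colE mxE.
have ba : b *m a = 1%:M.
  suff ta : t *m a = @delta_mx 'F_2 8 8 0 ord_max.
    by rewrite -(Lam_mulr t ha); change (@Lam A1_mod A1_mod (t *m a) = 1%:M); rewrite ta Lam_A1.
  apply/matrixP=> i k; rewrite mxE (bigD1 p) //= big1 ?addr0 => [|q ne]; last first.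
    by rewrite mxE (negbTE ne) andbF mul0r.
  rewrite aE !mxE eqxx andbT; case: (i == 0); rewrite /= ?mul0r ?mul1r //.
  have [->|ne] := eqVneq k ord_max.
    by rewrite word7; have [e|//] := F2_cases (T p j); rewrite e eqxx in nz.
  have [-> //|nz'] := eqVneq (A1_word (sq M) k p j) 0.
  have : deg p = A1_deg k + deg j + 0 by apply: (from_A1_homog hx); rewrite -/a aE.
  rewrite dp addr0 addrC => /addIr e; case/eqP: ne; apply/val_inj; move: e; clear.
  by case: k => k; do 8?[case: k => [|k]].
have ab2 : a *m b *m (a *m b) = a *m b by rewrite -mulmxA (mulmxA b) ba mul1mx.
have hab : @is_hom M M (1%:M - a *m b).
  by rewrite oppm; apply: is_homD (is_hom1 M) (is_hom_mul ha hb).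
have ee : (1%:M - a *m b) *m (1%:M - a *m b) = 1%:M - a *m b.
  by rewrite mulmxBl mul1mx mulmxBr mulmx1 ab2 subrr subr0.
have [|K [i [r [hi hr ir ri]]]] := submodule_split (is_hom_homog hab) ee.
  by move=> c; rewrite (is_hom_sq c hab) -mulmxA ee.
exists (deg j), K, a, b, i, r; split=> //; last by rewrite ir addrC subrK.
split=> //; apply: is_homI => // c.
have [e1 e2] := (is_hom_sq c hab, is_hom_sq c hi); rewrite -ir in e1.
rewrite -[LHS]mul1mx -ri -mulmxA (mulmxA i) e1.
by rewrite !mulmxA -(mulmxA r) -e2 mulmxA ri mul1mx.
Qed.

Lemma iso_dim M N : iso M N -> dim M = dim N.
Proof.
move=> [f [g [_ _ gf fg]]]; apply/eqP; rewrite eqn_leq.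
by rewrite (mulmx1_min gf) (mulmx1_min fg).
Qed.

(** As [red] is a choice, the decomposition itself has to be produced: copies of A(1) are split off
    while Sq2 Sq2 Sq2 is nonzero, and the dimension decreases. *)
Lemma redP M : reduced (red M) /\ stable_iso (red M) M.
Proof.
have [] : exists N, reduced N /\ exists s, iso M (dsum (free_mod s) N).
  have [k] := ubnP (dim M); elim: k M => // k IH M lt.
  have [rM|/A1_summand [n [K b]]] := pselect (reduced M).
    exists M; split=> //; exists [::]; apply/biprodP.
    exists 0, 0, 1%:M, 1%:M; split; rewrite ?mulmx1 ?mulmx0 ?add0r //.
    - by split; exact: is_hom0.
    - by split; exact: is_hom1.
    - by apply/matrixP=> -[].
  have ltK : (dim K < k)%N.
    rewrite ltnS in lt; apply: leq_trans lt.
    by have /biprodP/iso_dim -> := b; rewrite /= -add1n leq_add2r.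
  have [N [rN [s /biprodP b']]] := IH K ltK.
  exists N; split=> //; exists (n :: s); apply/biprodP; exact: biprod_assoc b b'.
move=> N hN; have := @xgetI _ M
  [set N' | reduced N' /\ exists s, iso M (dsum (free_mod s) N')]%classic N hN.
rewrite -/(red M) => -[rR [s e]].
by split=> //; apply: stable_sym; exact: stable_dsum_free e.
Qed.

(** * Short exact sequences *)

#[export] Instance stable_iso_Equivalence : Equivalence stable_iso.
Proof.
split; [exact: stable_refl|move=> M N; exact: stable_sym|].
by move=> M N P; exact: stable_trans.
Qed.

#[export] Instance tens_Proper : Proper (stable_iso ==> stable_iso ==> stable_iso) tens.
Proof. by move=> M M' h N N'; apply: stable_tens. Qed.

#[export] Instance dual_Proper : Proper (stable_iso ==> stable_iso) dual.
Proof. by move=> M M'; apply: stable_dual. Qed.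

#[export] Instance susp_Proper n : Proper (stable_iso ==> stable_iso) (susp n).
Proof. by move=> M M'; apply: stable_susp. Qed.

#[export] Hint Resolve stable_refl : core.

(** * Tensor calculus up to stable isomorphism and invertible modules *)

Section StableAlgebra.
Implicit Types M N P Q : gmod.

Lemma stable_comm M N : stable_iso (tens M N) (tens N M).
Proof. exact/iso_stable/iso_comm. Qed.

Lemma stable_assoc M N P : stable_iso (tens M (tens N P)) (tens (tens M N) P).
Proof. exact/iso_stable/iso_assoc. Qed.

Lemma stable_unitl M : stable_iso (tens unit_mod M) M.
Proof. exact/iso_stable/iso_unitl. Qed.

Lemma stable_unitr M : stable_iso (tens M unit_mod) M.
Proof. by rewrite stable_comm stable_unitl. Qed.

Lemma stable_suspl n M N : stable_iso (tens (susp n M) N) (susp n (tens M N)).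
Proof. exact/iso_stable/iso_susp_tens. Qed.

Lemma stable_suspr n M N : stable_iso (tens M (susp n N)) (susp n (tens M N)).
Proof. by rewrite stable_comm stable_suspl stable_comm. Qed.

Lemma stable_susp_susp m n M : stable_iso (susp m (susp n M)) (susp (n + m) M).
Proof. exact/iso_stable/iso_susp_susp. Qed.

Lemma stable_susp0 M : stable_iso (susp 0 M) M.
Proof. exact/iso_stable/iso_susp0. Qed.

Lemma stable_dual_susp n M : stable_iso (dual (susp n M)) (susp (- n) (dual M)).
Proof. exact/iso_stable/iso_dual_susp. Qed.

Lemma stable_dual_tens M N : stable_iso (dual (tens M N)) (tens (dual M) (dual N)).
Proof. exact/iso_stable/iso_dual_tens. Qed.

Lemma stable_CA M N P : stable_iso (tens M (tens N P)) (tens N (tens M P)).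
Proof. by rewrite !stable_assoc (stable_comm M). Qed.

Lemma stable_ACA M N P Q :
  stable_iso (tens (tens M N) (tens P Q)) (tens (tens M P) (tens N Q)).
Proof. by rewrite -!stable_assoc (stable_CA N). Qed.

Definition invertible M := stable_iso (tens M (dual M)) unit_mod.

Lemma invertible_tens M N : invertible M -> invertible N -> invertible (tens M N).
Proof.
by rewrite /invertible => hM hN; rewrite stable_dual_tens stable_ACA hM hN stable_unitl.
Qed.

Lemma invertible_susp n M : invertible M -> invertible (susp n M).
Proof.
rewrite /invertible => hM; rewrite stable_dual_susp stable_suspl stable_suspr hM.
by rewrite stable_susp_susp addNr stable_susp0.
Qed.

Lemma invertible_unit : invertible unit_mod.
Proof. by rewrite /invertible stable_unitl; apply: iso_stable; exact: iso_dual_unit. Qed.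

Lemma invertible_cancel M N P : invertible M ->
  stable_iso (tens M N) (tens M P) -> stable_iso N P.
Proof.
rewrite /invertible => hM h; rewrite -(stable_unitl N) -(stable_unitl P) -hM.
by rewrite (stable_comm M) -!stable_assoc h.
Qed.

End StableAlgebra.

(** Exactness is witnessed by a linear splitting [r], [s], in general not equivariant; in this form
    it passes to tensor products and duals by rewriting. *)
Definition sexact (K M N : gmod) (i : 'M['F_2]_(dim M, dim K)) (p : 'M['F_2]_(dim N, dim M)) :=
  [/\ @is_hom K M i, @is_hom M N p & exists r s,
    [/\ r *m i = 1%:M, p *m s = 1%:M & i *m r + s *m p = 1%:M]].

Definition ses (K M N : gmod) := exists i p, @sexact K M N i p.

Lemma sexact0 K M N i p : @sexact K M N i p -> p *m i = 0.
Proof.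
move=> [_ _ [r [s [ri ps e]]]].
have : p *m (i *m r) = 0.
  have -> : i *m r = 1%:M + s *m p by rewrite -e -addrA addmm addr0.
  by rewrite mulmxDr mulmxA ps mul1mx mulmx1 addmm.
by move/(congr1 (mulmx^~ i)); rewrite mul0mx -!mulmxA ri mulmx1.
Qed.

Lemma sexact_homog K M N i p : @sexact K M N i p -> exists r s,
  [/\ @homog M K 0 r, @homog N M 0 s, r *m i = 1%:M, p *m s = 1%:M
    & i *m r + s *m p = 1%:M] /\ r *m s = 0.
Proof.
move=> h; have pi0 := sexact0 h; case: h => hi hp [r [s [ri ps e]]].
have [gi gp] := (is_hom_homog hi, is_hom_homog hp).
have z : 0 = 0 + 0 :> int by rewrite addr0.
exists (@hpart M K 0 r), (@hpart N M 0 s).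
have ri' : @hpart M K 0 r *m i = 1%:M.
  by rewrite -(@hpart_mulr K M K 0 0 0 r i z gi) ri hpart_id //; exact: homog1.
have ps' : p *m @hpart N M 0 s = 1%:M.
  by rewrite -(@hpart_mull N M N 0 0 0 p s z gp) ps hpart_id //; exact: homog1.
have e' : i *m @hpart M K 0 r + @hpart N M 0 s *m p = 1%:M.
  rewrite -(@hpart_mull M K M 0 0 0 i r z gi) -(@hpart_mulr M N M 0 0 0 s p z gp).
  by rewrite -hpartD e hpart_id //; exact: homog1.
split; first by split=> //; exact: homog_hpart.
have := congr1 (mulmx (@hpart M K 0 r)) e'.
rewrite mulmx1 mulmxDr mulmxA ri' mul1mx => /(congr1 (+%R (@hpart M K 0 r))).
rewrite addmK2 addmm mulmxA => /(congr1 (mulmx^~ (@hpart N M 0 s))).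
by rewrite mul0mx -!mulmxA ps' mulmx1.
Qed.

Lemma sexact_lift K M N i p X (h : 'M_(dim M, dim X)) : @sexact K M N i p ->
  @is_hom X M h -> p *m h = 0 -> exists2 h', @is_hom X K h' & i *m h' = h.
Proof.
move=> se hh ph; have [r [s [[hr hs ri ps e] rs]]] := sexact_homog se.
case: se => hi hp _.
have irh : i *m (r *m h) = h.
  have ir : i *m r = 1%:M + s *m p by rewrite -e -addrA addmm addr0.
  by rewrite mulmxA ir mulmxDl mul1mx -mulmxA ph mulmx0 addr0.
exists (r *m h) => //; apply: is_homI => [|b].
  by apply: (homog_mul (esym (addr0 0)) hr (is_hom_homog hh)).
rewrite -[RHS]mul1mx -ri -[RHS]mulmxA [in RHS](mulmxA i) (is_hom_sq b hi).
by rewrite -[in RHS](mulmxA (sq M b)) irh -(is_hom_sq b hh) mulmxA.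
Qed.

(** The identity of M lifts to maps P -> P' -> P, which restrict to the kernels. The resulting
    endomorphism of P differs from 1 by a map into K, so the one of K differs from 1 by a map that
    factors through P. *)
Lemma schanuel K P M K' P' : ses K P M -> ses K' P' M ->
  @null P P 1%:M -> @null P' P' 1%:M -> stable_iso K K'.
Proof.
move=> [i [p h]] [i' [p' h']] nP nP'.
have lift Q Q' q q' : @null Q Q 1%:M -> @is_hom Q M q -> @is_hom Q' M q' ->
    (exists s, q' *m s = 1%:M) -> exists g, @is_hom Q Q' g /\ q' *m g = q.
  move=> nQ hq hq' [s q's]; apply: (null_projective nQ hq') => // v.
  by exists (s *m v); rewrite mulmxA q's mul1mx.
have [hi hp [r [s [ri ps e]]]] := h; have [hi' hp' [r' [s' [ri' ps' e']]]] := h'.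
have [g [hg pg]] := lift _ _ p p' nP hp hp' (ex_intro _ s' ps').
have [g' [hg' pg']] := lift _ _ p' p nP' hp' hp (ex_intro _ s ps).
have [f hf fE] : exists2 f, @is_hom K K' f & i' *m f = g *m i.
  apply: (sexact_lift h'); first exact: is_hom_mul.
  by rewrite mulmxA pg (sexact0 h).
have [f' hf' fE'] : exists2 f', @is_hom K' K f' & i *m f' = g' *m i'.
  apply: (sexact_lift h); first exact: is_hom_mul.
  by rewrite mulmxA pg' (sexact0 h').
have hom1 (X : gmod) u : @is_hom X X u -> @is_hom X X (u - 1%:M).
  by move=> hu; rewrite oppm; apply: is_homD hu (is_hom1 X).
have key (K1 P1 : gmod) (i1 : 'M_(dim P1, dim K1)) (p1 : 'M_(dim M, dim P1))
    (k : 'M_(dim P1)) (m : 'M_(dim K1)) :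
    @sexact K1 P1 M i1 p1 -> @null P1 P1 1%:M -> @is_hom P1 P1 k -> p1 *m k = p1 ->
    i1 *m m = k *m i1 -> null (m - 1%:M).
  move=> h1 n1 hk pk mE; have [t ht tE] : exists2 t, @is_hom P1 K1 t & i1 *m t = k - 1%:M.
    by apply: (sexact_lift h1); [exact: hom1|rewrite mulmxBr pk mulmx1 subrr].
  have -> : m - 1%:M = t *m i1.
    have [hi1 _ [r1 [s1 [ri1 _ _]]]] := h1.
    have : i1 *m (m - 1%:M) = i1 *m (t *m i1).
      by rewrite mulmxBr mE mulmx1 mulmxA tE mulmxBl mul1mx.
    by move/(congr1 (mulmx r1)); rewrite !(mulmxA r1) ri1 !mul1mx.
  have [hi1 _ _] := h1; rewrite -[t]mulmx1.
  by apply: null_mulr hi1 _; apply: null_mull ht n1.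
apply/stable_isoP; exists f, f'; split=> //.
  apply: (key _ _ i p (g' *m g)) => //; first exact: is_hom_mul.
    by rewrite mulmxA pg'.
  by rewrite mulmxA fE' -mulmxA fE mulmxA.
apply: (key _ _ i' p' (g *m g')) => //; first exact: is_hom_mul.
  by rewrite mulmxA pg.
by rewrite mulmxA fE -mulmxA fE' mulmxA.
Qed.

Lemma ses_isol K K' M N : iso K K' -> ses K M N -> ses K' M N.
Proof.
move=> [f [g [hf hg gf fg]]] [i [p [hi hp [r [s [ri ps e]]]]]].
exists (i *m g), p; split=> //; first exact: is_hom_mul.
exists (f *m r), s; split=> //; first by rewrite -mulmxA (mulmxA r) ri mul1mx.
by rewrite mulmxA -[i *m g *m f]mulmxA gf mulmx1.
Qed.

Lemma sexact_isor K M N N' i p (f : 'M_(dim N', dim N)) g : @sexact K M N i p ->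
  @is_hom N N' f -> g *m f = 1%:M -> f *m g = 1%:M -> @sexact K M N' i (f *m p).
Proof.
move=> [hi hp [r [s [ri ps e]]]] hf gf fg; split=> //; first exact: is_hom_mul.
exists r, (s *m g); split=> //; first by rewrite -mulmxA (mulmxA p) ps mul1mx.
by rewrite mulmxA -[s *m g *m f]mulmxA gf mulmx1.
Qed.

Lemma ses_isor K M N N' : iso N N' -> ses K M N -> ses K M N'.
Proof.
by move=> [f [g [hf hg gf fg]]] [i [p h]]; exists i, (f *m p); exact: sexact_isor h hf gf fg.
Qed.

Lemma sexact_tensr K M N X i p : @sexact K M N i p ->
  @sexact (tens K X) (tens M X) (tens N X) (i *t 1%:M) (p *t 1%:M).
Proof.
move=> [hi hp [r [s [ri ps e]]]]; split.
- exact: is_hom_tens hi (is_hom1 X).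
- exact: is_hom_tens hp (is_hom1 X).
exists (r *t 1%:M), (s *t 1%:M); rewrite !tensmx_mul ri ps !mulmx1 !tensmx11.
by rewrite -tensmxDl e tensmx11.
Qed.

Lemma sexact_tensl K M N X i p : @sexact K M N i p ->
  @sexact (tens X K) (tens X M) (tens X N) (1%:M *t i) (1%:M *t p).
Proof.
move=> [hi hp [r [s [ri ps e]]]]; split.
- exact: is_hom_tens (is_hom1 X) hi.
- exact: is_hom_tens (is_hom1 X) hp.
exists (1%:M *t r), (1%:M *t s); rewrite !tensmx_mul ri ps !mulmx1 !tensmx11.
by rewrite -tensmxDr e tensmx11.
Qed.

Lemma sexact_dual K M N i p : @sexact K M N i p ->
  @sexact (dual N) (dual M) (dual K) p^T i^T.
Proof.
move=> [hi hp [r [s [ri ps e]]]]; split; try exact: is_hom_dual.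
exists s^T, r^T; split; first by rewrite -trmx_mul ps trmx1.
  by rewrite -trmx_mul ri trmx1.
by rewrite -[RHS]trmx1 -e linearD /= !trmx_mul addrC.
Qed.

Lemma ses_tensr K M N X : ses K M N -> ses (tens K X) (tens M X) (tens N X).
Proof. by move=> [i [p /(sexact_tensr X) h]]; exists (i *t 1%:M), (p *t 1%:M). Qed.

Lemma ses_tensl K M N X : ses K M N -> ses (tens X K) (tens X M) (tens X N).
Proof. by move=> [i [p /(sexact_tensl X) h]]; exists (1%:M *t i), (1%:M *t p). Qed.

Lemma ses_dual K M N : ses K M N -> ses (dual N) (dual M) (dual K).
Proof. by move=> [i [p /sexact_dual h]]; exists p^T, i^T. Qed.

Lemma sexact_kernel K M N i p : @sexact K M N i p -> is_kernel p K.
Proof.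
move=> h; have pi0 := sexact0 h; case: h => hi hp [r [s [ri ps e]]].
by exists i; split=> //; exact: split_kernel ri e.
Qed.

Lemma kernel_sexact K M N (p : 'M_(dim N, dim M)) s : @is_hom M N p ->
  p *m s = 1%:M -> is_kernel p K -> exists i, @sexact K M N i p.
Proof.
move=> hp ps [i [hi pi0 hu]]; exists i; split=> //.
have /choice [r rE] : forall j : 'I_(dim M),
    exists u : 'cV_(dim K), i *m u = col j (1%:M - s *m p).
  move=> j; have [|u [uE _]] := hu (col j (1%:M - s *m p)); last by exists u.
  by rewrite colE mulmxA mulmxBr mulmxA ps mul1mx mulmx1 subrr mul0mx.
pose R : 'M_(dim K, dim M) := \matrix_(a, b) r b a 0.
have iR : i *m R = 1%:M - s *m p.
  apply/matrixP=> a b; have /matrixP /(_ a 0) := rE b; rewrite [RHS]mxE => <-.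
  by rewrite !mxE; apply: eq_bigr => c _; rewrite mxE.
exists R, s; split=> //; last by rewrite iR subrK.
have Ri (b : 'I_(dim K)) : R *m i *m delta_mx b (0 : 'I_1) = delta_mx b 0.
  have [|u [_ uu]] := hu (i *m delta_mx b 0); first by rewrite mulmxA pi0 mul0mx.
  rewrite -[LHS]uu; first exact: uu.
  by rewrite -!mulmxA mulmxA iR mulmxBl mul1mx -mulmxA (mulmxA p) pi0 mul0mx mulmx0 subr0.
apply/matrixP=> a b; have := Ri b; rewrite -colE => /matrixP /(_ a 0).
by rewrite !mxE andbT.
Qed.

Lemma kernel_exists M N p : @is_hom M N p -> (exists s, p *m s = 1%:M) ->
  exists K i, @sexact K M N i p.
Proof.
move=> hp [s0 ps0]; have hp0 := is_hom_homog hp.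
pose s := @hpart N M 0 s0.
have ps : p *m s = 1%:M.
  rewrite -(@hpart_mull N M N 0 0 0 p s0 _ hp0) ?addr0 //.
  by rewrite ps0 hpart_id //; exact: homog1.
pose e := 1%:M - s *m p.
have pe : p *m e = 0 by rewrite mulmxBr mulmx1 mulmxA ps mul1mx subrr.
have he : @homog M M 0 e.
  rewrite /e oppm; apply: homogD; first exact: homog1.
  by apply: (homog_mul (esym (addr0 0)) _ hp0); exact: homog_hpart.
have ee : e *m e = e by rewrite {1}/e mulmxBl mul1mx -mulmxA pe mulmx0 subr0.
have [|K [i [r [hi hr ir ri]]]] := submodule_split he ee.
  move=> b; rewrite -mulmxA {1}/e mulmxBl mul1mx -mulmxA (mulmxA p).
  by rewrite (is_hom_sq b hp) -mulmxA pe !mulmx0 subr0.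
exists K, i; split=> //; exists r, s; split=> //.
by rewrite ir /e subrK.
Qed.

Lemma sexact_OmegaF : ses OmegaF A1_mod unit_mod.
Proof.
have [f [hf f1] kf] := OmegaF_kernel.
by have [i h] := kernel_sexact hf f1 kf; exists i, f.
Qed.

(** Schanuel's lemma against the cover A(1) (x) M -> M, whose kernel is Omega F (x) M. *)
Lemma ses_stable K P M : ses K P M -> @null P P 1%:M -> stable_iso K (tens OmegaF M).
Proof.
move=> h nP; apply: (schanuel h _ nP (null1_tensr M null1_A1)).
by apply: ses_isor (iso_unitl M) _; apply: ses_tensr; exact: sexact_OmegaF.
Qed.

(** The dual sequence F -> D A(1) -> D Omega F again has a projective middle term, so F ~ Omega F
    (x) D Omega F. *)
Lemma invertible_OmegaF : invertible OmegaF.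
Proof.
apply: stable_sym; apply: (@ses_stable _ (dual A1_mod)); last exact: null1_dual null1_A1.
by apply: ses_isol iso_dual_unit _; apply: ses_dual; exact: sexact_OmegaF.
Qed.

(** * Explicit small modules around the Joker *)

Definition nat_hom_chk (m n : nat) (dm dn : nat -> int) (sm sn : bool -> nat -> nat -> nat)
    (f : nat -> nat -> nat) : bool :=
  [&& all (fun i => all (fun j => odd (f i j) ==> (dn i == dm j)) (iota 0 m)) (iota 0 n),
      nat_chk n m (nmul m f (sm false)) (nmul n (sn false) f)
    & nat_chk n m (nmul m f (sm true)) (nmul n (sn true) f)].

Lemma natmx_hom (M N : gmod) (dm dn : nat -> int) sm sn f :
  (forall i : 'I_(dim M), deg i = dm i) -> (forall i : 'I_(dim N), deg i = dn i) ->
  (forall b, sq M b = natmx (dim M) (dim M) (sm b)) ->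
  (forall b, sq N b = natmx (dim N) (dim N) (sn b)) ->
  nat_hom_chk (dim M) (dim N) dm dn sm sn f ->
  @is_hom M N (natmx (dim N) (dim M) f).
Proof.
move=> hdm hdn hM hN /and3P [/allP h c0 c1]; split=> [i j|b].
  rewrite mxE natr_F2 => nz; have := h i; rewrite mem_iota ltn_ord => /(_ isT) /allP /(_ j).
  rewrite mem_iota ltn_ord => /(_ isT) /implyP.
  by case: (odd _) nz => [_ /(_ isT) /eqP|]; rewrite ?eqxx // hdm hdn.
by rewrite hM hN !natmx_mul; apply: natmx_eq; case: b.
Qed.

(* The kernel of A(1) -> A(1)/A(1)Sq1Sq2, desuspended twice: a small model of
   Omega J. *)
Definition OmegaJ : gmod :=
  @edge_gmod 3 (fun i => nth 0 [:: 1; 3; 4] i)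
    (fun b => if b then [:: (0, 1)]%N else [:: (1, 2)]%N) isT.

(* The dual of A(1)//A(0). *)
Definition coA0 : gmod :=
  @edge_gmod 4 (fun i => nth 0 [:: -5; -3; -2; 0] i)
    (fun b => if b then [:: (0, 1); (2, 3)]%N else [:: (1, 2)]%N) isT.

Ltac nat_hom_tac :=
  [> by [] | by [] | by move=> b; exact: edge_mxE | by move=> b; exact: edge_mxE
   | by vm_compute].

Ltac natmx_check :=
  first [rewrite natmx_mul natmx1; apply: natmx_eq; vm_compute; reflexivity
       | rewrite !natmx_mul natmx_add natmx1; apply: natmx_eq; vm_compute; reflexivity].

Lemma ses_OmegaJ : ses OmegaJ (susp (- 2) A1_mod) joker.
Proof.
exists (natmx 8 3 (nedge [:: (0, 3); (1, 6); (2, 7)]%N)).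
exists (natmx 5 8 (nedge [:: (0, 0); (1, 1); (2, 2); (4, 3); (5, 4)]%N)); split.
- apply: (@natmx_hom OmegaJ (susp (- 2) A1_mod) (fun i => nth 0 [:: 1; 3; 4] i)
    (fun i => A1_deg i - 2) (fun b => nedge (if b then [:: (0, 1)]%N else [:: (1, 2)]%N))
    (fun b => nedge (A1_edges b))); nat_hom_tac.
- apply: (@natmx_hom (susp (- 2) A1_mod) joker (fun i => A1_deg i - 2)
    (fun i => nth 0 [:: 0; 1; 2; 3; 4] i - 2) (fun b => nedge (A1_edges b))
    (fun b => nedge (if b then [:: (0, 2); (1, 3); (2, 4)]%N else [:: (0, 1); (3, 4)]%N)));
    nat_hom_tac.
exists (natmx 3 8 (nedge [:: (3, 0); (6, 1); (7, 2)]%N)).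
exists (natmx 8 5 (nedge [:: (0, 0); (1, 1); (2, 2); (3, 4); (4, 5)]%N)).
split; natmx_check.
Qed.

(** F is the socle of [coA0]; the remaining classes, in degrees -5, -3, -2, form a copy of [OmegaJ]
    lowered by 6. This 6, spread over two applications of Omega, accounts for the 3 in Sigma^(-3)
    Omega. *)
Lemma ses_coA0 : ses unit_mod coA0 (susp (- 6) OmegaJ).
Proof.
exists (natmx 4 1 (nedge [:: (0, 3)]%N)).
exists (natmx 3 4 (nedge [:: (0, 0); (1, 1); (2, 2)]%N)); split.
- apply: (@natmx_hom unit_mod coA0 (fun _ => 0) (fun i => nth 0 [:: -5; -3; -2; 0] i)
    (fun _ => nedge [::])
    (fun b => nedge (if b then [:: (0, 1); (2, 3)]%N else [:: (1, 2)]%N))); nat_hom_tac.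
- apply: (@natmx_hom coA0 (susp (- 6) OmegaJ) (fun i => nth 0 [:: -5; -3; -2; 0] i)
    (fun i => nth 0 [:: 1; 3; 4] i - 6)
    (fun b => nedge (if b then [:: (0, 1); (2, 3)]%N else [:: (1, 2)]%N))
    (fun b => nedge (if b then [:: (0, 1)]%N else [:: (1, 2)]%N))); nat_hom_tac.
exists (natmx 1 4 (nedge [:: (3, 0)]%N)).
exists (natmx 4 3 (nedge [:: (0, 0); (1, 1); (2, 2)]%N)).
split; natmx_check.
Qed.

Lemma iso_dual_joker : iso (dual joker) joker.
Proof.
apply: (@iso_bij (dual joker) joker (@rev_ord 5)).
- by exists (@rev_ord 5); exact: rev_ordK.
- by case=> i; do 5?[case: i => [|i]].
- move=> b [i hi] [j hj]; rewrite /= !mxE /=.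
  by case: b; do 5?[case: i hi => [|i] hi] => //; do 5?[case: j hj => [|j] hj].
Qed.

(** * Evaluation, coevaluation and the dual of a kernel *)

Lemma sum_tens m n (F : 'I_(m * n) -> 'F_2) :
  \sum_k F k = \sum_(i < m) \sum_(j < n) F (mxtens_index (i, j)).
Proof.
rewrite pair_big /= (reindex (fun p : 'I_m * 'I_n => mxtens_index p)) /=.
  by apply: eq_bigr => -[i j].
by exists (@mxtens_unindex m n) => k _; rewrite (mxtens_indexK, mxtens_unindexK).
Qed.

Definition ev_mx (X : gmod) : 'M['F_2]_(dim unit_mod, dim (tens X (dual X))) :=
  \matrix_(i, k) ((mxtens_unindex k).1 == (mxtens_unindex k).2)%:R.

Lemma ev_mxE X i (x y : 'I_(dim X)) : ev_mx X i (mxtens_index (x, y)) = (x == y)%:R.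
Proof. by rewrite mxE mxtens_indexK. Qed.

Lemma sum_diag n (F : 'I_n -> 'F_2) i : \sum_j F j * (j == i)%:R = F i.
Proof.
rewrite (bigD1 i) //= big1 ?addr0 => [|j ne]; first by rewrite eqxx mulr1.
by rewrite (negbTE ne) mulr0.
Qed.

(** The two outer Cartan terms contribute the same matrix entry of Sq^(b+1) and cancel mod 2; the
    cross term is an entry of Sq1 Sq1 = 0. *)
Lemma ev_sq X b : ev_mx X *m sq (tens X (dual X)) b = 0.
Proof.
apply/matrixP=> z l; case: (mxtens_indexP l) => x y; rewrite mxE (@sum_tens _ (dim X)) [RHS]mxE.
have sqf : \sum_i sq X false i x * sq X false y i = 0.
  have /matrixP /(_ y x) := (sq_presentation X).1; rewrite !mxE => e.
  by rewrite -[RHS]e; apply: eq_bigr => i _; rewrite mulrC.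
under eq_bigr => i _.
  under eq_bigr => j _ do rewrite ev_mxE (@sq_tensE X (dual X)) eq_sym mulrC.
  rewrite sum_diag /= !mxE; over.
rewrite !big_split /= -[X in _ + X]mulr_sumr sqf mulr0 addr0 sum_diag.
rewrite (eq_bigr (fun i => sq X b y i * (i == x)%:R)); last by move=> i _; rewrite mulrC.
by rewrite sum_diag -mulr2n (mulrn_pchar (pchar_Fp _)).
Qed.

Lemma coev_sq X b : sq (tens X (dual X)) b *m (ev_mx X)^T = 0.
Proof.
apply/matrixP=> l z; case: (mxtens_indexP l) => x y; rewrite mxE (@sum_tens _ (dim X)) [RHS]mxE.
have sqf : \sum_i sq X false x i * sq X false i y = 0.
  by have /matrixP /(_ x y) := (sq_presentation X).1; rewrite !mxE.
under eq_bigr => i _.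
  under eq_bigr => j _ do 
    rewrite [(ev_mx X)^T _ _]mxE ev_mxE (@sq_tensE X (dual X)) [i == j]eq_sym.
  rewrite sum_diag /= !mxE; over.
rewrite !big_split /= -[X in _ + X]mulr_sumr sqf mulr0 addr0.
rewrite (eq_bigr (fun i => sq X b x i * (i == y)%:R)); last by move=> i _; rewrite eq_sym.
rewrite sum_diag (eq_bigr (fun i => sq X b i y * (i == x)%:R)); last first.
  by move=> i _; rewrite mulrC eq_sym.
by rewrite sum_diag -mulr2n (mulrn_pchar (pchar_Fp _)).
Qed.

Lemma unit_sq b : sq unit_mod b = 0.
Proof. by apply/matrixP=> i j; rewrite !mxE. Qed.

Lemma ev_hom X : @is_hom (tens X (dual X)) unit_mod (ev_mx X).
Proof.
split=> [i k|b]; last by rewrite ev_sq unit_sq mul0mx.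
case: (mxtens_indexP k) => x y; rewrite ev_mxE (@deg_tens X (dual X)) /=.
by have [->|] := eqVneq x y; rewrite ?eqxx // subrr.
Qed.

Lemma coev_hom X : @is_hom unit_mod (tens X (dual X)) (ev_mx X)^T.
Proof.
split=> [k i|b]; last by rewrite coev_sq unit_sq mulmx0.
case: (mxtens_indexP k) => x y; rewrite [_^T _ _]mxE ev_mxE (@deg_tens X (dual X)) /=.
by have [->|] := eqVneq x y; rewrite ?eqxx // subrr.
Qed.

Lemma ev_coev X : ev_mx X *m (ev_mx X)^T = (dim X)%:R%:M.
Proof.
apply/matrixP=> i j; rewrite mxE (@sum_tens _ (dim X)) (ord1 i) (ord1 j).
rewrite [RHS]mxE eqxx mulr1n.
under eq_bigr => x _ do under eq_bigr => y _ do rewrite [(_)^T _ _]mxE !ev_mxE [x == y]eq_sym.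
under eq_bigr => x _ do rewrite sum_diag eqxx.
by rewrite sumr_const card_ord.
Qed.

Lemma unit_not_null : ~ @null unit_mod unit_mod 1%:M.
Proof.
move=> [t]; rewrite /Lam /ad !unit_sq !(mul0mx, mulmx0) !addr0 => /matrixP /(_ ord0 ord0).
by rewrite !mxE.
Qed.

Lemma odd_F2 n : odd n -> n%:R = 1 :> 'F_2.
Proof. by move=> o; rewrite natr_F2 o. Qed.

(* Every stable endomorphism of F is 0 or 1, and since dim X is odd the map
   ev splits off F, so it is the given stable equivalence. *)
Lemma ev_stable X : invertible X -> odd (dim X) ->
  null ((ev_mx X)^T *m ev_mx X - 1%:M).
Proof.
move=> /stable_isoP [a [b [ha hb ba ab]]] oX.
have eu : ev_mx X *m (ev_mx X)^T = 1%:M by rewrite ev_coev odd_F2.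
have hv := ev_hom X; have hu := coev_hom X.
move: (ev_mx X) ((ev_mx X)^T) eu hu hv => v u vu hu hv.
have [au|au] : a *m u = 0 \/ a *m u = 1%:M.
- have [e|e] := F2_cases ((a *m u) ord0 ord0); [left|right];
  by apply/matrixP=> i j; rewrite (ord1 i) (ord1 j) e !mxE.
- case: unit_not_null; rewrite -vu.
  have -> : v *m u = v *m ((b *m a - 1%:M) *m u).
    by rewrite mulmxBl mul1mx -mulmxA au mulmx0 sub0r oppm.
  by apply: null_mull hv _; apply: null_mulr hu _.
have nb : null (u - b).
  have -> : u - b = - ((b *m a - 1%:M) *m u).
    by rewrite mulmxBl mul1mx -mulmxA au mulmx1 opprB.
  by rewrite oppm; apply: null_mulr hu _.
have nv : null (v - a).
  have -> : v - a = v *m (b *m a - 1%:M) + v *m ((u - b) *m a).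
    rewrite !oppm !mulmxDl !mulmxDr mulmx1 (mulmxA v u a) vu mul1mx.
    by rewrite [v *m _ + v]addrC [a + _]addrC addrA -[v + _ + _]addrA addmm addr0.
  by apply: nullD; apply: null_mull hv _ => //; apply: null_mulr.
have -> : u *m v - 1%:M = (b *m a - 1%:M) + (u - b) *m a + u *m (v - a).
  rewrite !oppm mulmxDl mulmxDr !addrA [RHS](ACl ((1*4)*(3*6)*(5*2))) /=.
  by rewrite !addmm !add0r.
apply: nullD; last exact: null_mull hu nv.
by apply: nullD => //; apply: null_mulr ha nb.
Qed.

(** The evaluation is split and a stable equivalence, so its kernel Z is projective. In the sequence
    X = X (x) DF -> X (x) DX -> X (x) DA, evaluation restricts to [f] on X; hence Z meets X in A and
    still surjects onto X (x) DA. Thus A -> Z -> X (x) DA is exact, and [ses_stable] applies. *)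
Lemma kernel_dual A X i f : @sexact A X unit_mod i f -> invertible X -> odd (dim X) ->
  stable_iso A (tens OmegaF (tens X (dual A))).
Proof.
move=> hif iX oX; have nev := ev_stable iX oX.
have eu : ev_mx X *m (ev_mx X)^T = 1%:M by rewrite ev_coev odd_F2.
have [Z [z hz]] := kernel_exists (ev_hom X) (ex_intro _ _ eu).
have [hz1 hev [rz [sz [rzz evs ez]]]] := hz; have evz := sexact0 hz.
have nZ : @null Z Z 1%:M.
  have [h hh zh] : exists2 h, @is_hom (tens X (dual X)) Z h &
      z *m h = 1%:M - (ev_mx X)^T *m ev_mx X.
    apply: (sexact_lift hz); last by rewrite mulmxBr mulmx1 mulmxA eu mul1mx subrr.
    by rewrite oppm; apply: is_homD (is_hom1 _) (is_hom_mul (coev_hom X) hev).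
  have hz' : h *m z = 1%:M.
    have : z *m (h *m z) = z by rewrite mulmxA zh mulmxBl mul1mx -mulmxA evz mulmx0 subr0.
    by move/(congr1 (mulmx rz)); rewrite mulmxA rzz mul1mx.
  rewrite -hz' -[h]mul1mx -{1}hz' -!mulmxA (mulmxA z h) zh -opprB oppm.
  by apply: null_mull hh _; apply: null_mulr hz1 _.
apply: (ses_stable _ nZ).
pose s (x : 'I_(dim X)) : 'I_(dim (tens X (dual unit_mod))) := mxtens_index (x, ord0).
have [g [hs hg gs sg]] : exists g, [/\ @is_hom X (tens X (dual unit_mod)) (fun_mx s),
    @is_hom (tens X (dual unit_mod)) X g, g *m fun_mx s = 1%:M & fun_mx s *m g = 1%:M].
  apply: fun_mx_iso.
  - exists (fun k => (mxtens_unindex k).1) => [x|k]; first by rewrite mxtens_indexK.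
    by case: (mxtens_indexP k) => x y; rewrite mxtens_indexK /s (ord1 y).
  - by move=> x; rewrite (@deg_tens X (dual unit_mod)) /= subr0.
  - move=> b x y; rewrite (@sq_tensE X (dual unit_mod)) eqxx mulr1 /= !mxE.
    by rewrite !mulr0 !addr0.
have hB := sexact_tensl X (sexact_dual hif).
pose a : 'M_(dim (tens X (dual X)), dim X) := (1%:M *t f^T) *m fun_mx s.
pose b : 'M_(dim (tens X (dual A)), dim (tens X (dual X))) := 1%:M *t i^T.
have {}hB : @sexact X (tens X (dual X)) (tens X (dual A)) a b.
  case: hB => [hB1 hB2 [r [s' [h1 h2 h3]]]]; split=> //; first exact: (is_hom_mul hB1 hs).
  exists (g *m r), s'; split=> //; first by rewrite /a -mulmxA (mulmxA r) h1 mul1mx.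
  by rewrite /a -mulmxA (mulmxA (fun_mx s)) sg mul1mx.
(* Evaluating on x (x) f returns f(x). *)
have ea : ev_mx X *m a = f.
  apply/matrixP=> o x; rewrite mxE (@sum_tens _ (dim X)) (ord1 o).
  have aE y y' : a (mxtens_index (y, y')) x = (y == x)%:R * f ord0 y'.
    rewrite mxE; under eq_bigr => l _ do rewrite [fun_mx s _ _]mxE.
    by rewrite sum_diag /s tensmxE !mxE.
  under eq_bigr => y _.
    under eq_bigr => y' _ do rewrite ev_mxE aE mulrC [y == y']eq_sym.
    rewrite sum_diag mulrC; over.
  by rewrite sum_diag.
clearbody a b.
have [ha hb [ra [sb [raa bs eab]]]] := hB; have ba := sexact0 hB.
have [hi hf [ri [sf [rii fs eif]]]] := hif; have fi := sexact0 hif.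
have zr : z *m rz = 1%:M + sz *m ev_mx X by rewrite -ez -addrA addmm addr0.
have [q hq zq] : exists2 q, @is_hom A Z q & z *m q = a *m i.
  by apply: (sexact_lift hz); [exact: is_hom_mul|rewrite mulmxA ea].
exists q, (b *m z); split=> //; first exact: is_hom_mul.
(* [c] moves a vector of X (x) DX into the kernel of evaluation by adding an element of the image of
   [a], so its class in X (x) DA is unchanged. *)
pose c := 1%:M - a *m sf *m ev_mx X.
have ec : ev_mx X *m c = 0.
  by rewrite /c mulmxBr mulmx1 !mulmxA ea fs mul1mx subrr.
have zrc : z *m (rz *m c) = c by rewrite mulmxA zr mulmxDl mul1mx -mulmxA ec mulmx0 addr0.
have bc : b *m c = b by rewrite /c mulmxBr mulmx1 !mulmxA ba !mul0mx subr0.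
exists (ri *m ra *m z), (rz *m c *m sb); split.
- by rewrite -mulmxA zq -[ri *m ra]mulmx1 -!mulmxA mul1mx (mulmxA ra) raa mul1mx rii.
- by rewrite mulmxA -[b *m z *m _]mulmxA zrc bc bs.
have : z *m (q *m (ri *m ra *m z) + rz *m c *m sb *m (b *m z)) = z.
  rewrite mulmxDr !mulmxA zq -[z *m rz *m c]mulmxA zrc.
  have e1 : a *m i *m ri = a + a *m sf *m f.
    by rewrite -mulmxA -[i *m ri]addr0 -(addmm (sf *m f)) addrA eif mulmxDr mulmx1 mulmxA.
  have e2 : c *m sb *m b = c + (a + a *m sf *m f) *m ra.
    rewrite -mulmxA -[sb *m b]addr0 -(addmm (a *m ra)) addrA [sb *m b + _]addrC eab.
    rewrite mulmxDr mulmx1 mulmxA; congr (_ + _ *m _).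
    by rewrite /c mulmxBl mul1mx -mulmxA ea oppm.
  rewrite e1 e2; move: (a + _) => u; rewrite mulmxDl addrC -addrA addmm addr0 /c mulmxBl mul1mx.
  by rewrite -[_ *m ev_mx X *m z]mulmxA evz mulmx0 subr0.
by move/(congr1 (mulmx rz)); rewrite (mulmxA rz z) rzz mul1mx.
Qed.

(** * Modules with vanishing Sq1-homology *)

(** In the numbering of [mxtens_index], basis element k of a tensor product is the pair (k %/ n, k
    %% n). *)
Definition ntens_sq (n : nat) (sm sn : bool -> nat -> nat -> nat) (b : bool)
    (k l : nat) : nat :=
  (sm b (k %/ n) (l %/ n) * (k %% n == l %% n) + (k %/ n == l %/ n) * sn b (k %% n) (l %% n)
   + b * (sm false (k %/ n) (l %/ n) * sn false (k %% n) (l %% n)))%N.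

Lemma sq_tens_natmx (M N : gmod) sm sn :
  (forall b, sq M b = natmx (dim M) (dim M) (sm b)) ->
  (forall b, sq N b = natmx (dim N) (dim N) (sn b)) ->
  forall b, sq (tens M N) b =
    natmx (dim M * dim N) (dim M * dim N) (ntens_sq (dim N) sm sn b).
Proof.
move=> hM hN b; apply/matrixP=> k l.
case: (mxtens_indexP k) => i j; case: (mxtens_indexP l) => i' j'.
have n0 : (0 < dim N)%N by apply: leq_ltn_trans (ltn_ord j).
rewrite sq_tensE !hM !hN !mxE /ntens_sq /= !divnMDl // !divn_small // !addn0.
by rewrite !modnMDl !modn_small // !natrD !natrM.
Qed.

Lemma invertible_OmegaJ : invertible OmegaJ.
Proof.
apply/stable_isoP; exists (ev_mx OmegaJ), (ev_mx OmegaJ)^T; split.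
- exact: ev_hom.
- exact: coev_hom.
(* This product has dimension 9 = 1 + 8: besides F there is one free summand. The witness sends its
   top class, of degree 3 and index 6, to its bottom class, of degree -3 and index 2. *)
- exists (natmx 9 9 (fun i j => (i == 2%N) && (j == 6%N))).
  pose sn b := nedge (if b then [:: (0, 1)]%N else [:: (1, 2)]%N).
  rewrite (@Lam_natmx (tens OmegaJ (dual OmegaJ)) (tens OmegaJ (dual OmegaJ))
    (ntens_sq 3 sn (fun b i j => sn b j i)) (ntens_sq 3 sn (fun b i j => sn b j i))).
  + have -> : ev_mx OmegaJ = natmx 1 9 (fun _ k => (k %/ 3 == k %% 3)%N).
      by apply/matrixP=> i k; rewrite !mxE.
    have -> : (natmx 1 9 (fun _ k => (k %/ 3 == k %% 3)%N))^T =
        natmx 9 1 (fun k _ => (k %/ 3 == k %% 3)%N).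
      by apply/matrixP=> i k; rewrite !mxE.
    rewrite oppm natmx_mul natmx1 natmx_add; apply: natmx_eq; vm_compute; reflexivity.
  + by apply: sq_tens_natmx => b; [exact: edge_mxE|]; apply/matrixP=> i j; rewrite !mxE.
  + by apply: sq_tens_natmx => b; [exact: edge_mxE|]; apply/matrixP=> i j; rewrite !mxE.
- rewrite ev_coev (_ : (dim OmegaJ)%:R = 1) ?subrr; first exact: null0.
  exact: odd_F2.
Qed.

Lemma OmegaJ_stable : stable_iso OmegaJ (tens OmegaF joker).
Proof. exact: ses_stable ses_OmegaJ (null1_susp _ null1_A1). Qed.

Lemma OmegaF_dual : stable_iso (tens OmegaF (dual OmegaF)) unit_mod.
Proof. exact: invertible_OmegaF. Qed.

Lemma dual_joker : stable_iso (dual joker) joker.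
Proof. exact/iso_stable/iso_dual_joker. Qed.

(** Read off from the invertibility of the 3-dimensional [OmegaJ] by cancelling Omega F, which
    avoids the 25-dimensional J (x) J. *)
Lemma joker_square : stable_iso (tens joker joker) unit_mod.
Proof.
have := invertible_OmegaJ; rewrite /invertible OmegaJ_stable stable_dual_tens stable_ACA.
by rewrite OmegaF_dual stable_unitl dual_joker.
Qed.

(** A contracting homotopy for the differential Sq1; over a field this is the vanishing of its
    homology. *)
Definition acyclic (M : gmod) : Prop := exists s, @ad M M false s = 1%:M.

(** The integral is also Sq1 Sq2 Sq1 Sq2; as it starts with Sq1, a null map is Sq1-homotopic to
    0. *)
Lemma acyclic_stable M N : stable_iso M N -> acyclic M -> acyclic N.
Proof.
move=> /stable_isoP [f [g [hf hg _ [t tE]]]] [s sE].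
exists (f *m s *m g + ad true (ad false (ad true t))).
rewrite adD (ad_mulr _ _ hg) (ad_mull _ _ hf) sE mulmx1.
have -> : ad false (ad true (ad false (ad true t))) = Lam t by rewrite /Lam ad_sq2.
by rewrite -tE oppm addmK2.
Qed.

Lemma acyclic_dual M : acyclic M -> acyclic (dual M).
Proof. by move=> [s sE]; exists s^T; rewrite ad_dual sE trmx1. Qed.

Lemma acyclic_susp n M : acyclic M -> acyclic (susp n M).
Proof. by move=> [s sE]; exists s. Qed.

Lemma acyclic_tensl M N : acyclic N -> acyclic (tens M N).
Proof.
move=> [s sE]; exists (1%:M *t s).
by rewrite (ad_tens_homl _ _ (is_hom1 M)) sE tensmx11.
Qed.

(** With the integral written Sq2 Sq1 Sq2 Sq1 and the witness s (x) p, where [p] sends the degree 0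
    class of [coA0] to its degree -5 class, the first Sq1 turns [s] into 1 and kills [p]; the
    remaining Sq2 Sq1 Sq2 turns [p] into 1. *)
Lemma acyclic_tens_coA0 M : acyclic M -> @null (tens M coA0) (tens M coA0) 1%:M.
Proof.
move=> [s sE]; pose p : 'M_(dim coA0) := natmx 4 4 (fun i j => (i == 0%N) && (j == 3%N)).
pose sn b := nedge (if b then [:: (0, 1); (2, 3)]%N else [:: (1, 2)]%N).
have ad_nat b f : @ad coA0 coA0 b (natmx 4 4 f) = natmx 4 4 (nad 4 4 sn sn b f).
  by apply: ad_natmx => b'; exact: edge_mxE.
exists (s *t p); rewrite Lam_xyxy ad1_tens sE.
have -> : @ad coA0 coA0 false p = 0.
  by rewrite ad_nat (natmx0 4 4); apply: natmx_eq; vm_compute.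
rewrite tensmx0 addr0 !(ad_tens_homl _ _ (is_hom1 M)).
suff -> : @ad coA0 coA0 true (ad false (ad true p)) = 1%:M by rewrite tensmx11.
by rewrite !ad_nat (natmx1 4); apply: natmx_eq; vm_compute.
Qed.

(* Sigma^(-3) Omega without the passage to reduced modules. *)
Definition shift (M : gmod) : gmod := susp (- 3) (tens OmegaF M).

#[export] Instance shift_Proper : Proper (stable_iso ==> stable_iso) shift.
Proof. by move=> M N h; rewrite /shift h. Qed.

Lemma shift_tens M N : stable_iso (shift (tens M N)) (tens M (shift N)).
Proof. by rewrite /shift stable_CA stable_suspr. Qed.

Lemma shift_joker M : acyclic M -> stable_iso M (shift (shift (tens M joker))).
Proof.
move=> aM; have := ses_stable (ses_tensl M ses_coA0) (acyclic_tens_coA0 aM).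
rewrite stable_unitr OmegaJ_stable /shift => {1}->; move: joker => J.
rewrite !stable_suspr !stable_susp_susp (_ : - 3 - 3 = - 6 :> int) //.
by rewrite (stable_CA M).
Qed.

Lemma tens_joker M : acyclic M -> stable_iso (tens M joker) (shift (shift M)).
Proof.
move=> /shift_joker => {1}->; rewrite !(stable_comm _ joker) -!shift_tens.
by rewrite stable_assoc joker_square stable_unitl.
Qed.

Lemma shift4 M : acyclic M -> stable_iso (shift (shift (shift (shift M)))) M.
Proof. by move=> aM; rewrite -(tens_joker aM) -shift_joker. Qed.

Lemma shift_inj M N : stable_iso (shift M) (shift N) -> stable_iso M N.
Proof.
rewrite /shift => /(stable_susp 3); rewrite !stable_susp_susp addNr !stable_susp0.
exact/invertible_cancel/invertible_OmegaF.
Qed.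

(** * Spherical modules *)

Import Order.TTheory Num.Theory.

Lemma Lam_functional M N t : (forall b, sq N b = 0) ->
  @Lam M N t = t *m (sq M true *m sq M true *m sq M true).
Proof. by move=> N0; rewrite /Lam /ad !N0 !(mul0mx, add0r) !mulmxA. Qed.

(* w - 1 maps L into A, so on A its square factors as a map L -> A after the
   stably trivial w - 1. *)
Lemma kernel_unipotent A L i f (w : 'M_(dim L)) (m : 'M_(dim A)) :
  @sexact A L unit_mod i f -> @is_hom L L w -> null (w - 1%:M) -> f *m w = f ->
  i *m m = w *m i -> null (m *m m - 1%:M).
Proof.
move=> h hw nw fw im; have [n hn nE] : exists2 n, @is_hom L A n & i *m n = w - 1%:M.
  apply: (sexact_lift h); last by rewrite mulmxBr fw mulmx1 subrr.
  by rewrite oppm; apply: is_homD hw (is_hom1 L).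
have [hi _ [r [s [ri _ _]]]] := h.
have mE : m = 1%:M + n *m i.
  have : i *m m = i *m (1%:M + n *m i).
    by rewrite im mulmxDr mulmx1 mulmxA nE mulmxBl mul1mx addrC subrK.
  by move/(congr1 (mulmx r)); rewrite !(mulmxA r) ri !mul1mx.
have -> : m *m m - 1%:M = n *m (w - 1%:M) *m i.
  rewrite oppm mE mulmxDl mul1mx mulmxDr mulmx1 -nE !mulmxA -!addrA addmK2.
  by rewrite addrCA addmm addr0.
by apply: null_mulr hi _; apply: null_mull hn _.
Qed.

(** The induced maps [a], [b] between the kernels only satisfy (b a)^2 ~ 1 and (a b)^2 ~ 1 by
    [kernel_unipotent], so the stable inverse of [a] is [b *m a *m b]. *)
Lemma kernel_compare A L i f A' X i' f' (u : 'M_(dim X, dim L)) (v : 'M_(dim L, dim X)) :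
  @sexact A L unit_mod i f -> @sexact A' X unit_mod i' f' ->
  @is_hom L X u -> @is_hom X L v -> null (v *m u - 1%:M) -> null (u *m v - 1%:M) ->
  f' *m u = f -> f *m v = f' -> stable_iso A A'.
Proof.
move=> h h' hu hv nvu nuv fu fv.
have [[hi _ _] [hi' _ _]] := (h, h').
have [a ha aE] : exists2 a, @is_hom A A' a & i' *m a = u *m i.
  by apply: (sexact_lift h'); [exact: is_hom_mul|rewrite mulmxA fu (sexact0 h)].
have [b hb bE] : exists2 b, @is_hom A' A b & i *m b = v *m i'.
  by apply: (sexact_lift h); [exact: is_hom_mul|rewrite mulmxA fv (sexact0 h')].
apply/stable_isoP; exists a, (b *m a *m b); split=> //.
- by apply: is_hom_mul => //; apply: is_hom_mul.
- rewrite -mulmxA; apply: (kernel_unipotent h (is_hom_mul hv hu)) => //.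
    by rewrite mulmxA fv.
  by rewrite mulmxA bE -mulmxA aE mulmxA.
- rewrite -mulmxA mulmxA; apply: (kernel_unipotent h' (is_hom_mul hu hv)) => //.
    by rewrite mulmxA fu.
  by rewrite mulmxA aE -mulmxA bE mulmxA.
Qed.

Local Open Scope ring_scope.

(* The bottom degree of X is d; it is one dimensional and, over A(0), X is the
   sum of its bottom class and a free module. *)
Definition spherical (X : gmod) (d : int) (j0 : 'I_(dim X)) : Prop :=
  [/\ deg j0 = d, forall j, j != j0 -> d < deg j,
      sq X false *m delta_mx j0 (0 : 'I_1) = 0
    & exists h, @ad X X false h = 1%:M + delta_mx j0 j0].

Lemma spherical_ge X d j0 (j : 'I_(dim X)) : @spherical X d j0 -> d <= deg j.
Proof. by move=> [e h _ _]; have [->|/h/ltW] := eqVneq j j0; rewrite ?e. Qed.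

Lemma spherical_row X d j0 b : @spherical X d j0 -> delta_mx (0 : 'I_1) j0 *m sq X b = 0.
Proof.
move=> h; apply/matrixP=> i k; rewrite -rowE !mxE; apply/eqP/negPn/negP => /sq_deg.
have [-> _ _ _] := h => e; have := spherical_ge k h; rewrite e.
by rewrite gerDl.
Qed.

Lemma delta_colrow n (j : 'I_n) :
  delta_mx j (0 : 'I_1) *m delta_mx (0 : 'I_1) j = delta_mx j j :> 'M['F_2]_n.
Proof. by rewrite mul_delta_mx. Qed.

Lemma spherical_ad X d j0 : @spherical X d j0 -> @ad X X false (delta_mx j0 j0) = 0.
Proof.
move=> h; rewrite /ad -delta_colrow -mulmxA (spherical_row false h) mulmx0 addr0.
by case: h => _ _ h _; rewrite mulmxA h mul0mx.
Qed.

Lemma spherical_susp X d j0 n : @spherical X d j0 -> @spherical (susp n X) (d + n) j0.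
Proof.
move=> [e lt s0 [h hE]]; split=> //=; first by rewrite e.
  by move=> j /lt; rewrite ltrD2r.
by exists h.
Qed.

Lemma spherical_tens X Y d e x y : @spherical X d x -> @spherical Y e y ->
  @spherical (tens X Y) (d + e) (mxtens_index (x, y)).
Proof.
move=> hX hY; have [eX lX sX [h hE]] := hX; have [eY lY sY [k kE]] := hY.
split.
- by rewrite deg_tens eX eY.
- move=> j; case: (mxtens_indexP j) => a b.
  rewrite (can_eq (@mxtens_indexK _ _)) xpair_eqE deg_tens.
  have [->|/lX la] := eqVneq a x; last by move=> _; apply: ltr_leD la (spherical_ge b hY).
  by move=> /lY lb; rewrite eX ltrD2l.
- have e0 : sq (tens X Y) false *m (delta_mx x (0 : 'I_1) *t delta_mx y (0 : 'I_1)) = 0.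
    by rewrite mulmxDl !tensmx_mul sX sY !mul1mx tens0mx tensmx0 addr0.
  have -> : delta_mx (mxtens_index (x, y)) 0 =
      delta_mx x (0 : 'I_1) *t delta_mx y (0 : 'I_1) :> 'cV['F_2]__.
    apply/matrixP=> j z; case: (mxtens_indexP j) => a b.
    by rewrite !mxE !mxtens_indexK (can_eq (@mxtens_indexK _ _)) xpair_eqE !ord1 !eqxx !andbT
      -natrM mulnb.
  exact: e0.
(* The Kunneth homotopy: 1 (x) 1 is deformed to x (x) 1 by [h], then to x (x) y by [k], with x and y
   standing for the projections onto the bottom classes. *)
exists (h *t 1%:M + delta_mx x x *t k).
rewrite adD (ad_tens_homr _ _ (is_hom1 Y)) ad1_tens (spherical_ad hX) tens0mx add0r hE kE.
rewrite tensmxDl tensmxDr tensmx11 -addrA addmK2; congr (_ + _).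
apply/matrixP=> j j'; case: (mxtens_indexP j) => a b; case: (mxtens_indexP j') => a' b'.
rewrite !mxE !mxtens_indexK !(can_eq (@mxtens_indexK _ _)) !xpair_eqE -natrM mulnb.
by congr (nat_of_bool _)%:R; case: (a == x); case: (b == y); case: (a' == x).
Qed.

(** Traces: Sq1 h + h Sq1 has trace 0 mod 2, whereas 1 plus the projection onto the bottom class has
    trace dim X + 1. *)
Lemma spherical_odd X d j0 : @spherical X d j0 -> odd (dim X).
Proof.
move=> [_ _ _ [h /(congr1 (fun A => \tr A))]]; rewrite /ad !mxtraceD mxtrace_mulC.
rewrite -mulr2n (mulrn_pchar (pchar_Fp _)) // mxtrace1 -delta_colrow mxtrace_mulC.
by rewrite mul_delta_mx trace_mx11 mxE eqxx natr_F2; case: odd.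
Qed.

Lemma spherical_natmx X d (j0 : 'I_(dim X)) (dx : nat -> int) (sx : bool -> nat -> nat -> nat)
    (h : nat -> nat -> nat) :
  (forall j : 'I_(dim X), deg j = dx j) ->
  (forall b, sq X b = natmx (dim X) (dim X) (sx b)) -> dx j0 = d ->
  all (fun j : nat => (j != j0 :> nat) ==> (d < dx j)) (iota 0 (dim X)) ->
  nat_chk (dim X) 1 (fun i _ => sx false i (j0 : nat)) (fun _ _ => 0%N) ->
  nat_chk (dim X) (dim X) (nad (dim X) (dim X) sx sx false h)
    (fun i j : nat => ((i == j) + ((i == j0 :> nat) && (j == j0 :> nat)))%N) ->
  @spherical X d j0.
Proof.
move=> hd hs e /allP lt c1 c2; split=> //.
- by rewrite hd.
- move=> j ne; rewrite hd.
  have /lt /implyP : (j : nat) \in iota 0 (dim X) by rewrite mem_iota ltn_ord.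
  exact.
- rewrite hs -colE (natmx0 _ 1) -(natmx_eq c1).
  by apply/matrixP=> i k; rewrite !mxE.
exists (natmx (dim X) (dim X) h); rewrite (ad_natmx false h hs hs) (natmx_eq c2).
by rewrite natmx1 -natmx_add; congr (_ + _); apply/matrixP=> i j; rewrite !mxE.
Qed.

Lemma spherical_OmegaF : @spherical OmegaF 1 (0 : 'I_7).
Proof.
(* The homotopy reverses the three Sq1 arrows. *)
apply: (@spherical_natmx OmegaF 1 (0 : 'I_7) (fun i => nth 0 [:: 1; 2; 3; 3; 4; 5; 6] i)
  (fun b => nedge (if b then [:: (0, 3); (1, 4); (2, 5); (4, 6)]%N
              else [:: (1, 2); (3, 4); (5, 6)]%N)) (nedge [:: (2, 1); (4, 3); (6, 5)]%N));
  [> by [] | by move=> b; exact: edge_mxE | by [] | | |]; by vm_compute.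
Qed.

Lemma spherical_OmegaJ : @spherical OmegaJ 1 (0 : 'I_3).
Proof.
apply: (@spherical_natmx OmegaJ 1 (0 : 'I_3) (fun i => nth 0 [:: 1; 3; 4] i)
  (fun b => nedge (if b then [:: (0, 1)]%N else [:: (1, 2)]%N)) (nedge [:: (2, 1)]%N));
  [> by [] | by move=> b; exact: edge_mxE | by [] | | |]; by vm_compute.
Qed.

Lemma spherical_unit : @spherical unit_mod 0 (0 : 'I_1).
Proof.
split=> //; first by move=> j; rewrite (ord1 j).
  by rewrite unit_sq mul0mx.
exists 0; rewrite ad0; apply/matrixP=> i j; rewrite !mxE (ord1 i) (ord1 j) eqxx.
by apply/val_inj.
Qed.

Lemma spherical_row_hom X j0 : @spherical X 0 j0 ->
  @is_hom X unit_mod (delta_mx (0 : 'I_1) j0).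
Proof.
move=> h; split=> [i k|b]; last by rewrite (spherical_row b h) unit_sq mul0mx.
rewrite mxE; have [->|] := eqVneq k j0; last by rewrite andbF eqxx.
by case: h => -> .
Qed.

Lemma spherical_hom X j0 (g : 'M_(dim unit_mod, dim X)) : @spherical X 0 j0 ->
  @is_hom X unit_mod g -> g = 0 \/ g = delta_mx (0 : 'I_1) j0.
Proof.
move=> [e lt _ _] [hg _]; have [g0|g1] := F2_cases (g ord0 j0); [left|right];
  apply/matrixP=> i k; rewrite !mxE (ord1 i); have [->|ne] := eqVneq k j0.
all: rewrite ?g0 ?g1 ?eqxx //; apply/eqP/negPn/negP => /hg /=.
all: by move=> d0; have := lt k ne; rewrite -d0 ltxx.
Qed.

(* The pushout of an extension of W along a functional f on its kernel X. *)
Lemma pushout X Y W A (j : 'M_(dim Y, dim X)) e i f :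
  @sexact X Y W j e -> @sexact A X unit_mod i f ->
  exists C (z : 'I_(dim C)), [/\ ses A Y C, deg z = 0,
    forall k, k != z -> exists w : 'I_(dim W), deg k = deg w
    & forall b, sq C b *m delta_mx z (0 : 'I_1) = 0].
Proof.
move=> hY hA; have [hj he _] := hY.
have [rj [se [[hrj hse rjj ese eje] rse]]] := sexact_homog hY.
have [hi hf [ri [sf [rii fs eif]]]] := hA; have fi := sexact0 hA; have ej := sexact0 hY.
(* C is the quotient of Y by A, in the coordinates F + W: [q] is the projection, [t] a linear
   section of it, and [s] below the induced action, whose upper right block is the extension
   cocycle. *)
pose q := col_mx (f *m rj) e; pose t := row_mx (j *m sf) se.
have qt : q *m t = 1%:M.
  rewrite mul_col_row ese (mulmxA e) ej mul0mx -!mulmxA rse mulmx0 (mulmxA rj) rjj mul1mx fs.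
  by rewrite -scalar_mx_block.
pose s b : 'M['F_2]_(1 + dim W) := block_mx 0 (f *m rj *m sq Y b *m se) 0 (sq W b).
have qs b : q *m sq Y b = s b *m q.
  rewrite mul_col_mx mul_block_col !mul0mx !add0r (is_hom_sq b he); congr col_mx.
  rewrite -!mulmxA.
  have -> : se *m e = 1%:M + j *m rj by rewrite -eje addrC addmK2.
  rewrite mulmxDr mulmx1 !mulmxDr (mulmxA (sq Y b)) -(is_hom_sq b hj).
  rewrite -(mulmxA j) (mulmxA rj j) rjj mul1mx (mulmxA f (sq X b)) (is_hom_sq b hf) unit_sq.
  by rewrite !mul0mx addr0.
have sE b : s b = q *m sq Y b *m t by rewrite qs -mulmxA qt mulmx1.
pose d (k : 'I_(1 + dim W)) : int := match fintype.split k with inl _ => 0 | inr w => deg w end.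
have [p1 p2] := sq_presentation Y.
(* Since [q] is onto, the relations of A(1) on C are inherited from those on Y. *)
have inj (u v : 'M_(1 + dim W)) : u *m q = v *m q -> u = v.
  by move/(congr1 (mulmx^~ t)); rewrite -!mulmxA qt !mulmx1.
have e2 a b : s a *m s b *m q = q *m (sq Y a *m sq Y b).
  by rewrite -mulmxA -(qs b) (mulmxA (s a)) -(qs a) mulmxA.
have h1 : s false *m s false = 0 by apply: inj; rewrite e2 p1 mulmx0 mul0mx.
have h2 : s true *m s true = s false *m s true *m s false.
  by apply: inj; rewrite e2 p2 -[RHS]mulmxA -(qs false)
    (mulmxA (s false *m s true) q) e2 !mulmxA.
have hfr : @homog Y unit_mod 0 (f *m rj).
  exact: (homog_mul (esym (addr0 0)) (is_hom_homog hf) hrj).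
have hrow (b : bool) w : (f *m rj *m sq Y b *m se) 0 w != 0 -> 0 = deg w + b.+1%:Z.
  have hfs : @homog Y unit_mod b.+1%:Z (f *m rj *m sq Y b).
    exact: (homog_mul (esym (add0r _)) hfr (@homog_sq Y b)).
  by move/(homog_mul (esym (addr0 _)) hfs hse (i := 0 : 'I_1)).
have hd (b : bool) (k l : 'I_(1 + dim W)) : s b k l != 0 -> d k = d l + b.+1%:Z.
  rewrite /s /d; case: (split_ordP k) => k' ->; case: (split_ordP l) => l' ->.
  - by rewrite block_mxEul mxE eqxx.
  - by rewrite block_mxEur (ord1 k') => /hrow.
  - by rewrite block_mxEdl mxE eqxx.
  - by rewrite block_mxEdr; exact: sq_deg.
pose C := mk_gmod hd h1 h2.
have hq : @is_hom Y C q.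
  split=> [k l|b]; last exact: qs.
  rewrite /= /d; case: (split_ordP k) => k' ->.
    rewrite col_mxEu (ord1 k').
    by move/(hfr (0 : 'I_1)); rewrite addr0.
  by rewrite col_mxEd; case: he => he' _ /he'.
exists C, (lshift (dim W) (0 : 'I_1)); split.
- exists (j *m i), q; split=> //; first exact: is_hom_mul.
  exists (ri *m rj), t; split=> //; first by rewrite -mulmxA (mulmxA rj) rjj mul1mx rii.
  rewrite /t /q mul_row_col mulmxA -(mulmxA j) -!mulmxA addrA -mulmxDr !mulmxA -mulmxDl.
  by rewrite eif mul1mx.
- by rewrite /= /d (unsplitK (inl _)).
- move=> k; case: (split_ordP k) => k' -> /=; first by rewrite (ord1 k') eqxx.
  by move=> _; exists k'; rewrite /d (unsplitK (inr _)).
- move=> b; rewrite -colE; apply/matrixP=> k l; rewrite mxE [RHS]mxE /= /s.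
  by case: (split_ordP k) => k' ->; rewrite ?block_mxEul ?block_mxEdl mxE.
Qed.

Definition joker_row (i : nat) : 'M['F_2]_(1, dim joker) := natmx 1 5 (fun _ k => k == i).

Lemma sq_joker b : sq joker b = natmx 5 5
  (nedge (if b then [:: (0, 2); (1, 3); (2, 4)]%N else [:: (0, 1); (3, 4)]%N)).
Proof. exact: edge_mxE. Qed.

(* phi below is the functional c (x) j |-> 1 of degree -2; since c spans a
   trivial submodule, c (x) J is a copy of the Joker and Sq2 Sq2 Sq2 kills it. *)
Lemma tens_joker_neq C (z : 'I_(dim C)) : deg z = 0 -> (forall k : 'I_(dim C), - 1 <= deg k) ->
  (forall b, sq C b *m delta_mx z (0 : 'I_1) = 0) -> ~ stable_iso C (tens C joker).
Proof.
move=> dz dC cz /stable_isoP [v [u [hv hu _ [t vu]]]].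
pose l : 'M['F_2]_(1, dim C) := delta_mx 0 z.
pose c : 'M['F_2]_(dim C, 1) := delta_mx z 0.
pose j : 'M['F_2]_(dim joker, 1) := natmx 5 1 (fun i _ => i == 0%N).
have cj b (w : 'M['F_2]_(dim joker, 1)) :
    sq (tens C joker) b *m (c *t w) = c *t (sq joker b *m w).
  by case: b; rewrite /= !mulmxDl !tensmx_mul !cz !mul1mx !tens0mx ?add0r ?addr0.
(* The second summand restores Sq1-invariance: [l *t joker_row 0] alone fails it by (l Sq1) (x) row
   0, and row 1 composed with Sq1 is row 0. *)
pose phi : 'M['F_2]_(1 * 1, dim C * dim joker) :=
  l *t joker_row 0 + (l *m sq C false) *t joker_row 1.
have phim : phi *m (c *t j) = 1%:M.
  rewrite mulmxDl !tensmx_mul -mulmxA cz mulmx0 tens0mx addr0 -tensmx11.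
  congr (_ *t _); first by rewrite mul_delta_mx; apply/matrixP=> i k; rewrite !mxE !ord1 eqxx.
  by rewrite natmx_mul natmx1; apply: natmx_eq; vm_compute.
have sqm : (sq (tens C joker) true *m sq (tens C joker) true *m sq (tens C joker) true)
    *m (c *t j) = 0.
  rewrite -!mulmxA !cj !mulmxA sq_joker !natmx_mul.
  rewrite (_ : natmx _ _ _ = 0) ?tensmx0 //.
  by rewrite (natmx0 5 1); apply: natmx_eq; vm_compute.
have low b k : (l *m sq C b) 0 k != 0 -> deg k = - b.+1%:Z.
  by rewrite -rowE mxE => /sq_deg; rewrite dz => /esym/eqP; rewrite addr_eq0 => /eqP.
(* A nonzero coefficient would lie in degree -2, below all of C; likewise in degree -3 for [l3]. *)
have l2 : l *m sq C true = 0.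
  apply/matrixP=> i k; rewrite (ord1 i) [RHS]mxE; apply/eqP/negPn/negP => /low dk.
  by have := dC k; rewrite dk.
have l3 : l *m sq C false *m sq C true = 0.
  have h : @homog C (susp 0 unit_mod) 3 (l *m sq C false *m sq C true).
    apply: (homog_mul (d := 1) (e := 2) _ _ (@homog_sq C true)) => //.
    by move=> i k; rewrite (ord1 i) => /low ->.
  apply/matrixP=> i k; rewrite [RHS]mxE; apply/eqP/negPn/negP => /h /=.
  have := dC k => + e; have -> : deg k = - 3 by apply/eqP; rewrite -addr_eq0 -e.
  by [].
have l11 : l *m sq C false *m sq C false = 0.
  by rewrite -mulmxA (sq_presentation C).1 mulmx0.
have hphi : @is_hom (tens C joker) (susp (- 2) unit_mod) phi.
  have r0 b : joker_row 0 *m sq joker b = 0.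
    by rewrite sq_joker natmx_mul (natmx0 1 5); apply: natmx_eq; case: b; vm_compute.
  have r1 : joker_row 1 *m sq joker false = joker_row 0.
    by rewrite sq_joker natmx_mul; apply: natmx_eq; vm_compute.
  have r1' : joker_row 1 *m sq joker true = 0.
    by rewrite sq_joker natmx_mul (natmx0 1 5); apply: natmx_eq; vm_compute.
  have phis b : phi *m sq (tens C joker) b = 0.
    have [r0t r0f] := (r0 true, r0 false); rewrite /= in r0t r0f r1 r1'.
    rewrite /phi; case: b; rewrite /= !mulmxDr !mulmxDl !tensmx_mul !mulmx1.
      by rewrite !(l2, l3, l11, r0t, r0f, r1', tens0mx, tensmx0, addr0).
    by rewrite l11 r0f r1 !(tens0mx, tensmx0) addr0 add0r addmm.
  split=> [i k|b].
    rewrite (_ : deg i = - 2) //; case: (mxtens_indexP k) => x y.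
    have -> : i = mxtens_index (0 : 'I_1, 0 : 'I_1) by apply/val_inj; case: i => -[].
    rewrite mxE !tensmxE deg_tens.
    rewrite ![joker_row _ _ _]mxE ![l _ _]mxE (_ : deg y = y%:Z - 2); last first.
      by case: y => y; do 5?[case: y => [|y]].
    have [-> |x0] := eqVneq x z.
      rewrite dz; have [->|y0] := eqVneq (nat_of_ord y) 0%N; first by rewrite mulr1.
      rewrite mulr0 add0r; have [->|] := eqVneq (nat_of_ord y) 1%N; last by rewrite mulr0 eqxx.
      by rewrite mulr1 => /low; rewrite dz.
    rewrite andbF mul0r add0r.
    have [->|] := eqVneq (nat_of_ord y) 1%N; last by rewrite mulr0 eqxx.
    by rewrite mulr1 => /low ->.
  by rewrite -[sq (susp _ _) _]/(sq unit_mod b) unit_sq mul0mx; exact: phis.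
have phiv : phi *m v = 0.
  have h := is_hom_mul hphi hv; apply/matrixP=> i k; rewrite [RHS]mxE.
  apply/eqP/negPn/negP; case: h => h _ /h /= e; have := dC k; rewrite -e.
  by [].
(* Since phi Lam(t) = (phi t) Sq2 Sq2 Sq2 kills c (x) j while phi v = 0 by degrees, phi(c (x) j)
   would be 0, not 1. *)
have : phi *m (v *m u - 1%:M) *m (c *t j) = 0.
  by rewrite vu -(Lam_mull _ hphi)
    (@Lam_functional _ (susp (- 2) unit_mod) _ unit_sq) -[LHS]mulmxA sqm mulmx0.
rewrite mulmxBr mulmx1 mulmxA phiv mul0mx sub0r oppm phim => /matrixP /(_ 0 0).
by rewrite !mxE.
Qed.

(** * The modules A_{k,eps} *)

(* A map from a reduced module to F that factors through a projective is 0. *)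
Lemma kernel_choice L X j0 A' i' : reduced L -> stable_iso L X -> @spherical X 0 j0 ->
  @sexact A' X unit_mod i' (delta_mx (0 : 'I_1) j0) ->
  exists f : 'M_(dim unit_mod, dim L), uniq_nontrivial f /\
    forall K i, @sexact K L unit_mod i f -> stable_iso K A'.
Proof.
move=> rL /stable_isoP [u [v [hu hv nvu nuv]]] sX hA'.
set f' : 'M_(dim unit_mod, dim X) := delta_mx _ _ in hA' *.
have hf' : @is_hom X unit_mod f' := spherical_row_hom sX.
have redL (g : 'M_(dim unit_mod, dim L)) : @is_hom L unit_mod g -> g *m (v *m u) = g.
  move=> hg; have [t tE] := nvu; rewrite -[v *m u](subrK 1%:M) tE mulmxDr mulmx1.
  by rewrite -(Lam_mull _ hg) (Lam_functional _ unit_sq) rL mulmx0 add0r.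
pose s : 'M['F_2]_(dim X, 1) := delta_mx j0 0.
have f's : f' *m s = 1%:M by rewrite mul_delta_mx; apply/matrixP=> i k; rewrite !mxE !ord1.
(* The error f' (u v - 1) s vanishes: the integral starts with Sq1, which acts by 0 on F and kills
   the bottom class [s]. *)
have uvs : f' *m (u *m v) *m s = 1%:M.
  have [t tE] := nuv; rewrite -[u *m v](subrK 1%:M) tE mulmxDr mulmx1 mulmxDl f's.
  rewrite -(Lam_mull _ hf') /Lam ad_sq2; move: (ad true (ad false _)) => kp.
  rewrite /ad unit_sq mul0mx add0r -mulmxA.
  by case: sX => _ _ s0 _; rewrite s0 mulmx0 add0r.
have one0 : 0 <> 1%:M :> 'M['F_2]_1 by move=> /matrixP /(_ 0 0); rewrite !mxE.
have fv : f' *m u *m v = f'.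
  have [e|//] := spherical_hom sX (is_hom_mul (is_hom_mul hf' hu) hv).
  by case: one0; rewrite -uvs mulmxA e mul0mx.
exists (f' *m u); split; last first.
  by move=> K i hK; apply: (kernel_compare hK hA' hu hv nvu nuv).
split; first exact: is_hom_mul.
  by apply/eqP => e; case: one0; rewrite -uvs mulmxA e !mul0mx.
(* Any [g] equals (g v) u because L is reduced, and the functional g v on X is 0 or f'. *)
move=> g hg g0; rewrite -(redL g hg) mulmxA.
have [e|-> //] := spherical_hom sX (is_hom_mul hg hv).
by case/eqP: g0; rewrite -(redL g hg) mulmxA e mul0mx.
Qed.

(** Over A(0) the bottom class splits off X: it is killed by Sq1, so the retraction [r] onto A'
    commutes with Sq1 and carries the homotopy of X to a contraction of A'. *)
Lemma spherical_kernel X j0 : @spherical X 0 j0 ->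
  exists A' i', @sexact A' X unit_mod i' (delta_mx (0 : 'I_1) j0) /\ acyclic A'.
Proof.
move=> sX; have hf := spherical_row_hom sX.
have fs : delta_mx (0 : 'I_1) j0 *m delta_mx j0 (0 : 'I_1) = 1%:M :> 'M['F_2]_1.
  by rewrite mul_delta_mx; apply/matrixP=> i k; rewrite !mxE !ord1.
have [A' [i' h]] := kernel_exists hf (ex_intro _ _ fs).
exists A', i'; split=> //.
have [r [s [[hr hs ri ps e] rs]]] := sexact_homog h.
have [e0 lt s0 [a aE]] := sX; have [hi _ _] := h.
have sE : s = delta_mx j0 (0 : 'I_1).
  apply/matrixP=> k l; have [->|ne] := eqVneq k j0; last first.
    rewrite [RHS]mxE (negbTE ne); apply/eqP/negPn/negP => /hs /=; rewrite !addr0 => ek.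
    by have := lt k ne; rewrite ek ltxx.
  have /matrixP /(_ 0 l) := ps; rewrite -rowE mxE => ->.
  by rewrite !mxE !ord1 !eqxx.
have rsq : r *m sq X false = sq A' false *m r.
  have ir : i' *m r = 1%:M + s *m delta_mx (0 : 'I_1) j0 by rewrite -e -addrA addmm addr0.
  rewrite -[LHS]mulmx1 -e mulmxDr sE -!mulmxA (mulmxA (sq X false) (delta_mx _ _)) s0 mul0mx.
  rewrite mulmx0 addr0 (mulmxA (sq X false)) -(is_hom_sq false hi) -mulmxA mulmxA ri.
  by rewrite mul1mx.
exists (r *m a *m i'); rewrite /ad.
rewrite !mulmxA -rsq -[_ *m i' *m _]mulmxA (is_hom_sq false hi) -!mulmxA.
rewrite -mulmxDr !mulmxA -mulmxDl -/(@ad X X false a) aE mulmxDl mul1mx mulmxDr ri -delta_colrow -sE.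
by rewrite -(mulmxA s) (sexact0 h) !mulmx0 addr0.
Qed.

Lemma tpowS M n : stable_iso (tpow M n.+1) (tens M (tpow M n)).
Proof. by case: n => [|n]; rewrite /tpow //= stable_unitr. Qed.

Lemma iter_shiftE n M :
  stable_iso (iter n shift M) (susp (- (3 * n)%N%:Z) (tens (tpow OmegaF n) M)).
Proof.
elim: n => [|n IH]; first by rewrite muln0 oppr0 stable_susp0 stable_unitl.
rewrite iterS IH /shift stable_suspr stable_susp_susp tpowS -stable_assoc.
have -> : - (3 * n)%N%:Z - 3 = - (3 * n.+1)%N%:Z by lia.
exact: stable_refl.
Qed.

Lemma spherical_tpow n : exists x, @spherical (tpow OmegaF n) n%:Z x.
Proof.
elim: n => [|[|n] [x hx]]; first by eexists; exact: spherical_unit.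
  by eexists; exact: spherical_OmegaF.
have := spherical_tens spherical_OmegaF hx; have -> : 1 + n.+1%:Z = n.+2%:Z by lia.
by move=> h; eexists; exact: h.
Qed.

Lemma invertible_tpow n : invertible (tpow OmegaF n).
Proof.
elim: n => [|[|n] h]; [exact: invertible_unit|exact: invertible_OmegaF|].
exact: invertible_tens invertible_OmegaF h.
Qed.

Section Sphere.
Variables (k eps : nat).
Hypotheses (hk : (1 <= k)%N) (heps : eps \in [:: 0; 1]%N).

Let L := susp (- k.+1%:Z) (Omega k.+1 (tpow joker eps)).

Lemma reduced_L : reduced L.
Proof. exact: (redP (tens (tpow OmegaF k.+1) (tpow joker eps))).1. Qed.

Lemma stable_L : stable_iso L (susp (- k.+1%:Z) (tens (tpow OmegaF k.+1) (tpow joker eps))).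
Proof. by apply: stable_susp; exact: (redP _).2. Qed.

(** One factor Omega F is kept apart: writing L as Omega W later allows A to be written as Omega of
    an extension of W, and W starts in degree -1. *)
Lemma sphere_model : exists W w,
  [/\ @spherical W (- 1) w, invertible W & stable_iso L (tens OmegaF W)].
Proof.
have [P [Q [q [hQ iQ PQ]]]] : exists P Q q, [/\ @spherical (tens P Q) k%:Z q,
    invertible (tens P Q) & stable_iso (tens (tpow OmegaF k) (tpow joker eps)) (tens P Q)].
  move: heps; rewrite !inE => /orP [] /eqP ->.
    have [x hx] := spherical_tpow k; exists (tpow OmegaF k), unit_mod.
    eexists; split=> //; last exact: invertible_tens (invertible_tpow k) invertible_unit.
    by have := spherical_tens hx spherical_unit; rewrite addr0 => h; exact: h.
  (* As k is positive, one more factor Omega F is available to be merged with J into the spherical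
     module [OmegaJ]. *)
  case: (k) hk => // n _; have [x hx] := spherical_tpow n; exists (tpow OmegaF n), OmegaJ.
  eexists; split; last 2 first.
  - exact: invertible_tens (invertible_tpow n) invertible_OmegaJ.
  - by rewrite tpowS -stable_assoc stable_CA OmegaJ_stable.
  by have := spherical_tens hx spherical_OmegaJ; rewrite -PoszD addn1 => h; exact: h.
exists (susp (- k.+1%:Z) (tens P Q)), q; split; last 2 first.
- exact: invertible_susp.
- by rewrite stable_L tpowS -stable_assoc PQ stable_suspr.
have := spherical_susp (- k.+1%:Z) hQ.
by rewrite -addn1 PoszD opprD addrA subrr add0r.
Qed.

(** [Amod] is a choice with default [unit_mod]: a kernel K0 of the functional [f] shows that the
    choice is a genuine one, and uniqueness of the functional shows that it is a kernel of [f]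
    too. *)
Lemma Amod_sphere : exists W w A' i',
  [/\ [/\ @spherical W (- 1) w, invertible W & stable_iso L (tens OmegaF W)],
      @sexact A' (tens OmegaF W) unit_mod i' (delta_mx (0 : 'I_1) (mxtens_index (0 : 'I_7, w))),
      @spherical (tens OmegaF W) 0 (mxtens_index (0 : 'I_7, w)),
      acyclic A' & stable_iso (Amod k eps) A'].
Proof.
have [W [w [sW iW LW]]] := sphere_model.
have sX : @spherical (tens OmegaF W) 0 (mxtens_index (0 : 'I_7, w)).
  by have := spherical_tens spherical_OmegaF sW.
have [A' [i' [hA' aA']]] := spherical_kernel sX.
exists W, w, A', i'; split=> //.
have [f [uf fK]] := kernel_choice reduced_L LW sX hA'.
have [hf f0 _] := uf.
have [s fs] : exists s, f *m s = 1%:M.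
  have [x fx] : exists x, f 0 x != 0.
    apply: contrapT => /forallNP h; case/eqP: f0; apply/matrixP=> i x.
    rewrite [RHS]mxE (ord1 i).
    by apply/eqP/negPn/negP/h.
  exists (delta_mx x (0 : 'I_1)); rewrite -colE; apply/matrixP=> i y; rewrite !mxE !ord1.
  by have [e|//] := F2_cases (f 0 x); rewrite e eqxx in fx.
have [K0 [i0 hK0]] := kernel_exists hf (ex_intro _ s fs).
have := @xgetI _ unit_mod [set K | exists f : 'M_(dim unit_mod, dim L),
    uniq_nontrivial f /\ is_kernel f K]%classic K0.
case; first by exists f; split=> //; exact: sexact_kernel hK0.
rewrite -/(Amod k eps) => g [ug kg].
have gf : g = f by case: uf => _ _ h; case: ug => hg g0 _; exact: h.
rewrite gf in kg; have [i hi] := kernel_sexact hf fs kg.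
exact: fK hi.
Qed.

End Sphere.

Lemma susp_eq a b M : a = b -> stable_iso (susp a M) (susp b M).
Proof. by move=> ->. Qed.

Lemma SOmega_shift M : stable_iso (SOmega M) (shift M).
Proof. exact: stable_susp (redP _).2. Qed.

Lemma iter_shift_stable n M N : stable_iso M N ->
  stable_iso (iter n shift M) (iter n shift N).
Proof. by move=> h; elim: n => //= n ->. Qed.

Lemma iter_SOmega n M : stable_iso (iter n SOmega M) (iter n shift M).
Proof. by elim: n => //= n IH; rewrite SOmega_shift IH. Qed.

Lemma iter_shift_inj n M N : stable_iso (iter n shift M) (iter n shift N) -> stable_iso M N.
Proof. by elim: n => //= n IH /shift_inj. Qed.

Lemma acyclic_shift n M : acyclic M -> acyclic (iter n shift M).
Proof. by move=> aM; elim: n => //= n IH; apply/acyclic_susp/acyclic_tensl. Qed.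

Lemma iter_shift_mod n m M : acyclic M -> (n = m %[mod 4])%N ->
  stable_iso (iter n shift M) (iter m shift M).
Proof.
move=> aM; have red4 p : stable_iso (iter p shift M) (iter (p %% 4)%N shift M).
  rewrite {1}(divn_eq p 4) addnC iterD; apply: iter_shift_stable.
  elim: (p %/ 4)%N => // q IH; rewrite mulSn iterD.
  apply: stable_trans (iter_shift_stable 4 IH) _; exact: shift4.
by move=> e; rewrite red4 e -red4.
Qed.

Lemma dual_op_stable k M N : stable_iso M N -> stable_iso (dual_op k M) (dual_op k N).
Proof. by move=> h; rewrite /dual_op h. Qed.

(** The dihedral relation: duality inverts both Omega F and Sigma^(-3). *)
Lemma dual_op_shift k M : stable_iso (shift (dual_op k (shift M))) (dual_op k M).
Proof.
rewrite /dual_op /shift stable_dual_susp stable_dual_tens opprK !stable_suspr !stable_susp_susp.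
rewrite stable_assoc OmegaF_dual stable_unitl.
by apply: susp_eq; lia.
Qed.

Lemma dual_op_joker k M : stable_iso (dual_op k (tens M joker)) (tens (dual_op k M) joker).
Proof. by rewrite /dual_op stable_dual_tens dual_joker stable_suspl. Qed.

Section Family.
Variables (k eps : nat).
Hypotheses (hk : (1 <= k)%N) (heps : eps \in [:: 0; 1]%N).

Local Notation A := (Amod k eps).

Lemma acyclic_Amod : acyclic A.
Proof.
have [W [w [A' [i' [_ _ _ aA' e]]]]] := Amod_sphere hk heps.
by apply: acyclic_stable aA'; exact: stable_sym.
Qed.

Lemma Amod_joker_neq : ~ stable_iso A (tens A joker).
Proof.
have [W [w [A' [i' [[sW iW LW] hA' sX aA' AA']]]]] := Amod_sphere hk heps.
have [j [e hj]] := sexact_OmegaF.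
have [f [g [hf hg gf fg]]] := iso_unitl W.
have hY := sexact_isor (sexact_tensr W hj) hf gf fg.
(* The cover Omega W -> A(1) (x) W -> W is pushed out along the functional on Omega W with kernel
   A'; hence A' -> A(1) (x) W -> C is exact, and C lives in degree 0 and the degrees of W. *)
have [C [z [hC dz dC cz]]] := pushout hY hA'.
have A'C : stable_iso A' (tens OmegaF C) := ses_stable hC (null1_tensr W null1_A1).
rewrite AA' A'C -stable_assoc => /(invertible_cancel invertible_OmegaF).
apply: (tens_joker_neq dz) => // c.
have [->|/dC [x ->]] := eqVneq c z; first by rewrite dz.
exact: spherical_ge sW.
Qed.

(** With S = Sigma^(-3) Omega, the operator Sigma^(-(k+1)) Omega^(k+2) supplied by [kernel_dual] is
    S^(k+2) Sigma^(3(k+2)-(k+1)). The suspension is 2k+5, the one in the duality; the factor J^eps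
    contributes S^(2 eps). *)
Definition refl_index : nat := k.+2 + eps.*2.

Lemma Amod_dual : stable_iso A (iter refl_index shift (dual_op k A)).
Proof.
have [W [w [A' [i' [[sW iW LW] hA' sX aA' AA']]]]] := Amod_sphere hk heps.
have aA := acyclic_Amod.
have h : stable_iso A (tens OmegaF (tens (tens OmegaF W) (dual A))).
  rewrite AA'; exact: (kernel_dual hA'
    (invertible_tens invertible_OmegaF iW) (spherical_odd sX)).
have Je B : acyclic B -> stable_iso (tens (tpow joker eps) B) (iter eps.*2 shift B).
  move: heps; rewrite !inE => /orP [] /eqP -> aB; first exact: stable_unitl.
  by rewrite stable_comm; exact: tens_joker.
have aB : acyclic (dual_op k A) by exact/acyclic_susp/acyclic_dual.
have e : iter refl_index shift (dual_op k A) =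
  iter k.+1 shift (shift (iter eps.*2 shift (dual_op k A))).
  by rewrite /refl_index iterD iterSr.
rewrite e iter_shiftE -(Je _ aB) {1}h -LW stable_L {e aB aA h hA' sX aA' AA'} /dual_op /shift.
move: (tpow OmegaF k.+1) (tpow joker eps) (dual A) => T Q D.
rewrite !stable_suspl !stable_suspr !stable_susp_susp.
rewrite -stable_assoc (stable_CA T OmegaF); apply: susp_eq; lia.
Qed.

(** The factor 3 stands for -1 modulo 4, so that exponents stay natural numbers. Both sides are
    compared after the injective operation S^(r+t), r being [refl_index]. *)
Lemma dual_op_iter t : stable_iso (dual_op k (iter t shift A))
  (iter (3 * (t + refl_index)) shift A).
Proof.
have S_dual M n : stable_iso (iter n shift (dual_op k (iter n shift M))) (dual_op k M).
  elim: n => // n IH; rewrite iterSr iterS.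
  by apply: stable_trans IH; apply: iter_shift_stable; exact: dual_op_shift.
apply: (@iter_shift_inj (refl_index + t)); rewrite -iterD iterD.
apply: stable_trans (iter_shift_stable _ (S_dual A t)) _.
rewrite -Amod_dual; apply/stable_sym/(@iter_shift_mod _ 0 A acyclic_Amod).
rewrite addnC addnA; lia.
Qed.

(** Only S^2 A ~ A is excluded directly, through J. It would follow from S A ~ A, which in turn
    would follow from S^3 A ~ A by S^4 A ~ A. *)
Lemma iter_shift_Amod i j :
  stable_iso (iter i shift A) (iter j shift A) <-> (i = j %[mod 4])%N.
Proof.
have aA := acyclic_Amod; split=> [h|]; last exact: iter_shift_mod.
have no2 : ~ stable_iso A (shift (shift A)).
  by rewrite -(tens_joker aA); exact: Amod_joker_neq.
have no1 : ~ stable_iso A (shift A) by move=> h1; apply: no2; rewrite -h1.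
have no3 : ~ stable_iso A (iter 3 shift A).
  by move=> h3; apply: no1; rewrite {2}h3 /= (shift4 aA).
have key n d : stable_iso (iter n shift A) (iter (n + d) shift A) -> (d < 4)%N -> d = 0%N.
  by rewrite iterD => /iter_shift_inj h4; move: d h4 => [|[|[|[|d]]]].
have m4 n := iter_shift_mod aA (esym (modn_mod n 4)).
have h4 : stable_iso (iter (i %% 4)%N shift A) (iter (j %% 4)%N shift A) by rewrite -!m4.
have [i4 j4] := (ltn_pmod i (isT : 0 < 4)%N, ltn_pmod j (isT : 0 < 4)%N).
have [le|/ltnW le] := leqP (i %% 4)%N (j %% 4)%N.
  have := key (i %% 4)%N (j %% 4 - i %% 4)%N; rewrite subnKC // => /(_ h4); lia.
have := key (j %% 4)%N (i %% 4 - j %% 4)%N; rewrite subnKC // => /(_ (stable_sym h4)); lia.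
Qed.

End Family.

(** * The dihedral action *)

Section DihedralGroup.
Local Open Scope group_scope.

Section DihedralRelations.
Variables (gT : finGroupType) (x y : gT).
Hypotheses (x4 : x ^+ 4 = 1) (x2 : x ^+ 2 != 1) (y2 : y ^+ 2 = 1) (xy : x ^ y = x^-1).

Lemma dihedral_order_x : #[x] = 4%N.
Proof.
have : (#[x] %| 4)%N by rewrite order_dvdn x4.
have : ~~ (#[x] %| 2)%N by rewrite order_dvdn.
by case: #[x] => [|[|[|[|[|n]]]]] // _ /dvdn_leq.
Qed.

Lemma dihedral_ynotin : y \notin <[x]>.
Proof.
apply/negP => /cycleP [i yE].
have : x ^ y = x by rewrite yE conjgE (commuteX i (commute_refl x)) mulKg.
by rewrite xy => /(congr1 (mulg x)); rewrite mulgV => e; case/eqP: x2; rewrite expgS expg1.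
Qed.

Lemma dihedral_order_y : #[y] = 2%N.
Proof.
apply: nt_prime_order => //; apply: contraNneq dihedral_ynotin => ->; exact: group1.
Qed.

Lemma dihedral_TI : <[x]> :&: <[y]> = 1.
Proof.
rewrite finset.setIC; apply: prime_TIg; first by rewrite -orderE dihedral_order_y.
by rewrite cycle_subG dihedral_ynotin.
Qed.

Lemma dihedral_norm : <[y]> \subset 'N(<[x]>).
Proof.
by rewrite cycle_subG; apply/normP; rewrite -cycleJ xy cycleV.
Qed.

Lemma dihedral_card : #|<[x]> * <[y]>| = 8%N.
Proof.
by rewrite TI_cardMg ?dihedral_TI // -!orderE dihedral_order_x dihedral_order_y.
Qed.

End DihedralRelations.

(** The presentation of the dihedral group gives a surjection onto the subgroup generated by [a] and
    [b]; that subgroup contains the 8 products of their powers, so the map is injective and the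
    relations pull back to [x] and [y]. *)
Lemma D8_model (gT : finGroupType) (a b : gT) :
  a ^+ 4 = 1 -> a ^+ 2 != 1 -> b ^+ 2 = 1 -> a ^ b = a^-1 ->
  exists (x y : 'D_8) (f : {morphism 'D_8 >-> gT}),
    [/\ [/\ <[x]> ><| <[y]> = 'D_8, #[x] = 4%N & #[y] = 2%N],
        'Z('D_8) = <[x ^+ 2]>, #[x ^+ 2] = 2%N, f x = a & f y = b].
Proof.
move=> a4 a2 b2 ab; have D8 : #|'D_8| = 8%N := @card_2dihedral 3 isT.
pose H := <<[set a; b]>>%G.
have Hhom : H \homg 'D_8.
  rewrite (@Grp_2dihedral 3 isT); apply/existsP; exists (a, b); rewrite /= !xpair_eqE.
  rewrite a4 b2 ab !eqxx !andbT; apply/eqP; rewrite joing_idl joing_idr //.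
have [f fH] : exists f : {morphism 'D_8 >-> gT}, f @* 'D_8 = H by apply/homgP.
have finj : 'injm f.
  rewrite -card_im_injm eqn_leq leq_morphim fH D8 -(dihedral_card a4 a2 b2 ab) /=.
  by rewrite subset_leq_card // mul_subG ?cycle_subG // mem_gen // !inE eqxx ?orbT.
have [aH bH] : a \in f @* 'D_8 /\ b \in f @* 'D_8.
  by rewrite fH; split; rewrite mem_gen // !inE eqxx ?orbT.
have [x xD _ ax] := morphimP aH; have [y yD _ bY] := morphimP bH.
have fi := injmP finj.
have x4 : x ^+ 4 = 1 by apply: fi; rewrite ?inE // morphX // -ax a4 morph1.
have y2 : y ^+ 2 = 1 by apply: fi; rewrite ?inE // morphX // -bY b2 morph1.
have x2 : x ^+ 2 != 1.
  by apply: contraNneq a2 => x2; rewrite ax -morphX // x2 morph1.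
have xy : x ^ y = x^-1 by apply: fi; rewrite ?inE // morphJ // morphV // -ax -bY.
have ox := dihedral_order_x x4 x2; have ynx := dihedral_ynotin x2 xy.
exists x, y, f; split=> //.
- split=> //; last exact: dihedral_order_y x2 y2 xy.
  rewrite sdprodE ?(dihedral_TI x2 y2 xy) ?(dihedral_norm xy) //.
  by apply/eqP; rewrite eqEcard finset.subsetT D8 (dihedral_card x4 x2 y2 xy).
- have gen : extremal_generators 'D_8 2 3 (x, y) by split; rewrite ?inE ?ynx // ?D8 ?ox.
  by have [_ _ _ _ [-> _ _ _ _]] := @dihedral2_structure _ 'D_8%G 3 x y isT gen (isog_refl _).
- by rewrite orderXdiv ox.
Qed.

End DihedralGroup.

(** * The symmetries of Z/4 and the labelling of the orbit *)

Definition ord4 (n : nat) : 'I_4 := Ordinal (ltn_pmod n (isT : 0 < 4)%N).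

Lemma rot4_inj : injective (fun t : 'I_4 => ord4 t.+1).
Proof.
move=> t u /(congr1 val) /= e; apply/val_inj => /=.
have := ltn_ord t; have := ltn_ord u; lia.
Qed.

Lemma refl4_inj c : injective (fun t : 'I_4 => ord4 (3 * (t + c))).
Proof.
move=> t u /(congr1 val) /= e; apply/val_inj => /=.
have := ltn_ord t; have := ltn_ord u; lia.
Qed.

Definition rot4 : 'S_4 := perm rot4_inj.
Definition refl4 c : 'S_4 := perm (@refl4_inj c).

Lemma rot4E i : rot4 i = ord4 i.+1. Proof. by rewrite permE. Qed.
Lemma refl4E c i : refl4 c i = ord4 (3 * (i + c)). Proof. by rewrite permE. Qed.

Lemma rot4_4 : (rot4 ^+ 4 = 1)%g.
Proof.
apply/permP=> i; rewrite perm1 !expgS expg0 mulg1 !permM !rot4E; apply/val_inj => /=.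
have := ltn_ord i; lia.
Qed.

Lemma rot4_2 : (rot4 ^+ 2 != 1)%g.
Proof.
apply/eqP => /permP /(_ ord0); rewrite perm1 !expgS expg0 mulg1 !permM !rot4E.
by move/(congr1 val).
Qed.

Lemma refl4_2 c : (refl4 c ^+ 2 = 1)%g.
Proof.
apply/permP=> i; rewrite perm1 !expgS expg0 mulg1 !permM !refl4E; apply/val_inj => /=.
have := ltn_ord i; lia.
Qed.

Lemma rot4_refl4 c : (rot4 ^ refl4 c = rot4^-1)%g.
Proof.
have e : (rot4 * refl4 c * rot4 = refl4 c)%g.
  apply/permP=> i; rewrite !permM !rot4E !refl4E; apply/val_inj => /=.
  have := ltn_ord i; lia.
by rewrite conjgE -[(rot4 * refl4 c)%g](mulgK rot4) e mulKg.
Qed.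

Lemma stable_classE M N : stable_class M = stable_class N <-> stable_iso M N.
Proof.
split=> [e|h].
  have : stable_class M N by rewrite e; exact: stable_refl.
  by [].
by apply/seteqP; split=> P; [exact: stable_trans (stable_sym h)|exact: stable_trans h].
Qed.

Lemma iter_SOmega_class k eps i j : (1 <= k)%N -> eps \in [:: 0; 1]%N ->
  stable_class (iter i SOmega (Amod k eps)) = stable_class (iter j SOmega (Amod k eps)) <->
  (i = j %[mod 4])%N.
Proof.
move=> hk heps; rewrite stable_classE -(iter_shift_Amod hk heps) !iter_SOmega.
by [].
Qed.

Section Orbit.
Variables (k eps : nat).
Hypotheses (hk : (1 <= k)%N) (heps : eps \in [:: 0; 1]%N).
Local Notation A := (Amod k eps).
Local Notation O := (orbit_set k eps).

Lemma orbit_point_subproof (t : 'I_4) : O (stable_class (iter t SOmega A)).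
Proof. by exists (t : nat) => //=; rewrite -ltnS. Qed.

Definition orbit_point (t : 'I_4) : O := SigSub (mem_set (orbit_point_subproof t)).

Lemma orbit_pointE t : set_val (orbit_point t) = stable_class (iter t SOmega A).
Proof. by []. Qed.

Lemma orbit_point_ord4 n : set_val (orbit_point (ord4 n)) = stable_class (iter n SOmega A).
Proof. by rewrite orbit_pointE; apply/iter_SOmega_class => //=; rewrite modn_mod. Qed.

Lemma orbit_point_inj : injective orbit_point.
Proof.
move=> t u /(congr1 set_val); rewrite !orbit_pointE => /(iter_SOmega_class _ _ hk heps).
by rewrite !modn_small // => /val_inj.
Qed.

Lemma orbit_point_surj (c : O) : exists t, orbit_point t = c.
Proof.
have [t /= t3 e] := set_valP c; exists (ord4 t); apply: val_inj.
by rewrite -[LHS]/(set_val _) orbit_point_ord4 e.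
Qed.

Definition orbit_index (c : O) : 'I_4 := projT1 (cid (orbit_point_surj c)).

Lemma orbit_indexK : cancel orbit_index orbit_point.
Proof. by move=> c; exact: projT2 (cid (orbit_point_surj c)). Qed.

Lemma orbit_pointK : cancel orbit_point orbit_index.
Proof. by move=> t; apply: orbit_point_inj; rewrite orbit_indexK. Qed.

Lemma orbit_induces (p : 'S_4) (F : gmod -> gmod) :
  (forall M N, stable_iso M N -> stable_iso (F M) (F N)) ->
  (forall t : 'I_4, stable_iso (iter (p t) shift A) (F (iter t shift A))) ->
  induces F (fun c : O => orbit_point (p (orbit_index c))).
Proof.
move=> Fs Fp c M cM; rewrite orbit_pointE; apply/stable_classE.
rewrite iter_SOmega Fp; apply: Fs; rewrite -iter_SOmega; apply/stable_classE.
by rewrite -cM -[in RHS](orbit_indexK c) orbit_pointE.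
Qed.

End Orbit.

Theorem corollary7p9 (k eps : nat) (hk : (1 <= k)%N) (heps : eps \in [:: 0; 1]%N) :
  (exists (x y : 'D_8) (to : {action 'D_8 &-> orbit_set k eps}),
     [/\ [/\ (<[x]> ><| <[y]>)%g = D8, #[x]%g = 4%N & #[y]%g = 2%N],
         induces SOmega (fun c : orbit_set k eps => to c x),
         induces (dual_op k) (fun c : orbit_set k eps => to c y),
         exists z : 'D_8,
           [/\ 'Z(D8)%g = <[z]>%g, #[z]%g = 2%N
             & induces (fun M : gmod => tens M joker)
                       (fun c : orbit_set k eps => to c z)]
       & ([set c : orbit_set k eps | to c y = c] #=
            `I_(if odd k then 0 else 2))%classic%card]) /\
  (forall t : nat,
     let X := iter t SOmega (Amod k eps) in
     stable_iso (tens X joker) (iter t.+2 SOmega (Amod k eps)) /\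
     (stable_iso (dual_op k X) X <->
      stable_iso (dual_op k (tens X joker)) (tens X joker))).
Proof.
split; last first.
  move=> t X; split.
    rewrite /X !iter_SOmega; apply: tens_joker; exact: acyclic_shift (acyclic_Amod hk heps).
  (* For the converse, tensoring once more with J undoes the twist because J (x) J ~ F. *)
  rewrite dual_op_joker; split=> [->|h]; first exact: stable_refl.
  have := stable_tens h (stable_refl joker).
  by rewrite -!stable_assoc joker_square !stable_unitr.
have [x [y [f [[sd ox oy] Zx oxx fx fy]]]] :=
  D8_model rot4_4 rot4_2 (refl4_2 (refl_index k eps)) (rot4_refl4 (refl_index k eps)).
pose pt := @orbit_point k eps; pose ix := @orbit_index k eps hk heps.
(* The dihedral group acts on the labels t of the classes S^t A through its embedding [f] in the
   permutations of Z/4. *)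
pose act (c : orbit_set k eps) (g : 'D_8) := pt (f g (ix c)).
have act1 : act^~ 1%g =1 id.
  by move=> c; rewrite /act morph1 perm1 /pt /ix orbit_indexK.
have actM : forall c, act_morph act c.
  by move=> c g h; rewrite /act morphM ?inE // permM /pt /ix orbit_pointK.
have aA := acyclic_Amod hk heps.
have mod4 n : stable_iso (iter (ord4 n) shift (Amod k eps)) (iter n shift (Amod k eps)).
  by apply: iter_shift_mod => //=; rewrite modn_mod.
exists x, y, (TotalAction act1 actM); split.
- by split.
- move: (@orbit_induces k eps hk heps (f x) SOmega); apply.
    by move=> M N h; rewrite !SOmega_shift h.
  by move=> t; rewrite fx rot4E mod4 SOmega_shift.
- move: (@orbit_induces k eps hk heps (f y) (dual_op k)); apply.
    exact: dual_op_stable.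
  by move=> t; rewrite fy refl4E mod4; apply: stable_sym; exact: dual_op_iter.
- exists (x ^+ 2)%g; split=> //.
  move: (@orbit_induces k eps hk heps (f (x ^+ 2)%g) (fun M => tens M joker)); apply.
    by move=> M N h; rewrite h.
  move=> t; rewrite morphX ?inE // fx expgS expg1 permM !rot4E mod4 /= mod4.
  by apply: stable_sym; apply: tens_joker; exact: acyclic_shift.
have fixE (t : 'I_4) : act (pt t) y = pt t <-> ord4 (3 * (t + refl_index k eps)) = t.
  rewrite /act /ix /pt orbit_pointK fy refl4E.
  by split=> [/(orbit_point_inj hk heps) //|->].
set r := refl_index k eps in fixE *.
have odd_r : odd r = odd k by rewrite /r /refl_index oddD odd_double addbF /= negbK.
have := odd_double_half r; rewrite odd_r; move: r r./2 fixE {odd_r} => r h fixE rh.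
(* The label t is fixed when 3(t + r) = t, that is 2t = r, modulo 4. This is impossible for r odd;
   for r = 2h it means t = h modulo 2, with the solutions h and h + 2. *)
have -> : [set c | TotalAction act1 actM c y = c]%classic =
  ((fun i => pt (ord4 (h + i.*2))) @` `I_(if odd k then 0 else 2))%classic.
  apply/seteqP; split=> [c|c [i /= iI <-]] /=; last first.
    by apply/fixE/val_inj => /=; move: iI rh; case: (odd k) => //=; lia.
  rewrite -(orbit_indexK hk heps c) => /fixE /(congr1 val) /=.
  move: (orbit_index hk heps c) => t e; have t4 := ltn_ord t.
  (* Index 0 stands for t = h modulo 4, index 1 for t = h + 2. *)
  exists ((t != (h %% 4)%N :> nat) : nat); first by move: e rh; case: (odd k) => /=; lia.
  by congr (pt _); apply/val_inj => /=; move: e rh; case: (odd k) => /=; lia.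
apply: inj_card_eq => i j /=; rewrite !inE /= => i2 j2.
move/(orbit_point_inj hk heps)/(congr1 val) => /=.
by move: i2 j2; case: (odd k); lia.
Qed.
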